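(* Let $d\geq 2$ and let $D_1,\dotsc,D_k\subset \mathbb{R}^+$ be arbitrary finite sets. If $t_1,\dotsc,t_k>0$ vary so that the ratios $t_1/t_2,\ t_2/t_3,\ \dotsc,\ t_{k-1}/t_k$ all tend to infinity, then $$m_{\mathbb{R}^d}(t_1\cdot D_1 \cup \dotsb \cup t_k\cdot D_k)\to \prod_{i=1}^k m_{\mathbb{R}^d}(D_i).$$
   Context: $\mathbb{R}^+$ is the set of positive reals and $t\cdot D=\{tx : x\in D\}$. For $D\subset\mathbb{R}^+$, a set $A\subset\mathbb{R}^d$ is $D$-avoiding if no two points of $A$ are at Euclidean distance belonging to $D$. $Q(x,r)$ is the open axis-parallel cube of side length $r$ centered at $x$. For a measurable set $A\subset\mathbb{R}^d$, $|A|$ is its Lebesgue measure and $\bar d(A)=\limsup_{R\to\infty}|A\cap Q(0,R)|/|Q(0,R)|$ is its upper density. $m_{\mathbb{R}^d}(D)=\sup \bar d(A)$, the supremum over all Lebesgue measurable $D$-avoiding sets $A\subset\mathbb{R}^d$. *)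

(* Defs.v *)
From HB Require Import structures.
From mathcomp Require Export all_boot all_order all_algebra.
From mathcomp Require Export all_classical all_reals all_analysis.
Export numFieldNormedType.Exports.

Set Implicit Arguments.
Unset Strict Implicit.
Unset Printing Implicit Defensive.
Import Order.TTheory GRing.Theory Num.Theory.

Local Open Scope classical_set_scope.
Local Open Scope ring_scope.

(* Points of R^d are row vectors; the library norm on 'rV[R]_d is the sup norm,
   so the Euclidean distance has to be spelled out. *)
Definition edist (R : realType) (d : nat) (x y : 'rV[R]_d) : R :=
  Num.sqrt (\sum_(i < d) (x 0 i - y 0 i) ^+ 2).

Definition half_open_box (R : realType) (d : nat) (a b : 'rV[R]_d) :
    set 'rV[R]_d :=
  [set x | forall i, a 0 i < x 0 i <= b 0 i].

Definition box_volume (R : realType) (d : nat) (a b : 'rV[R]_d) : R :=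
  \prod_(i < d) (b 0 i - a 0 i).

(* The condition on the endpoints keeps all volumes nonnegative. It allows empty
   boxes, of volume 0 when d > 0: finite covers can thus be padded. For d = 0
   every box is the whole space, with volume 1, and the definitions below are
   not meaningful. *)
Definition box_cover (R : realType) (d : nat) (A : set 'rV[R]_d) :
    set (nat -> 'rV[R]_d * 'rV[R]_d) :=
  [set I : nat -> 'rV[R]_d * 'rV[R]_d |
           (forall n i, (I n).1 0 i <= (I n).2 0 i) /\
           A `<=` \bigcup_n half_open_box (I n).1 (I n).2].

(* Lebesgue outer measure. The Lebesgue measurable sets are its Caratheodory
   measurable sets, on which it is, by definition, the (complete) Lebesgue
   measure. *)
Definition leb (R : realType) (d : nat) (A : set 'rV[R]_d) : \bar R :=
  ereal_inf [set (\sum_(n <oo) (box_volume (I n).1 (I n).2)%:E)%E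
              | I in box_cover A].

Definition lebesgue_measurable (R : realType) (d : nat) (A : set 'rV[R]_d) :
    Prop :=
  (@leb R d).-caratheodory A.

Definition cube (R : realType) (d : nat) (x : 'rV[R]_d) (r : R) :
    set 'rV[R]_d :=
  [set y | forall i, `|y 0 i - x 0 i| < r / 2].

Definition upper_density (R : realType) (d : nat) (A : set 'rV[R]_d) : \bar R :=
  limf_esup (fun r : R => leb (A `&` cube 0 r) / leb (cube (0 : 'rV[R]_d) r))%E
            +oo.

Definition avoiding (R : realType) (d : nat) (D : set R) (A : set 'rV[R]_d) :
    Prop :=
  forall x y, A x -> A y -> ~ D (edist x y).

Definition max_density (R : realType) (d : nat) (D : set R) : \bar R :=
  ereal_sup [set upper_density A | A in
    [set A : set 'rV[R]_d | lebesgue_measurable A /\ avoiding D A]].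

Definition dilate (R : realType) (t : R) (D : set R) : set R :=
  [set t * x | x in D].

(* Main.v *)
From HB Require Import structures.
Require Import Defs.
From mathcomp Require Import measurable_realfun ring lra zify.
Import Order.TTheory GRing.Theory Num.Theory.
Local Open Scope classical_set_scope.
Local Open Scope ring_scope.

Set Implicit Arguments.
Unset Strict Implicit.
Unset Printing Implicit Defensive.

(* Write m(D) for the maximal density; it is invariant under dilations.
   Lower bound: a D1-avoiding set, intersected with a suitable translate of a
   periodic D2-avoiding set, gives m(D1) m(D2) <= m(D1 U D2).
   Upper bound: by induction on k it is enough to prove, for D finite, that
   m(D U D') <= m(D) m(D') + e as soon as the distances of D' are short enough.
   Let A, contained in a large cube, avoid D U D'. An energy increment argument
   over dyadic cells finds a scale at which almost all cells in which A is dense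
   are regular, i.e. few of their (much smaller) subcells are sparse. In each cell
   A has density at most about m(D'), so one has to bound the number of regular
   dense cells, and for this it is enough that the union of their middles avoids
   D. If x and y lie in the middles of two regular cells and |x - y| = r, then A
   contains two points at distance r, for the following reason. Approximate A by
   a union of cells of a fine lattice, seen as a finite torus, with indicator f.
   Consider integer approximations u(i, c) of vectors of the sphere of radius r,
   close to y - x, obtained by moving one coordinate in steps of constant length
   and solving for another one, say the coordinate m. For i <> j the difference
   u(i, c) - u(j, c), as a function of c, progresses in the direction m by nearly
   constant nonzero steps because the slopes of the sphere differ, so a second
   moment computation shows that, for most (i, c), the function f (. - u(i, c))
   can be replaced with its average over segments in the direction m. These
   averages see every pair of points in matching subcells around x and y, most of
   which are not sparse; hence there are pairs of points of A at distance r. *)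

(** * Lebesgue measure of boxes and affine images *)

(** Two dependencies shape the proof. First, how short the distances of [D'] have to be may depend
    on [D] and on the error, but not on [A] or [D']. The levels [ns i] are therefore fixed
    beforehand, each fine enough for the local statement about all the distances of [D] at the
    previous one; as the energy is at most 1, [A] only selects one among [J] of them. Second, the
    local statement matches subcells with subcells, so two cells in which [A] merely has large
    density are not enough: at least half of the matched pairs must be free of sparse members. Hence
    the notion of regular cell, in which sparse subcells are counted against a cell of the
    intermediate level [n + g]. The curvature of the sphere acts through the lower bound in
    [slope_bounds], a substitute for the decay of the Fourier transform of the spherical measure; a
    second coordinate [l] is needed, hence dimension at least 2. Lattice vectors have length
    [nu * r] only up to rounding; one lattice step of error is harmless because the approximating
    set varies slowly on the lattice. The lower bound needs no separation of scales. *)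

Section OuterMeasure.
Variables (R : realType) (d : nat).
Let V := 'rV[R]_d.+1.
Local Notation leb := (@leb R d.+1).
Local Notation vol I := (box_volume I.1 I.2).

Lemma box_volume_ge0 (a b : V) : (forall i, a 0 i <= b 0 i) -> 0 <= box_volume a b.
Proof. by move=> ab; apply: prodr_ge0 => i _; rewrite subr_ge0. Qed.

Lemma box_volume_diag (a : V) : box_volume a a = 0.
Proof. by rewrite /box_volume big_ord_recl subrr mul0r. Qed.

Lemma half_open_box_diag (a : V) : half_open_box a a = set0.
Proof.
by apply/seteqP; split => // x /(_ ord0) /andP[/lt_le_trans h /h]; rewrite ltxx.
Qed.

Lemma box_cover_vol_ge0 (A : set V) I n : box_cover A I -> (0 <= (vol (I n))%:E)%E.
Proof. by move=> [h _]; rewrite lee_fin box_volume_ge0. Qed.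

Lemma leb_ge0 (A : set V) : (0 <= leb A)%E.
Proof.
apply: le_ereal_inf_tmp => _ [I IA <-]; apply: nneseries_ge0 => n _ _.
exact: box_cover_vol_ge0 IA.
Qed.

Lemma le_leb : {homo leb : A B / A `<=` B >-> (A <= B)%E}.
Proof.
move=> A B AB; apply/ereal_inf_le_tmp => x [I [I1 I2]] <-; exists I => //.
by split => //; apply: subset_trans AB I2.
Qed.

Lemma leb_le_box (a b : V) : (forall i, a 0 i <= b 0 i) ->
  (leb (half_open_box a b) <= (box_volume a b)%:E)%E.
Proof.
move=> ab; apply: ereal_inf_lbound.
exists (fun n => if n is 0%N then (a, b) else (0, 0)).
  split; first by case.
  by move=> x xab; exists 0%N.
rewrite (nneseries_split _ 1)//; last first.
  by move=> [|k] _ /=; rewrite lee_fin ?box_volume_diag// box_volume_ge0.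
rewrite big_nat1 eseries0 ?adde0// => -[|k] //= _ _.
by rewrite box_volume_diag.
Qed.

Lemma leb0 : leb set0 = 0%E.
Proof.
apply/eqP; rewrite eq_le leb_ge0 andbT.
by have := @leb_le_box 0 0 (fun=> lexx _); rewrite half_open_box_diag box_volume_diag.
Qed.

Lemma leb_sigma_subadditive : sigma_subadditive leb.
Proof.
move=> A; have [[i ioo]|] := pselect (exists i, leb (A i) = +oo%E).
  rewrite (eseries_pinfty _ _ ioo) ?leey// => n _.
  by rewrite -ltNye (lt_le_trans _ (leb_ge0 _)).
rewrite -forallNE => Aoo; apply/lee_addgt0Pr => e e0.
apply: le_trans (epsilon_trick _ _ (ltW e0)); last by move=> n; exact: leb_ge0.
have [G PG] : {G : nat -> nat -> V * V & forall n, box_cover (A n) (G n) /\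
   (\sum_(k <oo) (vol (G n k))%:E <= leb (A n) + (e / (2 ^ n.+1)%:R)%:E)%E}.
  apply: (@choice _ _ (fun n (B : nat -> V * V) => box_cover (A n) B /\
   (\sum_(k <oo) (vol (B k))%:E <= leb (A n) + (e / (2 ^ n.+1)%:R)%:E)%E)) => n.
  have en : 0 < e / (2 ^ n.+1)%:R by rewrite divr_gt0// ltr0n expn_gt0.
  have fA : leb (A n) \is a fin_num.
    by rewrite ge0_fin_numE ?leb_ge0// ltey; apply/eqP/Aoo.
  have [_ [B AB <-] lt] := lb_ereal_inf_adherent en fA.
  by exists B; split => //; exact: ltW.
(* The covers are merged along a bijection of [nat] with [nat * nat]; unordered sums justify the
   rearrangement. *)
pose v (p : nat * nat) := (vol (G p.1 p.2))%:E.
have v0 p : (0 <= v p)%E by exact: box_cover_vol_ge0 (PG _).1.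
apply: (@le_trans _ _ (\esum_(i in setT) v i)).
  apply: ereal_inf_lbound => /=.
  have /card_esym/ppcard_eqP[f] := card_nat2.
  exists (fun n => G (f n).1 (f n).2).
    split=> [n|x [n _] /((PG n).1.2) [k _ xk]]; first exact: (PG (f n).1).1.1.
    by exists (f^-1%FUN (n, k)) => //=; rewrite invK ?inE.
  rewrite nneseries_esumT; last by move=> n; exact: v0.
  by rewrite [RHS](@reindex_esum _ _ _ setT _ f)//; exact: bijT.
have -> : \esum_(i in setT) v i = (\sum_(n <oo) \sum_(k <oo) (vol (G n k))%:E)%E.
  rewrite nneseries_esumT; last by move=> n; apply: nneseries_ge0 => k _ _; exact: (v0 (n, k)).
  rewrite (eq_esum (b := fun n => \esum_(k in setT) (vol (G n k))%:E)); last first.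
    by move=> n _; rewrite nneseries_esumT// => k; exact: (v0 (n, k)).
  rewrite esum_esum; last by move=> i j _ _; exact: (v0 (i, j)).
  by congr esum; apply/seteqP; split.
apply: lee_nneseries => n *; last exact: (PG n).2.
by apply: nneseries_ge0 => k _ _; exact: (v0 (n, k)).
Qed.

(** This makes the library theory of Caratheodory measurable sets apply to [lebesgue_measurable]. *)
HB.instance Definition _ := isOuterMeasure.Build R V leb leb0 leb_ge0 le_leb
  leb_sigma_subadditive.

End OuterMeasure.

(** * The measure of a box is its volume *)

Section LebBox.
Variables (R : realType) (d : nat).
Let V := 'rV[R]_d.+1.
Local Notation leb := (@leb R d.+1).
Local Notation vol I := (box_volume I.1 I.2).
Local Notation mu := (@lebesgue_measure R).

Definition upd (x : V) (i : 'I_d.+1) (v : R) : V :=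
  \row_j if j == i then v else x 0 j.

(* The integral of the indicator of the box over its first [k] coordinates. *)
Let part (k : nat) (x a b : V) : R :=
  \prod_(i < d.+1) (if (i < k)%N then b 0 i - a 0 i
                    else \1_(`]a 0 i, b 0 i]%classic) (x 0 i)).

Let part_ge0 k (x a b : V) : (forall i, a 0 i <= b 0 i) -> 0 <= part k x a b.
Proof.
move=> ab; apply: prodr_ge0 => i _; case: ifP => _; rewrite ?subr_ge0//.
Qed.

Let lebesgue_measure_oc (a b : R) : a <= b -> mu `]a, b]%classic = (b - a)%:E.
Proof.
move=> ab; rewrite lebesgue_measure_itv/= lte_fin; case: ltP => // ba.
by have /eqP -> : a == b; rewrite ?subrr// eq_le ab ba.
Qed.

Let part_upd k (x a b : V) (kd : (k < d.+1)%N) t :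
  part k (upd x (Ordinal kd) t) a b =
  (\prod_(i < d.+1 | i != Ordinal kd) (if (i < k)%N then b 0 i - a 0 i
     else \1_(`]a 0 i, b 0 i]%classic) (x 0 i))) *
   \1_(`]a 0 (Ordinal kd), b 0 (Ordinal kd)]%classic) t.
Proof.
rewrite /part (bigD1 (Ordinal kd))//= ltnn mxE eqxx mulrC; congr (_ * _).
by apply: eq_bigr => i /negbTE ik; rewrite mxE ik.
Qed.

Let integral_part k (x a b : V) (kd : (k < d.+1)%N) : (forall i, a 0 i <= b 0 i) ->
  (\int[mu]_t (part k (upd x (Ordinal kd) t) a b)%:E = (part k.+1 x a b)%:E)%E.
Proof.
move=> ab; under eq_integral do rewrite part_upd EFinM.
rewrite ge0_integralZl_EFin//; first last.
- apply: prodr_ge0 => i _; case: ifP => _; rewrite ?subr_ge0//.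
- by apply/measurable_EFinP.
have -> : (\int[mu]_t (\1_(`]a 0 (Ordinal kd), b 0 (Ordinal kd)]%classic : set R) t)%:E =
    (b 0 (Ordinal kd) - a 0 (Ordinal kd))%:E)%E.
  by rewrite integral_indic//= setIT; exact: lebesgue_measure_oc.
rewrite -EFinM /part; congr EFin; rewrite [RHS](bigD1 (Ordinal kd))//= ltnSn mulrC.
congr (_ * _); apply: eq_bigr => i ik; rewrite ltnS [(i <= k)%N]leq_eqVlt.
by rewrite -(inj_eq val_inj)/= in ik; rewrite (negbTE ik).
Qed.

Let measurable_part k (x a b : V) (kd : (k < d.+1)%N) :
  measurable_fun setT (fun t => (part k (upd x (Ordinal kd) t) a b)%:E).
Proof.
apply/measurable_EFinP; under eq_fun do rewrite part_upd.
by apply: measurable_funM.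
Qed.

(** The indicator of the box is at most the sum of the indicators of the covering boxes. Integrating
    this inequality one coordinate at a time against the one-dimensional Lebesgue measure, with
    monotone convergence for the series, turns indicators into volumes; no compactness is
    involved. *)
Lemma box_volume_le_cover (a b : V) I : (forall i, a 0 i <= b 0 i) ->
  box_cover (half_open_box a b) I ->
  ((box_volume a b)%:E <= \sum_(n <oo) (vol (I n))%:E)%E.
Proof.
move=> ab [oI sub].
have key k : (k <= d.+1)%N -> forall x,
  ((part k x a b)%:E <= \sum_(n <oo) (part k x (I n).1 (I n).2)%:E)%E.
  elim: k => [_ x|k IH kd x].
    have := @part_ge0 0 x _ _ ab; rewrite le_eqVlt => /orP[/eqP <-|h].
      by apply: nneseries_ge0 => n _ _; rewrite lee_fin part_ge0.
    have boxP (a' b' : V) : half_open_box a' b' x -> part 0 x a' b' = 1.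
      move=> xab; rewrite /part big1// => i _; rewrite indicE mem_set//=.
      by rewrite in_itv/= xab.
    have xab : half_open_box a b x.
      move=> i; apply: contraPT h => xi.
      rewrite /part (bigD1 i)//= indicE memNset ?mul0r ?ltxx//= in_itv/=.
      exact/negP.
    have [n _ xn] := sub _ xab.
    rewrite (boxP _ _ xab) -(boxP _ _ xn) (nneseries_split _ n.+1)//; last first.
      by move=> m _; rewrite lee_fin part_ge0.
    rewrite big_nat_recr//= -addeA [leRHS]addeC -addeA leeDl// adde_ge0//.
      by apply: nneseries_ge0 => m _ _; rewrite lee_fin part_ge0.
    by apply: sume_ge0 => m _; rewrite lee_fin part_ge0.
  rewrite -(integral_part x kd ab).
  rewrite (eq_eseriesr (fun n _ => esym (integral_part x kd (oI n)))).
  rewrite -integral_nneseries//; first last.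
  - by move=> n t _; rewrite lee_fin part_ge0.
  - by move=> n; exact: measurable_part.
  apply: ge0_le_integral => //.
  - by move=> t _; rewrite lee_fin part_ge0.
  - exact: measurable_part.
  - apply: ge0_emeasurable_sum => [n t _ _|n _]; last exact: measurable_part.
    by rewrite lee_fin part_ge0.
  - by move=> t _; apply: IH; exact: ltnW.
have partd (a' b' : V) : part d.+1 0 a' b' = box_volume a' b'.
  by apply: eq_bigr => i _; rewrite ltn_ord.
have := key d.+1 (leqnn _) 0; rewrite partd => /le_trans; apply.
by rewrite (eq_eseriesr (fun n _ => congr1 EFin (partd _ _))).
Qed.

Lemma leb_box (a b : V) : (forall i, a 0 i <= b 0 i) ->
  leb (half_open_box a b) = (box_volume a b)%:E.
Proof.
move=> ab; apply/eqP; rewrite eq_le leb_le_box//=.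
by apply: le_ereal_inf_tmp => _ [I Icov <-]; exact: box_volume_le_cover.
Qed.

End LebBox.

(** * Measurability of boxes, dilations and translations *)

Section LebMeasurable.
Variables (R : realType) (d : nat).
Let V := 'rV[R]_d.+1.
Local Notation leb := (@leb R d.+1).
Local Notation vol I := (box_volume I.1 I.2).
Local Notation meas := (@lebesgue_measurable R d.+1).

(** Cutting each box of a cover of [X] along the hyperplane gives covers of the two pieces of [X]
    with the same total volume. *)
Lemma measurable_half_space (i : 'I_d.+1) (c : R) : meas [set x : V | x 0 i <= c].
Proof.
apply: le_caratheodory_measurable => X; set H := [set x : V | _].
apply: le_ereal_inf_tmp => _ [I [oI XI] <-].
(* The height [c] clamped to the side of the box: both halves stay admissible boxes, one of them
   possibly empty. *)
pose m n := Num.max ((I n).1 0 i) (Num.min c ((I n).2 0 i)).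
have am n : (I n).1 0 i <= m n by rewrite le_max lexx.
have mb n : m n <= (I n).2 0 i by rewrite ge_max oI ge_min lexx orbT.
pose I1 n := ((I n).1, upd (I n).2 i (m n)).
pose I2 n := (upd (I n).1 i (m n), (I n).2).
have volD n : vol (I n) = vol (I1 n) + vol (I2 n).
  have volE (a b : V) : box_volume a b =
      (b 0 i - a 0 i) * \prod_(j < d.+1 | j != i) (b 0 j - a 0 j).
    by rewrite /box_volume (bigD1 i).
  rewrite !volE /= !mxE eqxx.
  set p := \prod_(j < d.+1 | _) _.
  have -> : \prod_(j < d.+1 | j != i) ((upd (I n).2 i (m n)) 0 j - (I n).1 0 j) = p.
    by apply: eq_bigr => j /negbTE ji; rewrite mxE ji.
  have -> : \prod_(j < d.+1 | j != i) ((I n).2 0 j - (upd (I n).1 i (m n)) 0 j) = p.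
    by apply: eq_bigr => j /negbTE ji; rewrite mxE ji.
  by rewrite -mulrDl; congr (_ * _); ring.
have c1 : box_cover (X `&` H) I1.
  split=> [n j|x [Xx Hx]] /=; first by rewrite mxE; case: eqP => [->|].
  have [n _ xn] := XI _ Xx; exists n => // j /=; rewrite mxE.
  have /andP[h1 h2] := xn j; rewrite h1/=; case: eqP => [->|//].
  by rewrite /m le_max le_min (Hx : x 0 i <= c) (andP (xn i)).2 orbT.
have c2 : box_cover (X `&` ~` H) I2.
  split=> [n j|x [Xx Hx]] /=; first by rewrite mxE; case: eqP => [->|].
  have [n _ xn] := XI _ Xx; exists n => // j /=; rewrite mxE.
  have /andP[h1 h2] := xn j; rewrite h2 andbT; case: eqP => [ji|//].
  rewrite ji in h1 *; rewrite /m gt_max h1/= gt_min; apply/orP; left.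
  by rewrite ltNge; exact/negP.
rewrite (@eq_eseriesr _ _ (fun n => (vol (I1 n))%:E + (vol (I2 n))%:E)%E); last first.
  by move=> n _; rewrite volD EFinD.
rewrite nneseriesD; first last.
- by move=> n _ _; exact: box_cover_vol_ge0 c2.
- by move=> n _ _; exact: box_cover_vol_ge0 c1.
by apply: leeD; apply: ereal_inf_lbound; [exists I1|exists I2].
Qed.

Lemma measurable_box (a b : V) : meas (half_open_box a b).
Proof.
pose F i := [set x : V | x 0 i <= b 0 i] `\` [set x : V | x 0 i <= a 0 i].
have memF s x : (\big[setI/setT]_(i <- s) F i) x <-> forall i, i \in s -> F i x.
  elim: s => [|i s IH]; first by rewrite big_nil.
  rewrite big_cons; split=> [[xi /IH h] j|h].
    by rewrite inE => /predU1P[->|/h].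
  split; first by apply: h; rewrite mem_head.
  by apply/IH => j js; apply: h; rewrite inE js orbT.
have -> : half_open_box a b = \big[setI/setT]_(i < d.+1) F i.
  apply/seteqP; split=> x; rewrite memF => h i.
    by have /andP[h1 h2] := h i; split => //=; apply/negP; rewrite -ltNge.
  by have [h2 /negP] := h i (mem_index_enum _); rewrite -ltNge /= => ->.
apply: (big_ind meas); first by rewrite -setC0; apply: caratheodory_measurable_setC;
  exact: caratheodory_measurable_set0.
  exact: caratheodory_measurable_setI.
by move=> i _; apply: caratheodory_measurable_setD; exact: measurable_half_space.
Qed.

(** The set [t A + v], given through the inverse map so that membership unfolds by computation. *)
Definition affine (t : R) (v : V) (A : set V) : set V := [set x | A (t^-1 *: (x - v))].

Lemma leb_affine_le (t : R) v A : 0 < t -> (leb (affine t v A) <= (t ^+ d.+1)%:E * leb A)%E.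
Proof.
move=> t0.
have td : 0 < t ^+ d.+1 by rewrite exprn_gt0.
rewrite -lee_pdivrMl//; apply: le_ereal_inf_tmp => _ [I [oI AI] <-].
rewrite lee_pdivrMl//.
rewrite -nneseriesZl; last by move=> n _; rewrite lee_fin box_volume_ge0.
apply: ereal_inf_lbound; exists (fun n => (t *: (I n).1 + v, t *: (I n).2 + v)).
  split=> [n i|x /AI [n _ xn]] /=; first by rewrite !mxE lerD2r ler_pM2l.
  exists n => // i; have := xn i; rewrite /= !mxE.
  by rewrite ltr_pdivlMl// ler_pdivrMl// ltrBrDr lerBlDr.
apply: eq_eseriesr => n _; rewrite -EFinM; congr EFin.
rewrite /box_volume -[X in t ^+ X]card_ord -prodr_const -big_split/=.
by apply: eq_bigr => i _; rewrite !mxE; ring.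
Qed.

Lemma affineK (t : R) (v : V) A : t != 0 -> affine t^-1 (- (t^-1 *: v)) (affine t v A) = A.
Proof.
move=> t0; apply/funext => x; rewrite /affine/= invrK opprK; congr (A _).
by apply/rowP => i; rewrite !mxE; field.
Qed.

Lemma leb_affine (t : R) v A : 0 < t -> leb (affine t v A) = ((t ^+ d.+1)%:E * leb A)%E.
Proof.
move=> t0; have td : 0 < t ^+ d.+1 by rewrite exprn_gt0.
apply/eqP; rewrite eq_le leb_affine_le//=.
rewrite -{1}(affineK v A (lt0r_neq0 t0)) muleC -lee_pdivlMr//.
by rewrite (le_trans (leb_affine_le _ _ _)) ?invr_gt0// exprVn muleC.
Qed.

Lemma measurable_affine (t : R) v A : 0 < t -> meas A -> meas (affine t v A).
Proof.
move=> t0 mA X; have tn : t != 0 by exact: lt0r_neq0.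
have t0' : 0 < t^-1 by rewrite invr_gt0.
(* Every test set is an affine image, so the Caratheodory identity of [A] is applied to the preimage
   [X']. *)
have eX Y : Y = affine t v (affine t^-1 (- (t^-1 *: v)) Y).
  have := affineK (- (t^-1 *: v)) Y (lt0r_neq0 t0').
  by rewrite invrK scalerN scalerA mulfV// scale1r opprK => ->.
set X' := affine t^-1 (- (t^-1 *: v)) X.
have e1 : X `&` affine t v A = affine t v (X' `&` A) by rewrite {1}(eX X).
have e2 : X `&` ~` affine t v A = affine t v (X' `&` ~` A) by rewrite {1}(eX X).
rewrite e1 e2 [in LHS](eX X) -/X'.
rewrite (leb_affine v X' t0) (leb_affine v (X' `&` A) t0) (leb_affine v (X' `&` ~` A) t0).
have -> := mA X'.
by rewrite ge0_muleDr ?leb_ge0.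
Qed.

End LebMeasurable.

Section RealLeb.
Variables (R : realType) (d : nat).
Let V := 'rV[R]_d.+1.
Local Notation leb := (@leb R d.+1).
Local Notation meas := (@lebesgue_measurable R d.+1).

(* Junk value 0 on sets of infinite measure. *)
Definition rleb (A : set V) : R := fine (leb A).

Definition finm (A : set V) := (leb A < +oo)%E.

Lemma rlebK A : finm A -> leb A = (rleb A)%:E.
Proof. by move=> fA; rewrite fineK// ge0_fin_numE ?leb_ge0. Qed.

Lemma rleb_ge0 A : 0 <= rleb A.
Proof. by rewrite fine_ge0 ?leb_ge0. Qed.

Lemma finmS A B : A `<=` B -> finm B -> finm A.
Proof. by move=> /le_leb /le_lt_trans; apply. Qed.

Lemma finm_box (a b : V) : (forall i, a 0 i <= b 0 i) -> finm (half_open_box a b).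
Proof. by move=> ab; rewrite /finm leb_box// ltry. Qed.

Lemma le_rleb A B : A `<=` B -> finm B -> rleb A <= rleb B.
Proof.
move=> AB fB; have fA := finmS AB fB.
by rewrite -lee_fin -!rlebK// le_leb.
Qed.

Lemma lebU A B : (leb (A `|` B) <= leb A + leb B)%E.
Proof. exact: outer_measureU2. Qed.

Lemma finmU A B : finm A -> finm B -> finm (A `|` B).
Proof.
move=> fA fB; apply: le_lt_trans (lebU _ _) _.
by rewrite !rlebK// -EFinD ltry.
Qed.

Lemma rlebU A B : finm A -> finm B -> rleb (A `|` B) <= rleb A + rleb B.
Proof.
move=> fA fB; rewrite -lee_fin EFinD -!rlebK//; last exact: finmU.
exact: lebU.
Qed.

Lemma rleb0 : rleb set0 = 0.
Proof. by rewrite /rleb leb0. Qed.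

Lemma rleb_split C A : meas C -> finm A -> rleb A = rleb (A `&` C) + rleb (A `\` C).
Proof.
move=> mC fA; apply/EFin_inj; rewrite EFinD.
have f1 : finm (A `&` C) by apply: finmS fA; apply: subIset; left.
have f2 : finm (A `\` C) by apply: finmS fA; apply: subIset; left.
by rewrite -!rlebK//; exact: mC.
Qed.

Lemma rleb_box (a b : V) : (forall i, a 0 i <= b 0 i) ->
  rleb (half_open_box a b) = box_volume a b.
Proof. by move=> ab; rewrite /rleb leb_box. Qed.

Lemma finm_affine (t : R) v A : 0 < t -> finm A -> finm (affine t v A).
Proof. by move=> t0 fA; rewrite /finm leb_affine// rlebK// -EFinM ltry. Qed.

Lemma rleb_affine (t : R) v A : 0 < t -> finm A ->
  rleb (affine t v A) = t ^+ d.+1 * rleb A.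
Proof. by move=> t0 fA; rewrite /rleb leb_affine// rlebK. Qed.

Lemma rleb_bigcup_le (I : finType) (P : pred I) (F : I -> set V) A :
  A `<=` [set x | exists2 i, P i & F i x] -> (forall i, P i -> finm (F i)) ->
  rleb A <= \sum_(i | P i) rleb (F i).
Proof.
move=> AF fF.
pose U := \big[setU/set0]_(i | P i) F i.
have AU : A `<=` U.
  by move=> x /AF [i Pi Fi]; rewrite /U (bigD1 i)//=; left.
suff [fU leU] : finm U /\ rleb U <= \sum_(i | P i) rleb (F i).
  by apply: le_trans leU; exact: le_rleb.
apply: (big_ind2 (fun X y => finm X /\ rleb X <= y)).
- by split; rewrite ?rleb0// /finm leb0.
- move=> X x Y y [fX Xx] [fY Yy]; split; first exact: finmU.
  by rewrite (le_trans (rlebU _ _))// lerD.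
- by move=> i /fF.
Qed.

(** Only the pieces [F i] are measurable: the Caratheodory condition splits the arbitrary set [A]
    one piece after the other. *)
Lemma rleb_sum_disj_le (I : finType) (P : pred I) (F : I -> set V) A :
  finm A -> (forall i, P i -> meas (F i)) ->
  (forall i j x, P i -> P j -> F i x -> F j x -> i = j) ->
  \sum_(i | P i) rleb (A `&` F i) <= rleb A.
Proof.
move=> fA mF dF; rewrite -big_filter.
have : uniq [seq i <- index_enum I | P i] by rewrite filter_uniq// index_enum_uniq.
have : forall i, i \in [seq i <- index_enum I | P i] -> P i.
  by move=> i; rewrite mem_filter => /andP[].
elim: [seq i <- index_enum I | P i] A fA => [|i s IH] A fA sP /=.
  by move=> _; rewrite big_nil rleb_ge0.
move=> /andP[nis us]; rewrite big_cons.
have Pi : P i by apply: sP; rewrite mem_head.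
rewrite (rleb_split (mF i Pi) fA) lerD2l.
have sP' j : j \in s -> P j by move=> js; rewrite sP// inE js orbT.
apply: le_trans (IH _ _ sP' us); last by apply: finmS fA; apply: subIset; left.
rewrite !big_seq; apply: ler_sum => j js; apply: le_rleb.
  move=> x [Ax Fj]; split => //; split => // Fi.
  have ij : i = j by apply: dF Pi (sP' _ js) Fi Fj.
  by move: nis; rewrite ij js.
by apply: finmS fA => x [] [].
Qed.

Lemma rleb_sum_disj (I : finType) (P : pred I) (F : I -> set V) A :
  finm A -> (forall i, P i -> meas (F i)) ->
  (forall i j x, P i -> P j -> F i x -> F j x -> i = j) ->
  A `<=` [set x | exists2 i, P i & F i x] ->
  \sum_(i | P i) rleb (A `&` F i) = rleb A.
Proof.
move=> fA mF dF AF; apply/eqP; rewrite eq_le rleb_sum_disj_le//=.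
apply: rleb_bigcup_le => [x Ax|i Pi]; last by apply: finmS fA; apply: subIset; left.
by have [i Pi Fi] := AF _ Ax; exists i.
Qed.

End RealLeb.

(** * Cells of a grid and dyadic approximation *)

Section Cells.
Variables (R : realType) (d : nat).
Let V := 'rV[R]_d.+1.
Local Notation meas := (@lebesgue_measurable R d.+1).
Implicit Types (w : R) (c : 'I_d.+1 -> int) (x : V).

Definition cell w c : set V :=
  half_open_box (\row_i (w * (c i)%:~R)) (\row_i (w * (c i + 1)%:~R)).

Lemma cellP w c x : cell w c x <-> forall i, w * (c i)%:~R < x 0 i <= w * (c i + 1)%:~R.
Proof. by split=> h i; have := h i; rewrite !mxE. Qed.

Let cell_le w c i : 0 < w -> (\row_i (w * (c i)%:~R) : V) 0 i <= (\row_i (w * (c i + 1)%:~R) : V) 0 i.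
Proof. by move=> w0; rewrite !mxE ler_pM2l// ler_int lerDl. Qed.

Lemma measurable_cell w c : meas (cell w c).
Proof. exact: measurable_box. Qed.

Lemma finm_cell w c : 0 < w -> finm (cell w c).
Proof. by move=> w0; apply: finm_box => i; exact: cell_le. Qed.

Lemma rleb_cell w c : 0 < w -> rleb (cell w c) = w ^+ d.+1.
Proof.
move=> w0; rewrite rleb_box; last by move=> i; exact: cell_le.
rewrite /box_volume -[X in w ^+ X]card_ord -prodr_const; apply: eq_bigr => i _.
by rewrite !mxE intrD; ring.
Qed.

Lemma cell_coord_inj w (a b : int) (x : R) : 0 < w ->
  w * a%:~R < x -> x <= w * (a + 1)%:~R -> w * b%:~R < x -> x <= w * (b + 1)%:~R -> a = b.
Proof.
move=> w0 h1 h2 h3 h4.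
have := lt_le_trans h1 h4; have := lt_le_trans h3 h2.
rewrite !ltr_pM2l// !ltr_int; lia.
Qed.

Lemma cell_inj w c c' x : 0 < w -> cell w c x -> cell w c' x -> c = c'.
Proof.
move=> w0 /cellP h1 /cellP h2; apply/funext => i.
have /andP[a1 a2] := h1 i; have /andP[b1 b2] := h2 i.
exact: (cell_coord_inj w0 a1 a2 b1 b2).
Qed.

(** Cells are open on the left and closed on the right, hence a ceiling minus one rather than a
    floor. *)
Definition cell_index w x : 'I_d.+1 -> int := fun i => Num.ceil (x 0 i / w) - 1.

Lemma cell_indexP w x : 0 < w -> cell w (cell_index w x) x.
Proof.
move=> w0; apply/cellP => i; rewrite /cell_index subrK.
have /andP[h1 h2] := ceil_itv (x 0 i / w).
by rewrite mulrC -ltr_pdivlMr// h1 mulrC -ler_pdivrMr.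
Qed.

Lemma affine_cell w c (k : 'I_d.+1 -> int) : 0 < w ->
  affine 1 (\row_i (w * (k i)%:~R)) (cell w c) = cell w (fun i => c i + k i).
Proof.
move=> w0; rewrite /affine; apply/seteqP; split=> x /cellP h; apply/cellP => i; have := h i.
  by rewrite invr1 !mxE mul1r !intrD !mulrDr => /andP[? ?]; apply/andP; split; lra.
by rewrite invr1 !mxE mul1r !intrD !mulrDr => /andP[? ?]; apply/andP; split; lra.
Qed.

(** Says that [S] is a union of cells without naming their indices, which makes intersection and
    refinement immediate. *)
Definition grid_set w (S : set V) := forall c x y, cell w c x -> cell w c y -> S x -> S y.

Lemma grid_setI w S T : grid_set w S -> grid_set w T -> grid_set w (S `&` T).
Proof. by move=> hS hT c x y cx cy [/(hS c x y cx cy) ? /(hT c x y cx cy) ?]. Qed.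

Lemma grid_set_box w (a b : 'I_d.+1 -> int) : 0 < w ->
  grid_set w (half_open_box (\row_i (w * (a i)%:~R)) (\row_i (w * (b i)%:~R))).
Proof.
move=> w0 c x y /cellP cx /cellP cy h i; have := h i; rewrite !mxE => /andP[h1 h2].
have /andP[x1 x2] := cx i; have /andP[y1 y2] := cy i.
have := lt_le_trans h1 x2; have := lt_le_trans x1 h2.
rewrite !ltr_pM2l// !ltr_int => cb ac; apply/andP; split.
  by apply: le_lt_trans y1; rewrite ler_pM2l// ler_int; lia.
by apply: le_trans y2 _; rewrite ler_pM2l// ler_int; lia.
Qed.

Lemma cell_refine w (k : nat) c : 0 < w -> (0 < k)%N ->
  cell (w / k%:R) c `<=` cell w (fun i => (c i %/ k)%Z).
Proof.
move=> w0 k0 x /cellP h; apply/cellP => i; have /andP[h1 h2] := h i.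
have kR : 0 < k%:R :> R by rewrite ltr0n.
have e := divz_eq (c i) k; have l1 : (0 <= c i %% k)%Z by rewrite modz_ge0//; lia.
have l2 : (c i %% k < k)%Z by apply: ltz_pmod; lia.
have eq1 (a : int) : w / k%:R * a%:~R = w * (a%:~R / k%:R) by ring.
apply/andP; split.
  apply: le_lt_trans h1; rewrite eq1 ler_pM2l// ler_pdivlMr// -[k%:R]/(k%:~R) -intrM ler_int; lia.
apply: le_trans h2 _; rewrite eq1 ler_pM2l// ler_pdivrMr// -[k%:R]/(k%:~R) -intrM ler_int; lia.
Qed.

Lemma grid_set_refine w (k : nat) S : 0 < w -> (0 < k)%N -> grid_set w S -> grid_set (w / k%:R) S.
Proof.
move=> w0 k0 hS c x y /(cell_refine w0 k0) cx /(cell_refine w0 k0) cy; exact: hS cx cy.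
Qed.

End Cells.

(** * Approximation of measurable sets by unions of dyadic cells *)

Section DyadicApprox.
Variable R : realType.

Lemma prodr_perturb n (l : 'I_n -> R) (e : R) : (forall i, 0 <= l i) -> 0 < e ->
  exists2 dl, 0 < dl & forall l' : 'I_n -> R, (forall i, 0 <= l' i <= l i + dl) ->
    \prod_(i < n) l' i <= \prod_(i < n) l i + e.
Proof.
elim: n l e => [|n IH] l e l0 e0.
  by exists 1 => // l' _; rewrite !big_ord0 lerDl ltW.
have ln := l0 ord_max.
set P := \prod_(i < n) l (widen_ord (leqnSn n) i).
have P0 : 0 <= P by apply: prodr_ge0.
have e1 : 0 < e / (2 * (l ord_max + 1)) by rewrite divr_gt0// mulr_gt0//; lra.
have e2 : 0 < e / (2 * (P + 1)) by rewrite divr_gt0// mulr_gt0//; lra.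
have [d1 d10 hd] := IH (fun i => l (widen_ord (leqnSn n) i)) _ (fun i => l0 _) e1.
exists (Num.min d1 (Num.min 1 (e / (2 * (P + 1))))).
  by rewrite !lt_min d10 ltr01 e2.
move=> l' hl'; rewrite !big_ord_recr/= -/P.
have h1 : \prod_(i < n) l' (widen_ord (leqnSn n) i) <= P + e / (2 * (l ord_max + 1)).
  apply: hd => i; have /andP[-> /le_trans] /= := hl' (widen_ord (leqnSn n) i); apply.
  by rewrite lerD2l ge_min lexx.
have /andP[h2 h3] := hl' ord_max.
set dl := Num.min _ _ in h3.
have dl1 : dl <= 1 by rewrite /dl !ge_min lexx !orbT.
have dl2 : dl <= e / (2 * (P + 1)) by rewrite /dl !ge_min lexx !orbT.
apply: le_trans (ler_pM _ h2 h1 h3) _.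
  by apply: prodr_ge0 => i _; have /andP[] := hl' (widen_ord (leqnSn n) i).
have -> : (P + e / (2 * (l ord_max + 1))) * (l ord_max + dl) =
  P * l ord_max + P * dl + e / (2 * (l ord_max + 1)) * (l ord_max + dl) by ring.
rewrite -addrA lerD2l.
have a1 : e / (2 * (l ord_max + 1)) * (l ord_max + dl) <= e / 2.
  rewrite (_ : e / 2 = e / (2 * (l ord_max + 1)) * (l ord_max + 1)); last by field; lra.
  by rewrite ler_pM2l// lerD2l.
have a2 : P * dl <= e / 2.
  apply: le_trans (_ : P * (e / (2 * (P + 1))) <= _); first by rewrite ler_wpM2l.
  rewrite (_ : e / 2 = (P + 1) * (e / (2 * (P + 1)))); last by field; lra.
  by rewrite ler_pM2r//; lra.
lra.
Qed.

Lemma ex_pow2_small (L dl : R) : 0 < dl -> exists q : nat, L / (2 ^ q)%:R <= dl.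
Proof.
move=> dl0; exists (Num.bound (L / dl)).
have h := @upper_nthrootP R (L / dl) (Num.bound (L / dl)) (leqnn _).
rewrite natrX ler_pdivrMr ?exprn_gt0// mulrC -ler_pdivrMr//; exact: ltW.
Qed.

Variable d : nat.
Let V := 'rV[R]_d.+1.
Local Notation meas := (@lebesgue_measurable R d.+1).
Local Notation grid w a := (\row_i (w * (a i)%:~R) : V).

Lemma dyadic_box_enlarge (L : R) (a b : V) e : 0 < L -> (forall i, a 0 i <= b 0 i) -> 0 < e ->
  exists q : nat, exists a' b' : 'I_d.+1 -> int,
   [/\ forall i, L / (2 ^ q)%:R * (a' i)%:~R <= a 0 i,
       forall i, b 0 i <= L / (2 ^ q)%:R * (b' i)%:~R &
       box_volume (grid (L / (2 ^ q)%:R) a') (grid (L / (2 ^ q)%:R) b') <= box_volume a b + e].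
Proof.
move=> L0 ab e0.
have l0 i : 0 <= b 0 i - a 0 i by rewrite subr_ge0.
have [dl dl0 hdl] := prodr_perturb l0 e0.
(* Rounding both ends outwards lengthens a side by at most two grid steps, hence [dl / 2]. *)
have [q hq] := @ex_pow2_small L (dl / 2) (divr_gt0 dl0 (ltr0Sn _ _)).
set w := L / (2 ^ q)%:R in hq *.
have w0 : 0 < w by rewrite divr_gt0// ltr0n expn_gt0.
exists q, (fun i => Num.floor (a 0 i / w)), (fun i => Num.ceil (b 0 i / w)).
have ha i : w * (Num.floor (a 0 i / w))%:~R <= a 0 i < w * (Num.floor (a 0 i / w))%:~R + w.
  have /andP[] := floor_itv (a 0 i / w); rewrite ler_pdivlMr// ltr_pdivrMr// mulrC => -> /=.
  by rewrite intrD mulrDl mul1r mulrC.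
have hb i : b 0 i <= w * (Num.ceil (b 0 i / w))%:~R < b 0 i + w.
  have /andP[h1 h2] := ceil_itv (b 0 i / w).
  rewrite intrB ltr_pdivlMr// in h1; rewrite ler_pdivrMr// in h2.
  by apply/andP; split; lra.
split=> [i|i|]; first by have /andP[] := ha i.
  by have /andP[] := hb i.
apply: hdl => i; rewrite !mxE; have /andP[h1 h2] := ha i; have /andP[h3 h4] := hb i.
have abi := ab i; rewrite -/w; apply/andP; split; lra.
Qed.

(** A cover of nearly optimal volume is rounded outwards to dyadic boxes and truncated. The part of
    [A] that is lost is covered by the tail of a convergent series, and the excess is at most that
    of the whole cover. Dyadic grids are nested, so finitely many boxes share the finest of their
    grids. *)
Lemma dyadic_approx (L : R) (A : set V) e : 0 < L -> meas A -> A `<=` cell L (fun=> 0) -> 0 < e ->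
  exists q : nat, exists S : set V, [/\ grid_set (L / (2 ^ q)%:R) S,
    S `<=` cell L (fun=> 0), rleb (A `\` S) <= e & rleb (S `\` A) <= e].
Proof.
move=> L0 mA AL e0.
have fA : finm A by apply: finmS AL _; exact: finm_cell.
have e20 : 0 < e / 2 by rewrite divr_gt0.
have fA' : leb A \is a fin_num by rewrite ge0_fin_numE ?leb_ge0.
have [_ [I [oI AI] <-] ltI] := lb_ereal_inf_adherent e20 fA'.
(* Half of [e] pays for the choice of the cover; the other half, split geometrically, for rounding
   its boxes. *)
have en n : 0 < e / 2 / (2 ^ n.+1)%:R by rewrite divr_gt0// ltr0n expn_gt0.
pose P n (J : nat * ('I_d.+1 -> int) * ('I_d.+1 -> int)) :=
  let w := L / (2 ^ J.1.1)%:R in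
   [/\ forall i, w * (J.1.2 i)%:~R <= (I n).1 0 i,
       forall i, (I n).2 0 i <= w * (J.2 i)%:~R &
       box_volume (grid w J.1.2) (grid w J.2) <=
         box_volume (I n).1 (I n).2 + e / 2 / (2 ^ n.+1)%:R].
have [J PJ] : {J & forall n, P n (J n)}.
  apply: (@choice _ _ P) => n.
  have [q [a' [b' h]]] := dyadic_box_enlarge L0 (oI n) (en n).
  by exists (q, a', b').
pose w n := L / (2 ^ (J n).1.1)%:R.
pose K n := (grid (w n) (J n).1.2, grid (w n) (J n).2).
have oK n i : (K n).1 0 i <= (K n).2 0 i.
  rewrite !mxE; have [h1 h2 _] := PJ n; exact: le_trans (le_trans (h1 i) (oI n i)) (h2 i).
have IK n : half_open_box (I n).1 (I n).2 `<=` half_open_box (K n).1 (K n).2.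
  move=> x xI i; have [h1 h2 _] := PJ n; rewrite !mxE; have /andP[h3 h4] := xI i.
  by rewrite (le_lt_trans (h1 i) h3) (le_trans h4 (h2 i)).
pose vK n := (box_volume (K n).1 (K n).2)%:E.
have vK0 n : (0 <= vK n)%E by rewrite lee_fin box_volume_ge0.
have sumK : (\sum_(n <oo) vK n <= leb A + e%:E)%E.
  apply: (@le_trans _ _ (\sum_(n <oo) ((box_volume (I n).1 (I n).2)%:E +
      (e / 2 / (2 ^ n.+1)%:R)%:E))%E).
    by apply: lee_nneseries => n *; [exact: vK0|have [_ _] := PJ n].
  apply: le_trans (epsilon_trick _ _ (ltW e20)) _.
    by move=> n; rewrite lee_fin box_volume_ge0.
  rewrite (_ : (leb A + e%:E)%E = (leb A + (e / 2)%:E + (e / 2)%:E)%E).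
    by apply: leeD => //; exact: ltW.
  by rewrite -addeA -EFinD -splitr.
have sumKoo : (\sum_(n <oo) vK n < +oo)%E.
  by apply: le_lt_trans sumK _; rewrite rlebK// -EFinD ltry.
have := nneseries_tail_cvg sumKoo (fun n _ => vK0 n).
move=> /fine_cvgP [] [] N1 _ hfin /cvgrPdist_lt /(_ _ e0) [N2 _ hN2].
pose N := maxn N1 N2.
have fN : (\sum_(N <= n <oo) vK n)%E \is a fin_num by apply: hfin; rewrite /= leq_maxl.
have tail : (\sum_(N <= n <oo) vK n <= e%:E)%E.
  rewrite -(fineK fN) lee_fin.
  have := hN2 N (leq_maxr _ _); rewrite /= sub0r normrN => /ltW; apply: le_trans; exact: ler_norm.
pose U := \bigcup_n half_open_box (K n).1 (K n).2.
have AU : A `<=` U by move=> x /AI [n _ /IK xn]; exists n.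
have lebU : (leb U <= \sum_(n <oo) vK n)%E by apply: ereal_inf_lbound; exists K => //; split.
pose S := (\bigcup_(n in `I_N) half_open_box (K n).1 (K n).2) `&` cell L (fun=> 0).
pose q := \max_(n < N) (J n).1.1.
exists q, S; split.
- apply: grid_setI.
    move=> c x y cx cy [n nN xn]; exists n => //; move: cx cy xn.
    have nq : ((J n).1.1 <= q)%N by exact: (leq_bigmax (Ordinal nN)).
    apply: (_ : grid_set _ _).
    rewrite (_ : L / (2 ^ q)%:R = w n / (2 ^ (q - (J n).1.1))%:R).
      apply: grid_set_refine; rewrite ?expn_gt0// ?divr_gt0// ?ltr0n ?expn_gt0//.
      by apply: grid_set_box; rewrite divr_gt0// ltr0n expn_gt0.
    by rewrite /w -mulrA -invfM -natrM -expnD subnKC.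
  rewrite (_ : cell L _ = half_open_box (grid (L / (2 ^ 0)%:R) (fun=> 0)) (grid (L / (2 ^ 0)%:R) (fun=> 1))).
    rewrite (_ : L / (2 ^ q)%:R = (L / (2 ^ 0)%:R) / (2 ^ q)%:R); last by rewrite expn0 divr1.
    apply: grid_set_refine; rewrite ?expn_gt0 ?expn0 ?divr1//.
    exact: grid_set_box.
  by rewrite /cell expn0 divr1.
- by move=> x [].
- rewrite -lee_fin -rlebK; last by apply: finmS fA; apply: subIset; left.
  apply: le_trans tail.
  apply: (@le_trans _ _ (leb (\bigcup_(n in ~` `I_N) half_open_box (K n).1 (K n).2))).
    apply: le_leb => x [Ax nSx]; have [n _ xn] := AU _ Ax; exists n => //= nN.
    by apply: nSx; split; [exists n|exact: AL].
  apply: le_trans (outer_measure_sigma_subadditive_tail _ _ _) _.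
  apply: lee_nneseries => n *; first exact: leb_ge0.
  exact: leb_le_box.
- have fU : finm U by apply: le_lt_trans lebU _.
  have : rleb (U `\` A) <= e.
    have := rleb_split mA fU; rewrite setIC (setIidl AU) => h.
    have : rleb U <= rleb A + e.
      by rewrite -lee_fin EFinD -!rlebK//; exact: le_trans lebU sumK.
    by rewrite h lerD2l.
  apply: le_trans; apply: le_rleb; last by apply: finmS fU; apply: subIset; left.
  by move=> x [[[n _ xn] _] nAx]; split => //; exists n.
Qed.

End DyadicApprox.

(** * Densities of avoiding sets *)

Section LimfEsup.
Variable R : realType.
Implicit Types (f : R -> \bar R) (b : \bar R).

Lemma limf_esup_pinfty_le f b M : (forall r, M < r -> (f r <= b)%E) ->
  (limf_esup f +oo%R <= b)%E.
Proof.
move=> h; apply: (@le_trans _ _ (ereal_sup (f @` [set r | M < r]))).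
  by apply: ereal_inf_lbound; exists [set r | M < r] => //; exists M; rewrite num_real.
by apply: ge_ereal_sup => _ [r /h hr <-].
Qed.

Lemma limf_esup_pinfty_ge f b : (forall M, exists2 r, M < r & (b <= f r)%E) ->
  (b <= limf_esup f +oo%R)%E.
Proof.
move=> h; apply: le_ereal_inf_tmp => _ [U [M [_ MU]] <-].
have [r Mr br] := h M; apply: le_trans br _.
by apply: ereal_sup_ubound; exists r => //; exact: MU.
Qed.

Lemma bernoulli_le n (x : R) : 0 <= x <= 1 -> 1 - n%:R * x <= (1 - x) ^+ n.
Proof.
move=> /andP[x0 x1]; elim: n => [|n IH]; first by rewrite expr0 mul0r subr0.
rewrite exprS; apply: le_trans (_ : (1 - x) * (1 - n%:R * x) <= _); last by rewrite ler_wpM2l// subr_ge0.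
have : 0 <= n%:R * x * x by rewrite !mulr_ge0.
by rewrite -[n.+1]addn1 natrD; lra.
Qed.
End LimfEsup.

Section Density.
Variables (R : realType) (d : nat).
Let V := 'rV[R]_d.+1.
Local Notation leb := (@leb R d.+1).
Local Notation meas := (@lebesgue_measurable R d.+1).
Implicit Types (A : set V) (D : set R).

Let hbox (a b : R) : set V := half_open_box (\row__ a) (\row__ b).

Let rleb_hbox a b : a <= b -> rleb (hbox a b) = (b - a) ^+ d.+1.
Proof.
move=> ab; rewrite rleb_box; last by move=> i; rewrite !mxE.
rewrite /box_volume -[X in _ ^+ X]card_ord -prodr_const; apply: eq_bigr => i _.
by rewrite !mxE.
Qed.

Let finm_hbox a b : a <= b -> finm (hbox a b).
Proof. by move=> ab; apply: finm_box => i; rewrite !mxE. Qed.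

Lemma finm_cube (r : R) : 0 < r -> finm (cube (0 : V) r).
Proof.
move=> r0; apply: (@finmS _ _ _ (hbox (- (r / 2)) (r / 2))); last by apply: finm_hbox; lra.
by move=> x h i; have := h i; rewrite !mxE subr0 ltr_norml => /andP[-> /ltW ->].
Qed.

Lemma rleb_cube (r : R) : 0 < r -> rleb (cube (0 : V) r) = r ^+ d.+1.
Proof.
move=> r0; apply/eqP; rewrite eq_le; apply/andP; split.
  have -> : r ^+ d.+1 = rleb (hbox (- (r / 2)) (r / 2)).
    by rewrite rleb_hbox; [congr (_ ^+ _); field|lra].
  apply: le_rleb; last by apply: finm_hbox; lra.
  by move=> x h i; have := h i; rewrite !mxE subr0 ltr_norml => /andP[-> /ltW ->].
(* The cube is open, so it is exhausted from inside by half-open boxes of side [r - h], with [h]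
   controlled by Bernoulli's inequality. *)
apply/ler_addgt0Pr => e e0.
have [h [h0 hr hle]] : exists h, [/\ 0 < h, h < r & r ^+ d.+1 - e <= (r - h) ^+ d.+1].
  have rd : 0 < r ^+ d.+1 by rewrite exprn_gt0.
  pose x := Num.min (1 / 2) (e / (d.+1%:R * r ^+ d.+1)).
  have x0 : 0 < x by rewrite lt_min divr_gt0// divr_gt0// mulr_gt0.
  have x1 : x <= 1 / 2 by rewrite ge_min lexx.
  have x2 : x <= e / (d.+1%:R * r ^+ d.+1) by rewrite ge_min lexx orbT.
  exists (r * x); split; first by rewrite mulr_gt0.
    by rewrite gtr_pMr//; lra.
  rewrite (_ : r - r * x = r * (1 - x)); last by ring.
  rewrite exprMn; apply: le_trans (_ : r ^+ d.+1 * (1 - d.+1%:R * x) <= _); last first.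
    by rewrite ler_pM2l// bernoulli_le//; lra.
  rewrite mulrBr mulr1 lerD2l lerN2; move: x2; rewrite ler_pdivlMr ?mulr_gt0//; lra.
have : rleb (hbox (- (r / 2)) (r / 2 - h)) <= rleb (cube (0 : V) r).
  apply: le_rleb; last exact: finm_cube.
  move=> x xh i; have := xh i; rewrite !mxE subr0 ltr_norml => /andP[-> h1] /=; lra.
rewrite rleb_hbox; last by lra.
rewrite (_ : r / 2 - h - - (r / 2) = r - h); last by field.
lra.
Unshelve. all: by end_near. Qed.

Lemma density_ratioE A (r : R) : 0 < r ->
  (leb (A `&` cube 0 r) / leb (cube (0 : V) r))%E = (rleb (A `&` cube 0 r) / r ^+ d.+1)%:E.
Proof.
move=> r0; have fc := finm_cube r0.
have fA : finm (A `&` cube 0 r) by apply: finmS fc; apply: subIset; right.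
by rewrite !rlebK// rleb_cube// inver expf_eq0 (gt_eqF r0) andbF -EFinM.
Qed.

Lemma finmIl A B : finm A -> finm (A `&` B).
Proof. by apply: finmS; exact: subIsetl. Qed.

Lemma finmIr A B : finm B -> finm (A `&` B).
Proof. by apply: finmS; exact: subIsetr. Qed.

Lemma finmD A B : finm A -> finm (A `\` B).
Proof. exact: finmIl. Qed.

Lemma edist_translate (x y v : V) : edist (x - v) (y - v) = edist x y.
Proof.
by rewrite /edist; congr Num.sqrt; apply: eq_bigr => i _; rewrite !mxE; ring.
Qed.

Lemma edist_scale (t : R) (x y : V) : 0 < t -> edist (t *: x) (t *: y) = t * edist x y.
Proof.
move=> t0; rewrite /edist (eq_bigr (fun i => t ^+ 2 * (x 0 i - y 0 i) ^+ 2)).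
  by rewrite -mulr_sumr sqrtrM ?sqr_ge0// sqrtr_sqr gtr0_norm.
by move=> i _; rewrite !mxE; ring.
Qed.

Lemma edist_ge_coord (x y : V) i : `|x 0 i - y 0 i| <= edist x y.
Proof.
rewrite /edist -sqrtr_sqr; apply: ler_wsqrtr.
by rewrite (bigD1 i)//= lerDl; apply: sumr_ge0 => j _; exact: sqr_ge0.
Qed.

Lemma avoiding_translate D A v : avoiding D A -> avoiding D (affine 1 v A).
Proof.
by move=> aA x y Ax Ay; have := aA _ _ Ax Ay; rewrite invr1 !scale1r edist_translate.
Qed.

Lemma avoidingS D A B : B `<=` A -> avoiding D A -> avoiding D B.
Proof. by move=> BA aA x y /BA Ax /BA Ay; exact: aA. Qed.

(** Enumerates, by a finite type, the cells whose indices all lie between [-j] and [j - 1]. *)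
Definition window (j : nat) (f : {ffun 'I_d.+1 -> 'I_(j + j)}) : 'I_d.+1 -> int :=
  fun i => (f i)%:Z - j%:Z.

Lemma window_inj j : injective (@window j).
Proof.
move=> f g fg; apply/ffunP => i; apply/val_inj => /=.
by have := congr1 (@^~ i) fg; rewrite /window; lia.
Qed.

Lemma window_bound j (f : {ffun 'I_d.+1 -> 'I_(j + j)}) i :
  - j%:R <= ((window f i)%:~R : R) <= j%:R - 1.
Proof.
rewrite /window intrB -!pmulrn; have : (f i).+1%:R <= (j + j)%:R :> R by rewrite ler_nat.
have : 0 <= (f i)%:R :> R by [].
by rewrite natrD -natr1 => h1 h2; apply/andP; split; lra.
Qed.

Lemma card_window j : #|{ffun 'I_d.+1 -> 'I_(j + j)}| = ((j + j) ^ d.+1)%N.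
Proof. by rewrite card_ffun !card_ord. Qed.

Lemma window_cover (L : R) j (x : V) : 0 < L -> (forall i, `|x 0 i| < j%:R * L) ->
  exists f : {ffun 'I_d.+1 -> 'I_(j + j)}, cell L (window f) x.
Proof.
move=> L0 h; have /cellP hc := cell_indexP x L0.
have hb i : (- j%:Z <= cell_index L x i < j%:Z)%R.
  have := h i; rewrite ltr_norml => /andP[h1 h2]; have /andP[h3 h4] := hc i.
  have : L * (- j%:Z)%:~R < L * (cell_index L x i + 1)%:~R.
    by apply: lt_le_trans h4; rewrite intrN mulrN mulrC.
  have : L * (cell_index L x i)%:~R < L * (j%:Z)%:~R.
    by apply: lt_trans h3 _; rewrite mulrC.
  rewrite !ltr_pM2l// !ltr_int; lia.
have hn i : (absz (cell_index L x i + j%:Z)%R < j + j)%N by have := hb i; lia.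
exists [ffun i => Ordinal (hn i)].
rewrite (_ : window _ = cell_index L x); first exact: cell_indexP.
by apply/funext => i; rewrite /window ffunE/=; have := hb i; lia.
Qed.

Lemma translate_cell0 (L : R) A c : 0 < L ->
  affine 1 (\row_i (L * (- c i)%:~R)) (A `&` cell L c) `<=` cell L (fun=> 0).
Proof.
move=> L0 x [_]; have := affine_cell c (fun i => - c i) L0.
move=> /(congr1 (fun S : set V => S x)); rewrite /affine/= => ->.
by rewrite (_ : (fun i => c i + - c i) = (fun=> 0))//; apply/funext => i; rewrite subrr.
Qed.

(** A large cube is covered by about [(r / L) ^ d.+1] cells, and each piece of [A], translated to
    the cell at the origin, obeys the hypothesis. The boundary costs a factor tending to 1. *)
Lemma max_density_le (L b : R) D : 0 < L -> 0 <= b ->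
  (forall A, meas A -> A `<=` cell L (fun=> 0) -> avoiding D A -> rleb A <= b * L ^+ d.+1) ->
  (max_density d.+1 D <= b%:E)%E.
Proof.
move=> L0 b0 hb; apply: ge_ereal_sup => _ [A [mA aA] <-].
apply/lee_addgt0Pr => e e0.
have [dl dl0 hdl] := @prodr_perturb R d.+1 (fun=> 1) (e / (b + 1)) (fun=> ler01) (divr_gt0 e0 (ltr_pwDr ltr01 b0)).
apply: (@limf_esup_pinfty_le _ _ _ (Num.max 0 (4 * L / dl))) => r.
rewrite gt_max => /andP[r0 rL].
rewrite density_ratioE// -EFinD lee_fin.
have rd : 0 < r ^+ d.+1 by rewrite exprn_gt0.
pose j := Num.bound (r / (2 * L)).
have rj : r / (2 * L) < j%:R by apply: archi_boundP; rewrite divr_ge0 ?mulr_ge0// ltW.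
have jr : j%:R <= r / (2 * L) + 1.
  have r2 : 0 <= r / (2 * L) by rewrite divr_ge0 ?mulr_ge0// ltW.
  have /andP[h _] := truncn_itv r2.
  by rewrite /j /Num.bound ger0_norm// -natr1 lerD2r.
have fc := finm_cube r0.
have hcells : rleb (A `&` cube 0 r) <= ((j + j) ^ d.+1)%:R * (b * L ^+ d.+1).
  apply: le_trans (rleb_bigcup_le (P := xpredT) (F := fun f => A `&` cell L (@window j f)) _ _) _.
  - move=> x [Ax xr]; have [i|f fx] := @window_cover L j x L0; last by exists f.
    have := xr i; rewrite mxE subr0 => /lt_trans; apply.
    by rewrite -ltr_pdivrMr// -mulrA -invfM.
  - by move=> f _; apply: finmIr; exact: finm_cell.
  rewrite -card_window -sum1_card natr_sum mulr_suml; apply: ler_sum => f _; rewrite mul1r.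
  have := hb (affine 1 (\row_i (L * (- window f i)%:~R)) (A `&` cell L (window f))).
  rewrite rleb_affine// ?expr1n ?mul1r; last first.
    by apply: finmIr; exact: finm_cell.
  apply; first by apply: measurable_affine => //; apply: caratheodory_measurable_setI => //; exact: measurable_cell.
    exact: translate_cell0.
  by apply: avoiding_translate; apply: avoidingS aA; exact: subIsetl.
rewrite ler_pdivrMr//; apply: le_trans hcells _.
have -> : ((j + j) ^ d.+1)%:R * (b * L ^+ d.+1) = b * ((j + j)%:R * L) ^+ d.+1.
  by rewrite natrX exprMn; ring.
have jL : (j + j)%:R * L <= r * (1 + dl).
  have : 4 * L <= dl * r by rewrite -ler_pdivrMl// mulrC ltW.
  have : j%:R * (2 * L) <= r + 2 * L.
    have -> : r + 2 * L = (r / (2 * L) + 1) * (2 * L) by field; lra.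
    by rewrite ler_pM2r// mulr_gt0.
  by rewrite natrD; lra.
have h1 : ((j + j)%:R * L) ^+ d.+1 <= r ^+ d.+1 * (1 + e / (b + 1)).
  apply: le_trans (_ : (r * (1 + dl)) ^+ d.+1 <= _).
    by rewrite ler_pXn2r// nnegrE mulr_ge0// ?ltW//; lra.
  rewrite exprMn ler_pM2l//.
  have := hdl (fun=> 1 + dl); rewrite !prodr_const card_ord expr1n; apply.
  by move=> _; apply/andP; split; lra.
apply: le_trans (ler_wpM2l b0 h1) _.
rewrite mulrCA mulrC ler_pM2r// mulrDr mulr1 lerD2l mulrCA ler_piMr ?ltW//.
by rewrite ltr_pdivrMr//; lra.
Qed.
Definition periodize (T : R) A : set V :=
  [set x | exists k : {ffun 'I_d.+1 -> int}, affine 1 (\row_i (T * (k i)%:~R)) A x].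

Lemma measurable_periodize T A : meas A -> meas (periodize T A).
Proof.
move=> mA.
have -> : periodize T A = \bigcup_(n : nat)
    (if unpickle n is Some k then
       affine 1 (\row_i (T * ((k : {ffun 'I_d.+1 -> int}) i)%:~R)) A else set0).
  apply/seteqP; split=> x [k kx]; first by exists (pickle k) => //; rewrite pickleK.
  by case: unpickle => [k'|//] k'x; exists k'.
apply: caratheodory_measurable_bigcup => n; case: unpickle => [k|].
  exact: measurable_affine.
exact: caratheodory_measurable_set0.
Qed.

(** The period [L + s] leaves gaps of width [s]; points of distinct copies differ by strictly more
    than [s] in some coordinate because cells are half-open. *)
Lemma avoiding_periodize (L s : R) D A : 0 < L -> 0 <= s -> (forall x, D x -> x <= s) ->
  A `<=` cell L (fun=> 0) -> avoiding D A -> avoiding D (periodize (L + s) A).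
Proof.
move=> L0 s0 Ds AL aA x y [k kx] [l ly].
have [kl|kl] := eqVneq k l.
  by rewrite kl in kx; exact: (avoiding_translate aA kx ly).
have [i kli] : exists i, k i != l i.
  by apply/existsP; rewrite -negb_forall; apply: contra kl => /forallP h; apply/eqP/ffunP => i; exact/eqP.
move=> /Ds; apply/negP; rewrite -ltNge; apply: lt_le_trans (edist_ge_coord x y i).
have := AL _ kx i; have := AL _ ly i; rewrite invr1 !mxE !mul1r add0r !mulr1 mulr0.
move=> /andP[h1 h2] /andP[h3 h4].
have : (1 <= k i - l i) || (k i - l i <= -1) by lia.
have T0 : 0 < L + s by lra.
move=> /orP[]; rewrite -(ler_int R) -(ler_pM2l T0) intrB mulrBr ?intrN => h5.
  by apply: lt_le_trans (ler_norm _); lra.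
by rewrite distrC; apply: lt_le_trans (ler_norm _); lra.
Qed.

Lemma max_density_ge (L s : R) D A : 0 < L -> 0 <= s -> (forall x, D x -> x <= s) ->
  meas A -> A `<=` cell L (fun=> 0) -> avoiding D A ->
  ((rleb A / (L + s) ^+ d.+1)%:E <= max_density d.+1 D)%E.
Proof.
move=> L0 s0 Ds mA AL aA; set T := L + s; have T0 : 0 < T by rewrite /T; lra.
have fA : finm A by apply: finmS AL _; exact: finm_cell.
apply: (@le_trans _ _ (upper_density (periodize T A))); last first.
  apply: ereal_sup_ubound; exists (periodize T A) => //; split.
    exact: measurable_periodize.
  exact: avoiding_periodize.
have Td : 0 < T ^+ d.+1 by rewrite exprn_gt0.
set v := rleb A / T ^+ d.+1; have v0 : 0 <= v by rewrite divr_ge0// ?rleb_ge0 ?ltW.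
apply/lee_subgt0Pr => e e0; apply: limf_esup_pinfty_ge => M.
pose j := Num.bound (Num.max (M / T) (d.+1%:R * v / e)).
have : Num.max (M / T) (d.+1%:R * v / e) < j%:R.
  by apply: archi_boundP; rewrite le_max; apply/orP; right; apply: divr_ge0; [exact: mulr_ge0|exact: ltW].
rewrite gt_max => /andP[]; rewrite !ltr_pdivrMr// => jM je.
have j0 : 0 <= j%:R :> R by [].
(* The window holds [(2 j) ^ d.+1] whole periods, and the cube is one period wider on each side. The
   density thus loses the factor [(1 - 1 / (j + 1)) ^ d.+1]. *)
pose r := 2 * (j%:R + 1) * T.
have r0 : 0 < r by rewrite !mulr_gt0//; lra.
exists r; first by rewrite /r; nra.
rewrite density_ratioE// -EFinB lee_fin.
have fc := finm_cube r0.
have mc : \sum_(f : {ffun 'I_d.+1 -> 'I_(j + j)}) rleb A <= rleb (periodize T A `&` cube 0 r).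
  apply: (@le_trans _ _ (\sum_(f : {ffun 'I_d.+1 -> 'I_(j + j)})
      rleb (periodize T A `&` cube 0 r `&` cell T (window f)))).
    apply: ler_sum => f _.
    have -> : rleb A = rleb (affine 1 (\row_i (T * (window f i)%:~R)) A).
      by rewrite rleb_affine// expr1n mul1r.
    apply: le_rleb; last by apply: finmIl; exact: finmIr.
    move=> x xA; split; first split.
    + exists [ffun i => window f i]; rewrite (_ : \row_i _ = \row_i (T * (window f i)%:~R))//.
      by apply/rowP => i; rewrite !mxE ffunE.
    + move=> i; have := AL _ xA i; rewrite invr1 !mxE !mul1r add0r mulr1 mulr0 subr0 => /andP[h1 h2].
      have /andP[w1 w2] := window_bound f i.
      rewrite -(ler_pM2l T0) in w1; rewrite -(ler_pM2l T0) in w2.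
      rewrite (_ : r / 2 = T * j%:R + T); last by rewrite /r; field.
      have LT : L <= T by rewrite /T; lra.
      by rewrite ltr_norml; apply/andP; split; lra.
    + apply/cellP => i; have := AL _ xA i; rewrite invr1 !mxE !mul1r add0r mulr1 mulr0 => /andP[h1 h2].
      have LT : L <= T by rewrite /T; lra.
      by rewrite intrD mulrDr; apply/andP; split; lra.
  apply: rleb_sum_disj_le.
  - exact: finmIr.
  - by move=> f _; exact: measurable_cell.
  - by move=> f g x _ _ fx gx; apply: window_inj; exact: (cell_inj T0 fx gx).
rewrite ler_pdivlMr ?exprn_gt0//; apply: le_trans mc.
rewrite sumr_const card_window -mulr_natl natrX natrD.
have -> : rleb A = v * T ^+ d.+1 by rewrite /v; field; lra.
have -> : (j%:R + j%:R) ^+ d.+1 * (v * T ^+ d.+1) = v * ((1 - (j%:R + 1)^-1) * r) ^+ d.+1.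
  rewrite (_ : (1 - (j%:R + 1)^-1) * r = (j%:R + j%:R) * T); last by rewrite /r; field; lra.
  by rewrite exprMn; ring.
rewrite [((1 - _) * r) ^+ _]exprMn mulrA ler_pM2r; last by rewrite exprn_gt0.
have j1 : 0 <= (j%:R + 1 : R)^-1 <= 1.
  have j1p : 0 < j%:R + 1 :> R by lra.
  by rewrite invr_ge0 (ltW j1p) invf_le1//; lra.
apply: le_trans (ler_wpM2l v0 (bernoulli_le d.+1 j1)).
rewrite mulrBr mulr1 lerD2l lerN2.
rewrite mulrA ler_pdivrMr; last by lra.
by lra.
Qed.

Lemma max_density_ge0 D : (0 <= max_density d.+1 D)%E.
Proof.
apply: (@le_trans _ _ (upper_density (set0 : set V))); last first.
  apply: ereal_sup_ubound; exists set0 => //; split=> //.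
  exact: caratheodory_measurable_set0.
apply: limf_esup_pinfty_ge => M; exists (Num.max 1 (M + 1)).
  by rewrite lt_max ltrDl ltr01 orbT.
rewrite density_ratioE; last by rewrite lt_max ltr01.
by rewrite set0I rleb0 mul0r.
Qed.

Lemma max_density_le1 D : (max_density d.+1 D <= 1%:E)%E.
Proof.
apply: (@max_density_le 1) => // A _ AL _; rewrite mul1r -(rleb_cell (fun=> 0) ltr01).
by apply: le_rleb => //; exact: finm_cell.
Qed.

Definition mden D : R := fine (max_density d.+1 D).

Lemma mdenE D : max_density d.+1 D = (mden D)%:E.
Proof.
rewrite fineK// ge0_fin_numE ?max_density_ge0//.
by apply: le_lt_trans (max_density_le1 D) _; rewrite ltry.
Qed.

Lemma mden_ge0 D : 0 <= mden D.
Proof. by rewrite -lee_fin -mdenE max_density_ge0. Qed.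

Lemma mden_le1 D : mden D <= 1.
Proof. by rewrite -lee_fin -mdenE max_density_le1. Qed.

Lemma mden_le (L b : R) D : 0 < L -> 0 <= b ->
  (forall A, meas A -> A `<=` cell L (fun=> 0) -> avoiding D A -> rleb A <= b * L ^+ d.+1) ->
  mden D <= b.
Proof. by move=> L0 b0 h; rewrite -lee_fin -mdenE; exact: max_density_le h. Qed.

(** Together with [mden_le], this replaces upper densities by measures of avoiding sets inside one
    cell, up to the factor [(1 + s / L) ^ d.+1], which tends to 1 as [L] grows. No limit superior
    occurs afterwards. *)
Lemma rleb_le_mden (L s : R) D A : 0 < L -> 0 <= s -> (forall x, D x -> x <= s) ->
  meas A -> A `<=` cell L (fun=> 0) -> avoiding D A ->
  rleb A <= mden D * (L + s) ^+ d.+1.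
Proof.
move=> L0 s0 Ds mA AL aA; rewrite -ler_pdivrMr; last by rewrite exprn_gt0//; lra.
by rewrite -lee_fin -mdenE; exact: max_density_ge.
Qed.

End Density.

(** * The lower bound *)

Section LowerBound.
Variables (R : realType) (d : nat).
Let V := 'rV[R]_d.+1.
Local Notation meas := (@lebesgue_measurable R d.+1).
Implicit Types (A : set V) (D : set R).
Local Notation mden := (@mden R d).

Lemma expr1D_perturb n (e : R) : 0 < e -> exists2 dl, 0 < dl &
  forall x, 0 <= x <= dl -> (1 + x) ^+ n <= 1 + e.
Proof.
move=> e0; have [dl dl0 h] := @prodr_perturb R n (fun=> 1) e (fun=> ler01) e0.
exists dl => // x /andP[x0 x1]; have := h (fun=> 1 + x).
by rewrite !prodr_const card_ord expr1n; apply => _; apply/andP; split; lra.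
Qed.

(** Contrapositive of [mden_le]: nearly optimal density is reached inside a cell of any prescribed
    side. *)
Lemma mden_approx D (L b : R) : 0 < L -> b < mden D ->
  exists A, [/\ meas A, A `<=` cell L (fun=> 0), avoiding D A & b * L ^+ d.+1 <= rleb A].
Proof.
move=> L0 bm; have [b0|b0] := leP 0 b; last first.
  exists set0; split => //; first exact: caratheodory_measurable_set0.
  by rewrite rleb0; apply: mulr_le0_ge0; [exact: ltW|apply: exprn_ge0; exact: ltW].
apply: contrapT => h; move: bm; apply/negP; rewrite -leNgt.
apply: (mden_le L0 b0) => A mA AL aA; rewrite leNgt; apply/negP => hA.
by apply: h; exists A; split => //; exact: ltW.
Qed.

Lemma mden_dilate_le (t s : R) D : 0 < t -> 0 <= s -> (forall x, D x -> x <= s) ->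
  mden (dilate t D) <= mden D.
Proof.
move=> t0 s0 Ds; apply/ler_addgt0Pr => e e0.
have [dl dl0 hdl] := expr1D_perturb d.+1 e0.
(* The margin [s] around the shrunk cell costs the factor [(1 + t * s / L) ^+ d.+1], which this
   choice brings below [1 + e]. *)
pose L := t * s / dl + 1.
have L1 : 1 <= L by rewrite lerDr divr_ge0// ?mulr_ge0// ltW.
have L0 : 0 < L by lra.
have m0 := mden_ge0 d D; have m1 := mden_le1 d D.
apply: (mden_le L0) => [|A mA AL aA]; first by lra.
have t0' : 0 < t^-1 by rewrite invr_gt0.
have fA : finm A by apply: finmS AL _; exact: finm_cell.
have := @rleb_le_mden R d (L / t) s D (affine t^-1 0 A) (divr_gt0 L0 t0) s0 Ds.
rewrite rleb_affine// => h.
have {h} : t^-1 ^+ d.+1 * rleb A <= mden D * (L / t + s) ^+ d.+1.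
  apply: h; first exact: measurable_affine.
  - move=> x /AL /cellP h; apply/cellP => i; have := h i.
    rewrite invrK !mxE subr0 add0r !mulr1 !mulr0 => /andP[h1 h2].
    by rewrite -(pmulr_rgt0 _ t0) h1 /= ler_pdivlMr// mulrC.
  - move=> x y Ax Ay Dxy; apply: (aA _ _ Ax Ay); rewrite invrK !subr0.
    by rewrite edist_scale//; exists (edist x y).
have -> : L / t + s = t^-1 * (L * (1 + t * s / L)) by field; lra.
rewrite exprMn mulrCA ler_pM2l ?exprn_gt0// => /le_trans; apply.
rewrite exprMn mulrCA mulrC ler_pM2r ?exprn_gt0//.
have : (1 + t * s / L) ^+ d.+1 <= 1 + e.
  have ts0 : 0 <= t * s by rewrite mulr_ge0// ltW.
  have hL : dl * L = t * s + dl by rewrite /L; field; lra.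
  by apply: hdl; rewrite divr_ge0 ?(ltW L0)//= ler_pdivrMr// hL; lra.
move=> /(ler_wpM2l m0) /le_trans; apply; rewrite mulrDr mulr1 lerD2l.
by rewrite ler_piMl// ltW.
Qed.

Lemma mden_dilate (t s : R) D : 0 < t -> 0 <= s -> (forall x, D x -> x <= s) ->
  mden (dilate t D) = mden D.
Proof.
move=> t0 s0 Ds; apply/eqP; rewrite eq_le (mden_dilate_le t0 s0 Ds)/=.
have -> : mden D = mden (dilate t^-1 (dilate t D)).
  congr mden; apply/seteqP; split=> x /=.
    by move=> Dx; exists (t * x); [exists x|rewrite mulrA mulVf ?mul1r ?lt0r_neq0].
  by move=> [_ [y Dy <-] <-]; rewrite mulrA mulVf ?mul1r ?lt0r_neq0.
apply: (@mden_dilate_le _ (t * s)); rewrite ?invr_gt0 ?mulr_ge0//; first exact: ltW.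
by move=> _ [y Dy <-]; rewrite ler_pM2l// Ds.
Qed.

Definition wcell n (w : R) (f : {ffun 'I_d.+1 -> 'I_n.+1}) : set V := cell w (fun i => (f i)%:Z).

Lemma wcell_inj n w (f g : {ffun 'I_d.+1 -> 'I_n.+1}) x : 0 < w ->
  wcell w f x -> wcell w g x -> f = g.
Proof.
move=> w0 fx gx; have := cell_inj w0 fx gx => h; apply/ffunP => i; apply/val_inj.
by have := congr1 (@^~ i) h => -[].
Qed.

Lemma wcell_cover n (w : R) x : 0 < w -> cell (n.+1%:R * w) (fun=> 0) x ->
  exists f : {ffun 'I_d.+1 -> 'I_n.+1}, wcell w f x.
Proof.
move=> w0 /cellP xT; have /cellP hc := cell_indexP x w0.
have hb i : (0 <= cell_index w x i < n.+1%:Z)%R.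
  have /andP[h1 h2] := xT i; have /andP[h3 h4] := hc i.
  rewrite mulr0 in h1; rewrite add0r mulr1 mulrC in h2.
  have : w * 0%:~R < w * (cell_index w x i + 1)%:~R by rewrite mulr0; exact: lt_le_trans h4.
  have : w * (cell_index w x i)%:~R < w * (n.+1%:Z)%:~R by apply: lt_le_trans h2.
  rewrite !ltr_pM2l// !ltr_int; lia.
have hn i : (absz (cell_index w x i) < n.+1)%N by have := hb i; lia.
exists [ffun i => Ordinal (hn i)]; rewrite /wcell (_ : (fun i => _) = cell_index w x).
  exact: cell_indexP.
by apply/funext => i; rewrite ffunE/=; have := hb i; lia.
Qed.

(** Averaging over [x]: each [op f] is a bijection of the finite type, so every pair in [X] times
    [Y] is counted for exactly one [x]. *)
Lemma exists_shift (I : finType) (op : I -> I -> I) (X Y : {set I}) (x0 : I) :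
  (forall f, injective (op f)) ->
  exists x : I, (#|X| * #|Y| <= #|I| * #|[set f in X | op f x \in Y]|)%N.
Proof.
move=> op_inj.
have sumE : (\sum_(x : I) #|[set f in X | op f x \in Y]| = #|X| * #|Y|)%N.
  rewrite (eq_bigr (fun x => \sum_(f in X) (op f x \in Y : nat))%N); last first.
    move=> x _; rewrite -sum1_card big_mkcond [RHS]big_mkcond/=; apply: eq_bigr => f _.
    by rewrite inE; case: (f \in X); case: (_ \in Y).
  rewrite exchange_big/= -sum_nat_const; apply: eq_bigr => f _.
  rewrite -sum1_card [RHS]big_mkcond/= [RHS](reindex_inj (op_inj f))/=.
  by apply: eq_bigr => x _; case: (_ \in _).
apply: contrapT => /forallNP h.
have lt x : (#|I| * #|[set f in X | op f x \in Y]| < #|X| * #|Y|)%N.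
  by rewrite ltnNge; apply/negP/h.
have : (\sum_(x : I) #|I| * #|[set f in X | op f x \in Y]| < \sum_(x : I) #|X| * #|Y|)%N.
  rewrite (bigD1 x0)//= [ltnRHS](bigD1 x0)//= -addSn leq_add//.
  by apply: leq_sum => x _; exact: ltnW.
by rewrite -big_distrr/= sumE sum_nat_const ltnn.
Qed.

Lemma ord_sub_mod n (a b : 'I_n.+1) :
  exists k : int, a%:Z = (a - b)%R%:Z + b%:Z + n.+1%:Z * k.
Proof.
have ha := ltn_ord a; have hb := ltn_ord b.
exists (if (b <= a)%N then 0 else -1).
rewrite (_ : nat_of_ord (a - b)%R = (a + (n.+1 - b) %% n.+1) %% n.+1)%N //.
move: (nat_of_ord a) (nat_of_ord b) ha hb => {}a {}b ha hb.
have [->|b0] := posnP b; first by rewrite subn0 modnn addn0 modn_small//=; lia.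
rewrite (@modn_small (n.+1 - b)); last by lia.
case: (leqP b a) => h; last by rewrite modn_small; lia.
by rewrite (_ : (a + (n.+1 - b) = (a - b) + n.+1)%N) ?modnDr ?modn_small; lia.
Qed.

(** On a common dyadic grid both sets become sets of cells, indexed by a finite group of residues,
    where [exists_shift] applies. Periodizing [B] turns a cyclic shift of cells into a
    translation. *)
Lemma exists_translate (T e : R) (A B : set V) : 0 < T -> 0 < e -> meas A -> meas B ->
  A `<=` cell T (fun=> 0) -> B `<=` cell T (fun=> 0) ->
  exists v : V, rleb A * rleb B / T ^+ d.+1 - e <= rleb (A `&` affine 1 v (periodize T B)).
Proof.
move=> T0 e0 mA mB AT BT.
have Td : 0 < T ^+ d.+1 by rewrite exprn_gt0.
(* Two errors [e1] come from the intersection and three from expanding the product of the measures: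
   hence the 5. The bound by [T ^+ d.+1] absorbs the square of [e1]. *)
pose e1 := Num.min (T ^+ d.+1) (e / 5).
have e10 : 0 < e1 by rewrite lt_min Td divr_gt0.
have e11 : e1 <= T ^+ d.+1 by rewrite ge_min lexx.
have e12 : e1 <= e / 5 by rewrite ge_min lexx orbT.
have [q1 [S1 [gS1 S1T AS1 SA1]]] := dyadic_approx T0 mA AT e10.
have [q2 [S2 [gS2 S2T BS2 SB2]]] := dyadic_approx T0 mB BT e10.
pose q := maxn q1 q2.
have [n nE] : exists n, n.+1 = (2 ^ q)%N by exists (2 ^ q).-1; rewrite prednK// expn_gt0.
pose w := T / n.+1%:R.
have w0 : 0 < w by rewrite divr_gt0.
have wT : n.+1%:R * w = T by rewrite /w mulrCA mulfV ?mulr1// pnatr_eq0.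
have refine q' (S : set V) : (q' <= q)%N -> grid_set (T / (2 ^ q')%:R) S -> grid_set w S.
  move=> q'q gS; have -> : w = T / (2 ^ q')%:R / (2 ^ (q - q'))%:R.
    by rewrite /w nE -mulrA -invfM -natrM -expnD subnKC.
  by apply: grid_set_refine => //; rewrite ?expn_gt0// divr_gt0// ltr0n expn_gt0.
have {}gS1 := refine _ _ (leq_maxl _ _) gS1.
have {}gS2 := refine _ _ (leq_maxr _ _) gS2.
pose I := {ffun 'I_d.+1 -> 'I_n.+1}.
pose X (S : set V) := [set f : I | `[< wcell w f `<=` S >]]%SET.
have XP (S : set V) f : f \in X S -> wcell w f `<=` S by rewrite inE => /asboolP.
have finT : finm (cell T (fun=> 0) : set V) by exact: finm_cell.
have finS (S : set V) : S `<=` cell T (fun=> 0) -> finm S by move=> ST; exact: finmS finT.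
have Td_E : T ^+ d.+1 = #|I|%:R * w ^+ d.+1.
  by rewrite -wT exprMn card_ffun !card_ord natrX.
have X_ge (S : set V) : S `<=` cell T (fun=> 0) -> grid_set w S -> rleb S <= #|X S|%:R * w ^+ d.+1.
  move=> ST gS; apply: le_trans (rleb_bigcup_le (P := mem (X S)) (F := @wcell n w) _ _) _.
  - move=> x Sx; have := ST _ Sx; rewrite -wT => /(wcell_cover w0) [f fx]; exists f => //=.
    by rewrite inE; apply/asboolP => y fy; exact: (gS _ _ _ fx fy).
  - by move=> f _; exact: finm_cell.
  by rewrite (eq_bigr (fun=> w ^+ d.+1)) ?sumr_const ?mulr_natl// => f _; exact: rleb_cell.
have X_le (S : set V) : #|X S|%:R * w ^+ d.+1 <= T ^+ d.+1.
  by rewrite Td_E ler_pM2r ?exprn_gt0// ler_nat max_card.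
have [x hx] : exists x : I, (#|X S1| * #|X S2| <=
    #|I| * #|[set f in X S1 | (f - x)%R \in X S2]|)%N.
  apply: (@exists_shift I (fun f x => f - x)); first exact: 0.
  by move=> f a b /(congr1 (fun y => f - y)); rewrite !subKr.
set Y := [set f in X S1 | f - x \in X S2]%SET in hx.
exists (\row_i (w * ((x i)%:Z)%:~R)); set B' := affine 1 _ _.
have finA : finm A by exact: finS.
have finB : finm B by exact: finS.
(* cell by cell, both sets fill the cell up to the errors of approximation *)
have hcell f : f \in Y -> w ^+ d.+1 <=
    rleb (A `&` B' `&` wcell w f) + rleb ((S1 `\` A) `&` wcell w f) +
    rleb ((S2 `\` B) `&` wcell w (f - x)).
  rewrite inE => /andP[/XP f1 /XP f2].
  pose g : I := f - x; rewrite -/g in f2 *.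
  have [k hk] : exists k : {ffun 'I_d.+1 -> int}, forall i,
      ((f i)%:Z = (g i)%:Z + (x i)%:Z + n.+1%:Z * k i)%R.
    have [k hk] := choice (fun i => ord_sub_mod (f i) (x i)).
    by exists [ffun i => k i] => i; rewrite /g !ffunE.
  pose v : V := \row_i (w * ((f i)%:Z - (g i)%:Z)%:~R).
  have cellE : affine 1 v (wcell w g) = wcell w f.
    by rewrite affine_cell//; congr cell; apply/funext => i; rewrite addrC subrK.
  have sub : wcell w f `<=` (A `&` B' `&` wcell w f) `|` ((S1 `\` A) `&` wcell w f) `|`
     affine 1 v ((S2 `\` B) `&` wcell w g).
    move=> y fy; have [Ay|nAy] := pselect (A y); last first.
      by left; right; split => //; split => //; exact: f1.
    have fxy : wcell w g (1^-1 *: (y - v)) by move: (fy); rewrite -cellE.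
    have [By|nBy] := pselect (B (1^-1 *: (y - v))).
      left; left; split => //; split => //; exists k.
      rewrite /affine/= (_ : 1^-1 *: _ = 1^-1 *: (y - v))//.
      apply/rowP => i; rewrite !mxE invr1 !mul1r hk.
      rewrite -wT !(intrD, intrM, intrB); ring.
    by right; split => //; split => //; exact: f2.
  have f3 : finm ((S2 `\` B) `&` wcell w g) by apply: finmIr; exact: finm_cell.
  have f4 : finm ((S1 `\` A) `&` wcell w f) by apply: finmIr; exact: finm_cell.
  have f5 : finm (A `&` B' `&` wcell w f) by apply: finmIr; exact: finm_cell.
  have f6 := finm_affine v ltr01 f3.
  rewrite -(rleb_cell (fun i => (f i)%:Z) w0).
  apply: le_trans (le_rleb sub _) _; first by do 2 apply: finmU => //.
  apply: le_trans (rlebU _ _) _ => //; first exact: finmU.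
  by rewrite rleb_affine// expr1n mul1r lerD2r rlebU.
have hsum : #|Y|%:R * w ^+ d.+1 <= rleb (A `&` B') + e1 + e1.
  rewrite mulr_natl -sumr_const; apply: le_trans (ler_sum _ hcell) _.
  rewrite !big_split/=; apply: lerD; first apply: lerD.
  - apply: rleb_sum_disj_le; first exact: finmIl.
    + by move=> f _; exact: measurable_cell.
    + by move=> f g z _ _; exact: wcell_inj.
  - apply: le_trans SA1; apply: rleb_sum_disj_le; first by apply: finmD; exact: finS.
    + by move=> f _; exact: measurable_cell.
    + by move=> f g z _ _; exact: wcell_inj.
  - apply: le_trans SB2; apply: rleb_sum_disj_le; first by apply: finmD; exact: finS.
    + by move=> f _; exact: measurable_cell.
    + by move=> f g z _ _ h1 h2; apply: (addIr (- x)); exact: wcell_inj h1 h2.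
have hA : rleb A <= #|X S1|%:R * w ^+ d.+1 + e1.
  apply: le_trans (_ : rleb S1 + rleb (A `\` S1) <= _); last by rewrite lerD// X_ge.
  apply: le_trans (rlebU _ _); [|exact: finS|exact: finmD].
  by apply: le_rleb; [move=> y Ay; have [|] := pselect (S1 y); [left|right]
    |apply: finmU; [exact: finS|exact: finmD]].
have hB : rleb B <= #|X S2|%:R * w ^+ d.+1 + e1.
  apply: le_trans (_ : rleb S2 + rleb (B `\` S2) <= _); last by rewrite lerD// X_ge.
  apply: le_trans (rlebU _ _); [|exact: finS|exact: finmD].
  by apply: le_rleb; [move=> y Ay; have [|] := pselect (S2 y); [left|right]
    |apply: finmU; [exact: finS|exact: finmD]].
have hXY : (#|X S1|%:R * w ^+ d.+1) * (#|X S2|%:R * w ^+ d.+1) <= T ^+ d.+1 * (#|Y|%:R * w ^+ d.+1).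
  rewrite Td_E mulrACA [leRHS]mulrACA ler_wpM2r ?mulr_ge0 ?exprn_ge0 ?(ltW w0)//.
  by rewrite -!natrM ler_nat.
have := X_le S1; have := X_le S2.
have : 0 <= #|X S1|%:R * w ^+ d.+1 by rewrite mulr_ge0// exprn_ge0// ltW.
have : 0 <= #|X S2|%:R * w ^+ d.+1 by rewrite mulr_ge0// exprn_ge0// ltW.
move: hXY hA hB hsum (rleb_ge0 A) (rleb_ge0 B); clear -Td e0 e10 e11 e12.
set x1 := #|X S1|%:R * _; set x2 := #|X S2|%:R * _; set y := #|Y|%:R * _.
set a := rleb A; set b := rleb B; set c := rleb _; set t := T ^+ _ in Td e11 * => hXY hA hB hy a0 b0 x20 x10 x1t x2t.
suff : a * b <= (c + e) * t by rewrite -ler_pdivrMr// lerBlDr.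
apply: le_trans (ler_pM a0 b0 hA hB) _.
have -> : (x1 + e1) * (x2 + e1) = x1 * x2 + e1 * x1 + e1 * x2 + e1 * e1 by ring.
have h1 : e1 * x1 <= e1 * t by rewrite ler_pM2l.
have h2 : e1 * x2 <= e1 * t by rewrite ler_pM2l.
have h3 : e1 * e1 <= e1 * t by rewrite ler_pM2l.
have h4 : t * y <= t * (c + e1 + e1) by rewrite ler_pM2l.
have h5 : e1 * t <= e / 5 * t by rewrite ler_pM2r.
lra.
Qed.

Lemma mden_mul_le (s : R) (D1 D2 : set R) : 0 <= s ->
  (forall x, D1 x -> x <= s) -> (forall x, D2 x -> x <= s) ->
  mden D1 * mden D2 <= mden (D1 `|` D2).
Proof.
move=> s0 h1 h2; apply/ler_addgt0Pr => e e0.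
set m1 := mden D1; set m2 := mden D2; set m := mden _.
have m10 : 0 <= m1 by exact: mden_ge0.
have m20 : 0 <= m2 by exact: mden_ge0.
have m11 : m1 <= 1 by exact: mden_le1.
have m21 : m2 <= 1 by exact: mden_le1.
have m0 : 0 <= m by exact: mden_ge0.
have m_1 : m <= 1 by exact: mden_le1.
pose e1 := Num.min 1 (e / 8).
have e10 : 0 < e1 by rewrite lt_min ltr01 divr_gt0.
have e11 : e1 <= 1 by rewrite ge_min lexx.
have e12 : e1 <= e / 8 by rewrite ge_min lexx orbT.
have e2 : 0 < e / 8 by rewrite divr_gt0.
(* Below, [m1 - e1] and [m2 - e1] have to be nonnegative in order to be multiplied. *)
have [m1e|m1e] := leP m1 e1.
  by apply: le_trans (ler_piMr m10 m21) _; lra.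
have [m2e|m2e] := leP m2 e1.
  by apply: le_trans (ler_piMl m20 m11) _; lra.
(* The product of two measures is compared with the square of [T ^+ d.+1], hence the doubled
   exponent. *)
have [dl dl0 hdl] := expr1D_perturb (d.+1 + d.+1) e2.
pose L := s / dl + 1.
have L0 : 0 < L by rewrite ltr_wpDl// divr_ge0// ltW.
have hL : dl * L = s + dl by rewrite /L; field; lra.
have hsL : (1 + s / L) ^+ (d.+1 + d.+1) <= 1 + e / 8.
  by apply: hdl; rewrite divr_ge0 ?(ltW L0)//= ler_pdivrMr// hL; lra.
pose T := L + s; have T0 : 0 < T by rewrite /T; lra.
have m1lt : m1 - e1 < m1 by lra.
have m2lt : m2 - e1 < m2 by lra.
have [A [mA AL aA hA]] := mden_approx L0 m1lt.
have [B [mB BL aB hB]] := mden_approx L0 m2lt.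
have LT : cell L (fun=> 0) `<=` (cell T (fun=> 0) : set V).
  move=> x /cellP h; apply/cellP => i; have := h i; rewrite !mulr0 !add0r !mulr1 => /andP[-> h3] /=.
  by rewrite /T; lra.
have Td : 0 < T ^+ d.+1 by rewrite exprn_gt0.
have Ld : 0 < L ^+ d.+1 by rewrite exprn_gt0.
have [v hv] := exists_translate T0 (mulr_gt0 e10 Td) mA mB (subset_trans AL LT) (subset_trans BL LT).
set A' := A `&` _ in hv.
have {}hA' : rleb A' <= m * T ^+ d.+1.
  apply: (rleb_le_mden L0 s0).
  - by move=> x [/h1|/h2].
  - apply: caratheodory_measurable_setI => //; apply: measurable_affine => //.
    exact: measurable_periodize.
  - by move=> x [/AL].
  - move=> x y [Ax Bx] [Ay By] [|]; first exact: aA.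
    exact: (avoiding_translate (avoiding_periodize L0 s0 h2 BL aB) Bx By).
have hAB : rleb A * rleb B <= (m + e1) * (T ^+ d.+1 * T ^+ d.+1).
  have : rleb A * rleb B / T ^+ d.+1 <= (m + e1) * T ^+ d.+1 by lra.
  by rewrite ler_pdivrMr// mulrA.
have TE : T ^+ d.+1 * T ^+ d.+1 = L ^+ d.+1 * L ^+ d.+1 * (1 + s / L) ^+ (d.+1 + d.+1).
  have -> : T = L * (1 + s / L) by rewrite /T; field; lra.
  by rewrite !exprMn [(1 + _) ^+ (_ + _)]exprD; ring.
have LL : 0 < L ^+ d.+1 * L ^+ d.+1 by rewrite mulr_gt0.
have key : (m1 - e1) * (m2 - e1) <= (m + e1) * (1 + e / 8).
  rewrite -(ler_pM2l LL).
  apply: le_trans (_ : rleb A * rleb B <= _).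
    apply: le_trans (_ : ((m1 - e1) * L ^+ d.+1) * ((m2 - e1) * L ^+ d.+1) <= _).
      by rewrite le_eqVlt; apply/orP; left; apply/eqP; ring.
    by apply: ler_pM => //; rewrite mulr_ge0 ?subr_ge0 ?ltW.
  apply: le_trans hAB _; rewrite TE [leRHS]mulrCA ler_pM2l; last by lra.
  by rewrite ler_pM2l.
have : e1 * m1 <= e1 by rewrite ler_piMr// ltW.
have : e1 * m2 <= e1 by rewrite ler_piMr// ltW.
have : e / 8 * m <= e / 8 by rewrite ler_piMr// ltW.
have : e / 8 * e1 <= e / 8 by rewrite ler_piMr// ltW.
have : 0 <= e1 * e1 by rewrite mulr_ge0// ltW.
by lra.
Qed.

End LowerBound.

(** * Averages over directions in a finite group *)

Section Equidistribution.
Variable R : realType.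

(* Along a sequence of nearly constant step [lam], a slowly varying function
   averages to what it averages to over the whole interval. *)
Lemma sum_along_progression (C : int -> R) (K dl B lam eta : R) (psi : nat -> int) (b : nat) :
  (forall z, `|C z| <= K) -> (forall z, `|C (z + 1) - C z| <= dl) ->
  (forall z n, `|\sum_(v < n) C (z + v%:Z)| <= B) ->
  0 < lam -> 0 <= eta <= 1 ->
  (forall c, (c < b)%N -> (1 - eta) * lam <= (psi c.+1 - psi c)%:~R <= (1 + eta) * lam) ->
  `|\sum_(c < b) C (psi c)| <= B / lam + b%:R * (eta * K + 4 * lam * dl).
Proof.
move=> CK Cdl CB lam0 /andP[eta0 eta1] hpsi.
have dl0 : 0 <= dl by apply: le_trans (Cdl 0).
have step z v : `|C (z + v%:Z) - C z| <= v%:R * dl.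
  elim: v => [|v IH]; first by rewrite addr0 subrr normr0 mul0r.
  have -> : C (z + v.+1%:Z) - C z = (C (z + v%:Z + 1) - C (z + v%:Z)) + (C (z + v%:Z) - C z).
    by rewrite addrA subrK -addrA (_ : v%:Z + 1 = v.+1%:Z)//; lia.
  by apply: le_trans (ler_normD _ _) _; rewrite -natr1 mulrDl mul1r addrC lerD.
have [nn hnn] : exists nn : nat -> nat, forall c, (c < b)%N -> psi c.+1 = psi c + (nn c)%:Z.
  exists (fun c => `|psi c.+1 - psi c|%N) => c cb.
  have /andP[h _] := hpsi c cb.
  have : 0 <= (psi c.+1 - psi c)%:~R :> R by apply: le_trans h; rewrite mulr_ge0 ?subr_ge0 ?(ltW lam0).
  by rewrite ler0z; lia.
have telesc k : (k <= b)%N -> \sum_(c < k) \sum_(v < nn c) C (psi c + v%:Z) =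
    \sum_(v < \sum_(c < k) nn c) C (psi 0%N + v%:Z) /\ psi k = psi 0%N + (\sum_(c < k) nn c)%N%:Z.
  elim: k => [|k IH] kb; first by rewrite !big_ord0 addr0.
  have [IH1 IH2] := IH (ltnW kb).
  rewrite !big_ord_recr/= IH1 big_split_ord/=; split.
    by congr (_ + _); apply: eq_bigr => v _; rewrite IH2 -addrA PoszD.
  by rewrite hnn// IH2 -addrA PoszD.
have [tel _] := telesc b (leqnn b).
have err c : (c < b)%N -> `|lam * C (psi c) - \sum_(v < nn c) C (psi c + v%:Z)| <=
    eta * lam * K + 4 * lam ^+ 2 * dl.
  move=> cb; have /andP[] := hpsi c cb; rewrite hnn// addrAC subrr add0r -pmulrn => h1 h2.
  have -> : lam * C (psi c) - \sum_(v < nn c) C (psi c + v%:Z) =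
     (lam - (nn c)%:R) * C (psi c) - \sum_(v < nn c) (C (psi c + v%:Z) - C (psi c)).
    rewrite sumrB sumr_const card_ord -mulr_natl; ring.
  apply: le_trans (ler_normB _ _) _; apply: lerD.
    rewrite normrM ler_pM//; rewrite ler_norml; apply/andP; split; lra.
  apply: le_trans (ler_norm_sum _ _ _) _.
  apply: le_trans (_ : \sum_(v < nn c) (nn c)%:R * dl <= _).
    apply: ler_sum => v _; apply: le_trans (step _ _) _.
    by rewrite ler_wpM2r// ler_nat ltnW.
  rewrite sumr_const card_ord -[leLHS]mulr_natl mulrA; apply: ler_wpM2r => //.
  have n0 : 0 <= (nn c)%:R :> R by [].
  have n2 : (nn c)%:R <= 2 * lam by nra.
  by nra.
rewrite -(ler_pM2l lam0) -[lam in leLHS](gtr0_norm lam0) -normrM.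
have -> : lam * (B / lam + b%:R * (eta * K + 4 * lam * dl)) =
   B + b%:R * (eta * lam * K + 4 * lam ^+ 2 * dl) by field; lra.
rewrite -[X in `|X|](subrK (\sum_(c < b) \sum_(v < nn c) C (psi c + v%:Z))) addrC.
apply: le_trans (ler_normD _ _) _; apply: lerD; first by rewrite tel.
rewrite mulr_sumr -sumrB; apply: le_trans (ler_norm_sum _ _ _) _.
apply: le_trans (_ : \sum_(c < b) (eta * lam * K + 4 * lam ^+ 2 * dl) <= _).
  by apply: ler_sum => c _; exact: err.
by rewrite sumr_const card_ord -[leLHS]mulr_natl.
Qed.

Variable V : finZmodType.
Variables (f : V -> R) (e : V) (ell : nat).
Hypothesis ell0 : (0 < ell)%N.
Hypothesis f01 : forall x, 0 <= f x <= 1.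

Definition line_avg (x : V) : R := ell%:R^-1 * \sum_(v < ell) f (x + e *+ v).
Definition line_dev (x : V) : R := f x - line_avg x.

Let ellR : 0 < ell%:R :> R. Proof. by rewrite ltr0n. Qed.

Lemma line_avg01 x : 0 <= line_avg x <= 1.
Proof.
have h0 : 0 <= \sum_(v < ell) f (x + e *+ v) by apply: sumr_ge0 => v _; have /andP[] := f01 (x + e *+ v).
rewrite /line_avg mulrC divr_ge0 ?(ltW ellR)//= ler_pdivrMr// mul1r.
apply: le_trans (_ : \sum_(v < ell) 1 <= _); last by rewrite sumr_const card_ord.
by apply: ler_sum => v _; have /andP[] := f01 (x + e *+ v).
Qed.

Lemma line_dev_le1 x : `|line_dev x| <= 1.
Proof.
have /andP[a1 a2] := f01 x; have /andP[b1 b2] := line_avg01 x.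
by rewrite ler_norml /line_dev; apply/andP; split; lra.
Qed.

(** With [F] the partial sums of [f] along the line, the sum is the mean over [j < ell] of
    [F j - (F (n + j) - F n)], a difference of two sums of at most [ell] values in [[0, 1]]. Hence a
    bound that does not grow with [n]. *)
Lemma line_dev_sum x n : `|\sum_(v < n) line_dev (x + e *+ v)| <= ell%:R.
Proof.
pose F k := \sum_(v < k) f (x + e *+ v).
have F0 k j : (j <= ell)%N -> 0 <= F (k + j)%N - F k <= ell%:R.
  move=> jl; rewrite /F big_split_ord/= addrAC subrr add0r; apply/andP; split.
    by apply: sumr_ge0 => v _; have /andP[] := f01 (x + e *+ (k + v)).
  apply: le_trans (_ : \sum_(v < j) 1 <= _); last by rewrite sumr_const card_ord ler_nat.
  by apply: ler_sum => v _; have /andP[] := f01 (x + e *+ (k + v)).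
have -> : \sum_(v < n) line_dev (x + e *+ v) =
    ell%:R^-1 * \sum_(j < ell) ((F j - F 0%N) - (F (n + j)%N - F n)).
  rewrite /line_dev sumrB /line_avg -mulr_sumr exchange_big/=.
  rewrite -[X in X - _](mulKf (lt0r_neq0 ellR)) -mulrBr; congr (_ * _).
  rewrite mulr_natl -[X in _ *+ X]card_ord -sumr_const -sumrB; apply: eq_bigr => j _.
  have -> : \sum_(v < n) f (x + e *+ v + e *+ j) = F (j + n)%N - F j.
    rewrite /F big_split_ord/= addrAC subrr add0r; apply: eq_bigr => v _.
    by rewrite -addrA -mulrnDr addnC.
  by rewrite /F big_ord0 addnC -/(F _); ring.
rewrite normrM ger0_norm ?invr_ge0 ?(ltW ellR)// mulrC ler_pdivrMr//.
apply: le_trans (ler_norm_sum _ _ _) _.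
apply: le_trans (_ : \sum_(j < ell) ell%:R <= _); last by rewrite sumr_const card_ord mulr_natl.
apply: ler_sum => j _; have := F0 0%N j (ltnW (ltn_ord j)); have := F0 n j (ltnW (ltn_ord j)).
rewrite add0n => /andP[h1 h2] /andP[h3 h4]; rewrite ler_norml; apply/andP; split; lra.
Qed.

Variable om : R.
Hypothesis f_lip : \sum_x `|f (x + e) - f x| <= om * #|V|%:R.

Lemma line_dev_lip : \sum_x `|line_dev (x + e) - line_dev x| <= 2 * om * #|V|%:R.
Proof.
have h x : `|line_dev (x + e) - line_dev x| <= `|f (x + e) - f x| +
    ell%:R^-1 * \sum_(v < ell) `|f (x + e *+ v + e) - f (x + e *+ v)|.
  have -> : line_dev (x + e) - line_dev x = (f (x + e) - f x) -
      ell%:R^-1 * \sum_(v < ell) (f (x + e *+ v + e) - f (x + e *+ v)).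
    rewrite /line_dev /line_avg sumrB mulrBr.
    under [in RHS]eq_bigr do rewrite addrAC.
    ring.
  apply: le_trans (ler_normB _ _) _; rewrite lerD2l normrM ger0_norm ?invr_ge0 ?(ltW ellR)//.
  by rewrite ler_pM2l ?invr_gt0//; exact: ler_norm_sum.
apply: (@le_trans _ _ (\sum_x (`|f (x + e) - f x| +
    ell%:R^-1 * \sum_(v < ell) `|f (x + e *+ v + e) - f (x + e *+ v)|))).
  by apply: ler_sum => x _; exact: h.
rewrite big_split/= -mulr_sumr exchange_big/=.
have -> : \sum_(j < ell) \sum_x `|f (x + e *+ j + e) - f (x + e *+ j)| =
    \sum_(j < ell) \sum_x `|f (x + e) - f x|.
  by apply: eq_bigr => v _; rewrite [RHS](reindex_inj (addIr (e *+ v))).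
rewrite sumr_const card_ord -[X in _^-1 * X]mulr_natl mulrA mulVf ?(lt0r_neq0 ellR)// mul1r.
by have := f_lip; lra.
Qed.

(** As a function of [z], this correlation is bounded, has small increments and has bounded sums
    over intervals: the three hypotheses of [sum_along_progression]. *)
Let corr (D : V) (z : int) : R := \sum_x line_dev x * line_dev (x + D + e *~ z).

Let corr_le D z : `|corr D z| <= #|V|%:R.
Proof.
apply: le_trans (ler_norm_sum _ _ _) _.
apply: le_trans (_ : \sum_(x : V) 1 <= _); last by rewrite sumr_const.
by apply: ler_sum => x _; rewrite normrM -[leRHS]mulr1 ler_pM// line_dev_le1.
Qed.

Let corr_lip D z : `|corr D (z + 1) - corr D z| <= 2 * om * #|V|%:R.
Proof.
rewrite /corr -sumrB; apply: le_trans (ler_norm_sum _ _ _) _.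
apply: le_trans line_dev_lip.
rewrite [leRHS](reindex_inj (addIr (D + e *~ z))); apply: ler_sum => x _.
rewrite -mulrBr normrM mulrzDr_tmp mulr1z !addrA.
by rewrite ler_piMl// line_dev_le1.
Qed.

Let corr_sum D z n : `|\sum_(v < n) corr D (z + v%:Z)| <= ell%:R * #|V|%:R.
Proof.
rewrite /corr exchange_big/=; apply: le_trans (ler_norm_sum _ _ _) _.
apply: le_trans (_ : \sum_(x : V) ell%:R <= _); last by rewrite sumr_const mulr_natr.
apply: ler_sum => x _; rewrite -mulr_sumr normrM -[leRHS]mul1r ler_pM ?line_dev_le1//.
rewrite (eq_bigr (fun v : 'I_n => line_dev (x + D + e *~ z + e *+ v))); last first.
  by move=> v _; rewrite mulrzDr_tmp -pmulrn addrA.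
exact: line_dev_sum.
Qed.

Let corr_progression D psi b lam eta : 0 < lam -> 0 <= eta <= 1 ->
  (forall c, (c < b)%N -> (1 - eta) * lam <= (psi c.+1 - psi c)%:~R <= (1 + eta) * lam) ->
  `|\sum_(c < b) corr D (psi c)| <= #|V|%:R * (ell%:R / lam + b%:R * (eta + 8 * lam * om)).
Proof.
move=> lam0 eta01 hpsi.
have := sum_along_progression (corr_le D) (corr_lip D) (corr_sum D) lam0 eta01 hpsi.
by move=> /le_trans; apply; rewrite le_eqVlt; apply/orP; left; apply/eqP; ring.
Qed.

Variables (N b : nat) (u : 'I_N -> nat -> V) (eta lmin lmax : R).
Hypotheses (N0 : (0 < N)%N) (b0 : (0 < b)%N).
Hypotheses (lmin0 : 0 < lmin) (lminmax : lmin <= lmax) (eta01 : 0 <= eta <= 1).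

(** Any two of the [N] families drift apart along [e] at a nearly constant rate [lam]. The rate is
    positive for one ordering of [i] and [j] only, hence the disjunction. *)
Definition spread := forall i j : 'I_N, i != j ->
  exists D : V, exists psi : nat -> int, exists lam : R, [/\ lmin <= lam <= lmax,
    (forall c, (c < b)%N -> (1 - eta) * lam <= (psi c.+1 - psi c)%:~R <= (1 + eta) * lam) &
    (forall c, (c < b)%N -> u i c - u j c = D + e *~ psi c) \/
    (forall c, (c < b)%N -> u j c - u i c = D + e *~ psi c)].

Hypothesis u_spread : spread.

Lemma om_ge0 : 0 <= om.
Proof.
have V0 : 0 < #|V|%:R :> R by rewrite ltr0n; apply/card_gt0P; exists 0.
by rewrite -(pmulr_lge0 _ V0); apply: le_trans f_lip; exact: sumr_ge0.
Qed.

Let pair i j := \sum_(c < b) \sum_y line_dev (y - u i c) * line_dev (y - u j c).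

Let pairC i j : pair i j = pair j i.
Proof. by apply: eq_bigr => c _; apply: eq_bigr => y _; rewrite mulrC. Qed.

Let pairE i j : pair i j = \sum_(c < b) \sum_x line_dev x * line_dev (x + (u i c - u j c)).
Proof.
apply: eq_bigr => c _; rewrite (reindex_inj (addIr (u i c)))/=; apply: eq_bigr => x _.
by rewrite addrK addrA.
Qed.

Let E := ell%:R / lmin + b%:R * (eta + 8 * lmax * om).

Let pair_diag i : pair i i <= b%:R * #|V|%:R.
Proof.
apply: le_trans (_ : \sum_(c < b) \sum_(y : V) 1 <= _); last first.
  by rewrite sumr_const card_ord sumr_const mulr_natl.
apply: ler_sum => c _; apply: ler_sum => y _; apply: le_trans (ler_norm _) _.
by rewrite normrM -[leRHS]mulr1 ler_pM// line_dev_le1.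
Qed.

Let pair_off i j : i != j -> pair i j <= #|V|%:R * E.
Proof.
move=> ij; have [D [psi [lam [/andP[l1 l2] hpsi hD]]]] := u_spread ij.
have lam0 : 0 < lam by exact: lt_le_trans l1.
have pE : pair i j = \sum_(c < b) corr D (psi c).
  case: hD => hD; last rewrite pairC; rewrite pairE; apply: eq_bigr => c _.
    by apply: eq_bigr => x _; rewrite hD// addrA.
  by apply: eq_bigr => x _; rewrite hD// addrA.
rewrite pE; apply: le_trans (ler_norm _) _.
apply: le_trans (corr_progression D lam0 eta01 hpsi) _.
rewrite ler_wpM2l// lerD//; first by rewrite ler_wpM2l// lef_pV2.
rewrite ler_wpM2l// lerD2l ler_wpM2r ?om_ge0// ler_pM2l//.
Qed.

(** Convexity in [c] reduces the square to correlations of [u i c] and [u j c] with the same [c].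
    The [N] diagonal pairs among [N ^ 2] give [1 / N]; the others are sums of [corr] along a
    progression, by [spread]. *)
Lemma second_moment :
  \sum_y ((N%:R * b%:R)^-1 * \sum_(i < N) \sum_(c < b) line_dev (y - u i c)) ^+ 2 <=
  #|V|%:R * (N%:R^-1 + ell%:R / (lmin * b%:R) + eta + 8 * lmax * om).
Proof.
have NR : 0 < N%:R :> R by rewrite ltr0n.
have bR : 0 < b%:R :> R by rewrite ltr0n.
have jensen (a : 'I_b -> R) : (\sum_c a c) ^+ 2 <= b%:R * \sum_c a c ^+ 2.
  have : 0 <= \sum_c \sum_c' (a c - a c') ^+ 2.
    by apply: sumr_ge0 => c _; apply: sumr_ge0 => c' _; exact: sqr_ge0.
  rewrite (eq_bigr (fun c => b%:R * a c ^+ 2 - 2 * a c * \sum_c' a c' + \sum_c' a c' ^+ 2)).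
    rewrite big_split/= sumrB -!mulr_sumr -mulr_suml sumr_const card_ord -mulr_sumr.
    rewrite -[X in _ + X]mulr_natl; lra.
  move=> c _; rewrite mulr_natl -[X in _ *+ X]card_ord -sumr_const !mulr_sumr -sumrB -big_split/=.
  by apply: eq_bigr => c' _; ring.
have key : \sum_y (\sum_(i < N) \sum_(c < b) line_dev (y - u i c)) ^+ 2 <=
    b%:R * (N%:R * (b%:R * #|V|%:R) + N%:R * (N%:R * (#|V|%:R * E))).
  apply: (@le_trans _ _ (\sum_y b%:R * \sum_(c < b) (\sum_(i < N) line_dev (y - u i c)) ^+ 2)).
    by apply: ler_sum => y _; rewrite exchange_big/=; exact: jensen.
  rewrite -mulr_sumr ler_pM2l//.
  have -> : \sum_y \sum_(c < b) (\sum_(i < N) line_dev (y - u i c)) ^+ 2 =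
      \sum_(i < N) \sum_(j < N) pair i j.
    rewrite exchange_big/= /pair; under [RHS]eq_bigr do rewrite exchange_big/=.
    rewrite [RHS]exchange_big/=; apply: eq_bigr => c _.
    under [RHS]eq_bigr do rewrite exchange_big/=.
    rewrite [RHS]exchange_big/=; apply: eq_bigr => y _.
    by rewrite expr2 mulr_suml; apply: eq_bigr => i _; rewrite mulr_sumr.
  have E0 : 0 <= E.
    have l0 : 0 <= lmax by apply: le_trans lminmax; exact: ltW.
    have /andP[eta0 _] := eta01.
    by rewrite addr_ge0 ?divr_ge0 ?(ltW lmin0) ?mulr_ge0 ?addr_ge0 ?mulr_ge0 ?om_ge0.
  apply: (@le_trans _ _ (\sum_(i < N) (b%:R * #|V|%:R + N%:R * (#|V|%:R * E)))); last first.
    by rewrite sumr_const card_ord -[leLHS]mulr_natl mulrDr.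
  apply: ler_sum => i _; rewrite (bigD1 i)//= lerD// ?pair_diag//.
  apply: le_trans (_ : \sum_(j < N | j != i) #|V|%:R * E <= _).
    by apply: ler_sum => j ji; apply: pair_off; rewrite eq_sym.
  apply: le_trans (_ : \sum_(j < N) #|V|%:R * E <= _).
    by rewrite [leRHS](bigD1 i)//= lerDr mulr_ge0.
  by rewrite sumr_const card_ord -[leLHS]mulr_natl.
rewrite (eq_bigr (fun y => (N%:R * b%:R)^-1 ^+ 2 *
    (\sum_(i < N) \sum_(c < b) line_dev (y - u i c)) ^+ 2)); last by move=> y _; rewrite exprMn.
rewrite -mulr_sumr -(ler_pM2l (exprn_gt0 2 (mulr_gt0 NR bR))) mulrA -exprMn mulfV ?expr1n ?mul1r; last first.
  by rewrite mulf_neq0 ?lt0r_neq0.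
apply: le_trans key _; rewrite le_eqVlt; apply/orP; left; apply/eqP; rewrite /E; field.
by rewrite !lt0r_neq0.
Qed.

Lemma weighted_line_avg (h : V -> R) (z : R) : (forall y, 0 <= h y <= 1) -> 0 < z ->
  N%:R^-1 + ell%:R / (lmin * b%:R) + eta + 8 * lmax * om <= z ^+ 2 ->
  \sum_(i < N) \sum_(c < b) \sum_y h y * line_avg (y - u i c) <=
  \sum_(i < N) \sum_(c < b) \sum_y h y * f (y - u i c) + N%:R * b%:R * (z * #|V|%:R).
Proof.
move=> h01 z0 hz.
have NR : 0 < N%:R :> R by rewrite ltr0n.
have bR : 0 < b%:R :> R by rewrite ltr0n.
have V0 : 0 <= #|V|%:R :> R by [].
pose G y := (N%:R * b%:R)^-1 * \sum_(i < N) \sum_(c < b) line_dev (y - u i c).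
have G2 : \sum_y G y ^+ 2 <= #|V|%:R * z ^+ 2.
  by apply: le_trans second_moment _; rewrite ler_wpM2l.
(* AM-GM: [- h * G <= z / 2 + G ^ 2 / (2 * z)] *)
have hG : - (z * #|V|%:R) <= \sum_y h y * G y.
  apply: (@le_trans _ _ (\sum_y (- (z / 2) - (2 * z)^-1 * G y ^+ 2))).
    rewrite sumrB -mulr_sumr sumr_const -[X in X - _]mulr_natl.
    have : (2 * z)^-1 * \sum_y G y ^+ 2 <= (2 * z)^-1 * (#|V|%:R * z ^+ 2).
      by rewrite ler_wpM2l// invr_ge0 mulr_ge0// ltW.
    rewrite (_ : (2 * z)^-1 * (#|V|%:R * z ^+ 2) = z / 2 * #|V|%:R); last by field; lra.
    rewrite -[card _]/#|V|; lra.
  apply: ler_sum => y _; have /andP[h0 h1] := h01 y.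
  have : 0 <= (2 * z)^-1 * (z * h y + G y) ^+ 2.
    by rewrite mulr_ge0 ?sqr_ge0// invr_ge0 mulr_ge0// ltW.
  have -> : (2 * z)^-1 * (z * h y + G y) ^+ 2 =
    z / 2 * h y ^+ 2 + h y * G y + (2 * z)^-1 * G y ^+ 2 by field; lra.
  have : z / 2 * h y ^+ 2 <= z / 2 by rewrite ler_piMr ?divr_ge0 ?(ltW z0)// expr_le1.
  lra.
have sumG : \sum_(i < N) \sum_(c < b) \sum_y h y * line_dev (y - u i c) =
    N%:R * b%:R * \sum_y h y * G y.
  rewrite mulr_sumr; under eq_bigr do rewrite exchange_big/=.
  rewrite exchange_big/=; apply: eq_bigr => y _.
  rewrite /G mulrCA [X in _ = h y * X]mulVKf ?mulf_neq0 ?lt0r_neq0//.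
  by rewrite mulr_sumr; apply: eq_bigr => i _; rewrite mulr_sumr.
have -> : \sum_(i < N) \sum_(c < b) \sum_y h y * line_avg (y - u i c) =
  \sum_(i < N) \sum_(c < b) \sum_y h y * f (y - u i c) -
  \sum_(i < N) \sum_(c < b) \sum_y h y * line_dev (y - u i c).
  rewrite -sumrB; apply: eq_bigr => i _; rewrite -sumrB; apply: eq_bigr => c _.
  by rewrite -sumrB; apply: eq_bigr => y _; rewrite /line_dev; ring.
rewrite sumG lerD2l -mulrN ler_pM2l ?mulr_gt0//; lra.
Qed.

End Equidistribution.

(** The bound holds on average over [(i, c)], so some [(i, c)] satisfies it for the whole sum over
    [t]. A single [(i, c)] is required because the hits of all the [t] must start from one base
    point to fill blocks. *)
Lemma exists_good_direction (R : realType) (V : finZmodType) (f h : V -> R) (e : V)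
    (ell N b : nat) (W : finType) (u : W -> 'I_N -> nat -> V) (om eta lmin lmax c0 z : R) :
  (0 < ell)%N -> (forall x, 0 <= f x <= 1) -> (forall x, 0 <= h x <= 1) ->
  \sum_x `|f (x + e) - f x| <= om * #|V|%:R ->
  (0 < N)%N -> (0 < b)%N -> 0 < lmin -> lmin <= lmax -> 0 <= eta <= 1 ->
  (forall t, spread e b (u t) eta lmin lmax) -> 0 < z ->
  N%:R^-1 + ell%:R / (lmin * b%:R) + eta + 8 * lmax * om <= z ^+ 2 ->
  (forall t i c, (c < b)%N -> \sum_y h y * f (y - u t i c) <= c0 * #|V|%:R) ->
  exists i : 'I_N, exists2 c : nat, (c < b)%N &
    \sum_t \sum_y h y * line_avg f e ell (y - u t i c) <= #|W|%:R * ((c0 + z) * #|V|%:R).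
Proof.
move=> ell0 f01 h01 f_lip N0 b0 lmin0 lmm eta01 us z0 hz hc0.
have sumK (T : finType) (a : R) : \sum_(t : T) a = #|T|%:R * a.
  by rewrite sumr_const mulr_natl.
apply: contrapT => /forallNP hno.
have hlt (i : 'I_N) (c : 'I_b) : #|W|%:R * ((c0 + z) * #|V|%:R) <
    \sum_t \sum_y h y * line_avg f e ell (y - u t i c).
  by rewrite ltNge; apply/negP => hle; apply: (hno i); exists c.
have up : \sum_t \sum_(i < N) \sum_(c < b) \sum_y h y * line_avg f e ell (y - u t i c) <=
    \sum_(t : W) N%:R * b%:R * ((c0 + z) * #|V|%:R).
  apply: ler_sum => t _.
  apply: le_trans (weighted_line_avg ell0 f01 f_lip N0 b0 lmin0 lmm eta01 (us t) h01 z0 hz) _.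
  rewrite mulrDl mulrDr lerD2r.
  apply: le_trans (_ : \sum_(i < N) \sum_(c < b) c0 * #|V|%:R <= _).
    by apply: ler_sum => i _; apply: ler_sum => c _; exact: hc0.
  by rewrite !sumK !card_ord mulrA.
have : \sum_(i < N) \sum_(c < b) #|W|%:R * ((c0 + z) * #|V|%:R) <
    \sum_(i < N) \sum_(c < b) \sum_t \sum_y h y * line_avg f e ell (y - u t i c).
  pose i0 := Ordinal N0; pose cc0 := Ordinal b0.
  rewrite (bigD1 i0)//= [ltRHS](bigD1 i0)//=; apply: ltr_leD.
    rewrite (bigD1 cc0)//= [ltRHS](bigD1 cc0)//=; apply: ltr_leD; first exact: (hlt i0 cc0).
    by apply: ler_sum => c _; apply: ltW; exact: hlt.
  by apply: ler_sum => i _; apply: ler_sum => c _; apply: ltW; exact: hlt.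
have -> : \sum_(i < N) \sum_(c < b) \sum_t \sum_y h y * line_avg f e ell (y - u t i c) =
    \sum_t \sum_(i < N) \sum_(c < b) \sum_y h y * line_avg f e ell (y - u t i c).
  rewrite [RHS]exchange_big/=; apply: eq_bigr => i _; rewrite [RHS]exchange_big/=.
  by apply: eq_bigr.
move=> /lt_le_trans /(_ up); rewrite !sumK !card_ord.
by rewrite mulrA [_ * (#|W|%:R * _)]mulrCA ltxx.
Qed.

(** * Integer vectors close to the sphere *)

Section SphereGraph.
Variables (R : realType) (D : nat) (u0 : 'I_D -> R) (m l : 'I_D) (r rho : R).
Hypotheses (lm : l != m) (r0 : 0 < r) (u0r : \sum_k u0 k ^+ 2 = r ^+ 2) (u0m : u0 m != 0).

Let mu := `|u0 m|.
Let mu0 : 0 < mu. Proof. by rewrite normr_gt0. Qed.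

Hypotheses (rho0 : 0 < rho) (rhor : rho <= r) (rhomu : D%:R * (rho * (3 * r)) <= 3 / 4 * mu ^+ 2).

Definition near_axis (p : 'I_D -> R) := forall k, k != m -> `|p k - u0 k| <= rho.

(* The coordinate [m] of the point of the sphere of radius [r] above [p]. *)
Definition sphere_graph (p : 'I_D -> R) : R :=
  Num.sg (u0 m) * Num.sqrt (r ^+ 2 - \sum_(k | k != m) p k ^+ 2).

Local Notation phi := sphere_graph.
Let qq (p : 'I_D -> R) := r ^+ 2 - \sum_(k | k != m) p k ^+ 2.

Let u0_le k : `|u0 k| <= r.
Proof.
rewrite -(ler_pXn2r (ltn0Sn 1)) ?nnegrE ?(ltW r0)// -[leLHS]normrX ger0_norm ?sqr_ge0//.
by rewrite -u0r (bigD1 k)//= lerDl sumr_ge0// => j _; exact: sqr_ge0.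
Qed.

Let near_le p k : near_axis p -> k != m -> `|p k| <= 2 * r.
Proof.
move=> np km; have := np k km; have := u0_le k.
have := ler_normD (p k - u0 k) (u0 k); rewrite subrK; have := rhor; lra.
Qed.

Let qq_u0 : qq u0 = mu ^+ 2.
Proof. by rewrite /qq -u0r (bigD1 m)//= addrK /mu -normrX ger0_norm ?sqr_ge0. Qed.

Let sum_bound (F : 'I_D -> R) c : 0 <= c -> (forall k, k != m -> `|F k| <= c) ->
  `|\sum_(k | k != m) F k| <= D%:R * c.
Proof.
move=> c0 h; apply: le_trans (ler_norm_sum _ _ _) _.
apply: le_trans (_ : \sum_(k < D) c <= _); last by rewrite sumr_const card_ord -[leLHS]mulr_natl.
rewrite big_mkcond/=; apply: ler_sum => k _; case: ifP => // km; exact: h.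
Qed.

(** Moving a coordinate by [rho] changes its square by at most [3 * r * rho]; the smallness of [rho]
    takes away three quarters of [mu ^+ 2] and leaves one. *)
Let qq_ge p : near_axis p -> mu ^+ 2 / 4 <= qq p.
Proof.
move=> np.
have : `|\sum_(k | k != m) (p k ^+ 2 - u0 k ^+ 2)| <= D%:R * (rho * (3 * r)).
  apply: sum_bound => [|k km]; first by rewrite !mulr_ge0 ?(ltW rho0) ?(ltW r0).
  have -> : p k ^+ 2 - u0 k ^+ 2 = (p k - u0 k) * (p k + u0 k) by ring.
  rewrite normrM ler_pM ?np//; have := ler_normD (p k) (u0 k).
  have := near_le np km; have := u0_le k; lra.
rewrite sumrB => h; have := ler_norm (\sum_(k | k != m) p k ^+ 2 - \sum_(k | k != m) u0 k ^+ 2).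
have := qq_u0; rewrite /qq; have := rhomu; lra.
Qed.

Let sg2 : Num.sg (u0 m) * Num.sg (u0 m) = 1.
Proof. by rewrite -expr2 sqr_sg u0m. Qed.

Lemma sphere_graph_sqr p : near_axis p -> phi p ^+ 2 = qq p.
Proof.
move=> np; rewrite /phi exprMn expr2 sg2 mul1r sqr_sqrtr//.
by apply: le_trans (qq_ge np); rewrite divr_ge0// sqr_ge0.
Qed.

(** The square root in [phi] without its sign; the divisions below are made by this positive
    quantity. *)
Let psi p := Num.sg (u0 m) * phi p.

Let psi_ge p : near_axis p -> mu / 2 <= psi p.
Proof.
move=> np; rewrite /psi /phi mulrA sg2 mul1r -[leLHS]ger0_norm; last by rewrite divr_ge0// ltW.
rewrite -sqrtr_sqr; apply: ler_wsqrtr; apply: le_trans (qq_ge np); rewrite exprMn; lra.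
Qed.

Let phi_psi p : phi p = Num.sg (u0 m) * psi p.
Proof. by rewrite /psi mulrA sg2 mul1r. Qed.

Let psi_sqr p : near_axis p -> psi p ^+ 2 = qq p.
Proof. by move=> np; rewrite /psi exprMn [_ ^+ 2]expr2 sg2 mul1r sphere_graph_sqr. Qed.

Let psi_le p : near_axis p -> psi p <= r.
Proof.
move=> np; rewrite -(ler_pXn2r (ltn0Sn 1)) ?nnegrE ?(ltW r0)//; last first.
  by apply: le_trans (psi_ge np); rewrite divr_ge0// ltW.
by rewrite psi_sqr// /qq lerBlDr lerDl sumr_ge0// => k _; exact: sqr_ge0.
Qed.

Let norm_sgM (x : R) : `|Num.sg (u0 m) * x| = `|x|.
Proof. by rewrite normrM normr_sg u0m mul1r. Qed.

Let Lip := 4 * D%:R * r / mu.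

Let Lip0 : 0 <= Lip.
Proof. by rewrite divr_ge0 ?mulr_ge0 ?(ltW r0) ?(ltW mu0). Qed.

Lemma sphere_graph_lip p p' dl : near_axis p -> near_axis p' -> 0 <= dl ->
  (forall k, k != m -> `|p k - p' k| <= dl) -> `|phi p - phi p'| <= 4 * D%:R * r / mu * dl.
Proof.
move=> np np' dl0 h; rewrite !phi_psi -mulrBr norm_sgM.
have s0 : mu <= psi p + psi p' by have := psi_ge np; have := psi_ge np'; lra.
have s00 : 0 < psi p + psi p' by apply: lt_le_trans s0.
have -> : psi p - psi p' = (psi p ^+ 2 - psi p' ^+ 2) / (psi p + psi p') by field; lra.
rewrite !psi_sqr// normrM normfV [`|psi p + _|]gtr0_norm//.
have hN : `|qq p - qq p'| <= D%:R * (dl * (4 * r)).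
  have -> : qq p - qq p' = \sum_(k | k != m) (p' k ^+ 2 - p k ^+ 2) by rewrite sumrB /qq; ring.
  apply: sum_bound => [|k km]; first by rewrite !mulr_ge0// ltW.
  have -> : p' k ^+ 2 - p k ^+ 2 = (p' k - p k) * (p' k + p k) by ring.
  rewrite normrM ler_pM// ?(distrC (p' k)) ?h//; apply: le_trans (ler_normD _ _) _.
  have := near_le np km; have := near_le np' km; lra.
rewrite ler_pdivrMr//; apply: le_trans hN _.
have -> : 4 * D%:R * r / mu * dl * (psi p + psi p') =
  (4 * D%:R * r * dl) * ((psi p + psi p') / mu) by ring.
have : 1 <= (psi p + psi p') / mu by rewrite ler_pdivlMr// mul1r.
have : 0 <= 4 * D%:R * r * dl by rewrite !mulr_ge0// ltW.
move=> h1 h2; apply: le_trans (_ : 4 * D%:R * r * dl * 1 <= _); first by rewrite mulr1; lra.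
by rewrite ler_wpM2l.
Qed.

(* The partial derivative of [sphere_graph] in the direction [l]. *)
Definition slope p : R := - p l / phi p.

Let Lip_le p p' dl := @sphere_graph_lip p p' dl.

(** The radicand is quadratic in the coordinate [l], so the secant slope is, up to sign,
    [(2 * p l + th) / (psi p + psi p')]. Replacing its terms by their values at [p0] costs a
    multiple of [b0], uniformly over all steps near the same [p0]. *)
Lemma sphere_graph_secant p0 p p' th b0 : near_axis p0 -> near_axis p -> near_axis p' ->
  0 <= b0 -> 0 < th -> (forall k, k != m -> p' k = p k + (if k == l then th else 0)) ->
  (forall k, k != m -> `|p k - p0 k| <= b0) -> (forall k, k != m -> `|p' k - p0 k| <= b0) ->
  `|phi p' - phi p - th * slope p0| <= th * (8 * r * (1 + Lip) / mu ^+ 2 * b0).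
Proof.
move=> np0 np np' b00 th0 hp' hb hb'.
have qE : qq p' - qq p = - (th * (2 * p l + th)).
  rewrite /qq (bigD1 l)//= [in X in _ - X](bigD1 l)//= (hp' l lm) eqxx.
  rewrite (eq_bigr (fun k => p k ^+ 2)); last by move=> k /andP[km kl]; rewrite hp'// (negbTE kl) addr0.
  ring.
set a := psi p; set a' := psi p'; set a0 := psi p0.
have ha : mu / 2 <= a := psi_ge np; have ha' : mu / 2 <= a' := psi_ge np'.
have ha0 : mu / 2 <= a0 := psi_ge np0.
have s0 : 0 < a + a' by have := mu0; lra.
have a00 : 0 < a0 by have := mu0; lra.
have slE : slope p0 = Num.sg (u0 m) * (- p0 l / a0).
  rewrite /slope phi_psi -/a0 invfM invr_sg; ring.
rewrite slE !phi_psi -/a -/a'.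
have -> : Num.sg (u0 m) * a' - Num.sg (u0 m) * a - th * (Num.sg (u0 m) * (- p0 l / a0)) =
  Num.sg (u0 m) * (a' - a - th * (- p0 l / a0)) by ring.
rewrite norm_sgM.
have e1 : a' - a = - (th * (2 * p l + th)) / (a + a').
  by rewrite -qE -!psi_sqr//; rewrite -/a -/a'; field; lra.
have -> : a' - a - th * (- p0 l / a0) =
   th * ((- 2 * (p l - p0 l) * a0 - th * a0 + p0 l * (a - a0) + p0 l * (a' - a0)) / ((a + a') * a0)).
  by rewrite e1; field; rewrite !lt0r_neq0.
rewrite normrM (gtr0_norm th0) (ler_pM2l th0) normrM normfV (gtr0_norm (mulr_gt0 s0 a00)).
have thb : th <= 2 * b0.
  have := hb l lm; have := hb' l lm; rewrite hp'// eqxx !ler_norml => /andP[_ h1] /andP[h2 _]; lra.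
have h1 : `|p0 l| <= 2 * r by exact: near_le.
have ha0r : a0 <= r by exact: psi_le.
have hab : `|a - a0| <= Lip * b0 by rewrite /a /a0 /psi -mulrBr norm_sgM Lip_le.
have hab' : `|a' - a0| <= Lip * b0 by rewrite /a' /a0 /psi -mulrBr norm_sgM Lip_le.
have num : `|- 2 * (p l - p0 l) * a0 - th * a0 + p0 l * (a - a0) + p0 l * (a' - a0)| <=
    4 * r * (1 + Lip) * b0.
  have a0n : `|a0| <= r by rewrite gtr0_norm.
  have n1 : `|- 2 * (p l - p0 l) * a0| <= 2 * b0 * r.
    rewrite normrM; apply: ler_pM => //.
    by rewrite normrM normrN (ger0_norm (ler0n _ 2)) ler_pM2l// hb.
  have n2 : `|th * a0| <= 2 * b0 * r.
    by rewrite normrM; apply: ler_pM => //; rewrite gtr0_norm.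
  have n3 : `|p0 l * (a - a0)| <= 2 * r * (Lip * b0) by rewrite normrM ler_pM.
  have n4 : `|p0 l * (a' - a0)| <= 2 * r * (Lip * b0) by rewrite normrM ler_pM.
  have := ler_normD (- 2 * (p l - p0 l) * a0 - th * a0 + p0 l * (a - a0)) (p0 l * (a' - a0)).
  have := ler_normD (- 2 * (p l - p0 l) * a0 - th * a0) (p0 l * (a - a0)).
  have := ler_normB (- 2 * (p l - p0 l) * a0) (th * a0).
  lra.
have aa0 : 0 < (a + a') * a0 by exact: mulr_gt0.
rewrite ler_pdivrMr//; apply: le_trans num _.
have den : mu * (mu / 2) <= (a + a') * a0.
  by apply: ler_pM; [exact: ltW|rewrite divr_ge0 ?ltW|lra|].
have -> : 8 * r * (1 + Lip) / mu ^+ 2 * b0 * ((a + a') * a0) =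
  (4 * r * (1 + Lip) * b0) * (((a + a') * a0) / (mu * (mu / 2))) by field; rewrite (lt0r_neq0 mu0).
have : 1 <= ((a + a') * a0) / (mu * (mu / 2)).
  by rewrite ler_pdivlMr ?mul1r// !mulr_gt0// invr_gt0.
have : 0 <= 4 * r * (1 + Lip) * b0 by rewrite !mulr_ge0 ?addr_ge0 ?(ltW r0).
by move=> h2 h3; rewrite -[leLHS]mulr1 ler_wpM2l.
Qed.

(** Here curvature acts. With [q] the common value of [a ^+ 2 + p l ^+ 2] and [a' ^+ 2 + p' l ^+ 2],
    the difference of slopes is, up to sign, [p l - p' l] times [(a * a' + q + p l * p' l) / (a * a'
    * (a + a'))]. As [q + p l * p' l >= 0], that factor is at least [1 / (a + a')], hence at least
    [1 / (2 * r)]. *)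
Lemma slope_bounds p p' : near_axis p -> near_axis p' ->
  (forall k, k != m -> k != l -> p k = p' k) ->
  `|p l - p' l| / (2 * r) <= `|slope p - slope p'| <= 8 * r / mu.
Proof.
move=> np np' hpp'.
set a := psi p; set a' := psi p'.
have ha : mu / 2 <= a := psi_ge np; have ha' : mu / 2 <= a' := psi_ge np'.
have a0 : 0 < a by have := mu0; lra.
have a'0 : 0 < a' by have := mu0; lra.
have slE q : near_axis q -> slope q = Num.sg (u0 m) * (- q l / psi q).
  move=> nq; rewrite /slope phi_psi invfM invr_sg; ring.
rewrite !slE// -/a -/a' -mulrBr norm_sgM.
apply/andP; split; last first.
  have b1 x y : `|x| <= 2 * r -> mu / 2 <= y -> `|- x / y| <= 4 * r / mu.
    move=> hx hy; have y0 : 0 < y by have := mu0; lra.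
    rewrite normrM normrN normfV (gtr0_norm y0) ler_pdivrMr//; apply: le_trans hx _.
    rewrite mulrAC ler_pdivlMr//; have := r0; nra.
  apply: le_trans (ler_normB _ _) _.
  have := b1 _ _ (near_le np lm) ha; have := b1 _ _ (near_le np' lm) ha'; lra.
pose q := qq p + p l ^+ 2.
have q1 : a ^+ 2 = q - p l ^+ 2 by rewrite psi_sqr// /q addrK.
have q2 : a' ^+ 2 = q - p' l ^+ 2.
  rewrite psi_sqr// /q /qq (bigD1 l)//= [in X in _ = r ^+ 2 - X + _ - _](bigD1 l)//=.
  have -> : \sum_(k | (k != m) && (k != l)) p k ^+ 2 = \sum_(k | (k != m) && (k != l)) p' k ^+ 2.
    by apply: eq_bigr => k /andP[km kl]; rewrite hpp'.
  ring.
have xx : - q <= p l * p' l.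
  have h1 : p l ^+ 2 <= q by have := sqr_ge0 a; lra.
  have h2 : p' l ^+ 2 <= q by have := sqr_ge0 a'; lra.
  have := sqr_ge0 (p l + p' l); rewrite sqrrD; lra.
have -> : - p l / a - - p' l / a' =
   - ((p l - p' l) * ((a * a' + q + p l * p' l) / (a * a' * (a + a')))).
  have e : (p l * a' - p' l * a) * (a + a') = (p l - p' l) * (a * a' + q + p l * p' l).
    have -> : (p l * a' - p' l * a) * (a + a') = (p l - p' l) * (a * a') + p l * a' ^+ 2 - p' l * a ^+ 2 by ring.
    by rewrite q1 q2; ring.
  by rewrite mulrA -e; field; rewrite !lt0r_neq0 ?addr_gt0.
have aa0 : 0 < a * a' by exact: mulr_gt0.
have aaa0 : 0 < a + a' by exact: addr_gt0.
have num0 : 0 <= a * a' + q + p l * p' l by lra.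
rewrite normrN normrM ler_wpM2l// ger0_norm; last by rewrite divr_ge0// ltW// mulr_gt0.
rewrite ler_pdivlMr; last exact: mulr_gt0.
apply: le_trans (_ : a * a' <= _); last by lra.
rewrite mulrCA ger_pMr// mulrC ler_pdivrMr ?mulr_gt0// mul1r.
have := psi_le np; have := psi_le np'; rewrite -/a -/a'; lra.
Qed.

End SphereGraph.

(** * Families of lattice vectors that drift apart *)

Section LatticeDirections.
Variables (R : realType) (D : nat) (u0 : 'I_D -> R) (m l : 'I_D) (r rho : R).
Hypotheses (lm : l != m) (r0 : 0 < r) (u0r : \sum_k u0 k ^+ 2 = r ^+ 2) (u0m : u0 m != 0).
Hypotheses (rho0 : 0 < rho) (rhor : rho <= r)
  (rhomu : D%:R * (rho * (3 * r)) <= 3 / 4 * `|u0 m| ^+ 2).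
Variables (nu : R) (s0 : 'I_D -> int) (a g ell N b : nat).
Hypotheses (nu0 : 0 < nu) (hs0 : forall k, `|(s0 k)%:~R - nu * u0 k| <= 1).
Hypotheses (a0 : (0 < a)%N) (g0 : (0 < g)%N).
Hypothesis fits : (1 + ell%:R + N%:R * a%:R + b.+1%:R * g%:R) / nu <= rho.

Let nun0 : nu != 0. Proof. exact: lt0r_neq0. Qed.

Let mu := `|u0 m|.
Let Lip := 4 * D%:R * r / mu.
Local Notation phi := (sphere_graph u0 m r).
Let slp := slope u0 m l r.

Definition lattice_graph (s : 'I_D -> int) : int :=
  Num.floor (nu * phi (fun k => (s k)%:~R / nu)).

(** The index [i] makes long jumps [a], which separate the slopes; [c] makes short steps [g], along
    which each slope hardly varies; [t] runs over a window of starting points. *)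
Definition lattice_point (t : 'I_D -> nat) (i c : nat) : 'I_D -> int :=
  fun k => s0 k + (t k)%:Z + (if k == l then (i * a + c * g)%N%:Z else 0).

(* Integer approximation of a vector of the sphere of radius [nu * r]. *)
Definition lattice_vector (t : 'I_D -> nat) (i c : nat) : 'I_D -> int :=
  fun k => if k == m then lattice_graph (lattice_point t i c) else lattice_point t i c k.

Variable n : nat.
Definition torus_of (z : 'I_D -> int) : 'rV['I_n.+2]_D := \row_k (z k)%:~R.

Lemma torus_ofD z z' : torus_of (fun k => z k + z' k) = torus_of z + torus_of z'.
Proof. by apply/rowP => k; rewrite !mxE intrD. Qed.

Lemma torus_ofB z z' : torus_of (fun k => z k - z' k) = torus_of z - torus_of z'.
Proof. by apply/rowP => k; rewrite !mxE intrB. Qed.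

Definition axis (k0 : 'I_D) : 'I_D -> int := fun k => if k == k0 then 1 else 0.

Lemma torus_ofMz z (w : int) : torus_of (fun k => z k * w) = torus_of z *~ w.
Proof.
have t0 : torus_of (fun=> 0) = 0 by apply/rowP => k; rewrite !mxE.
elim/int_ind: w => [|k IH|k IH].
- by rewrite mulr0z -t0; congr torus_of; apply/funext => k; rewrite mulr0.
- rewrite -[k.+1]addn1 PoszD mulrzDr_tmp -IH mulr1z -torus_ofD; congr torus_of.
  by apply/funext => j; rewrite mulrDr mulr1.
- rewrite -[k.+1]addn1 PoszD opprD mulrzDr_tmp -IH mulrN1z -torus_ofB; congr torus_of.
  by apply/funext => j; rewrite mulrDr mulrN1.
Qed.

Let pt (s : 'I_D -> int) : 'I_D -> R := fun k => (s k)%:~R / nu.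

Lemma lattice_near t i c : (forall k, (t k < ell)%N) -> (i <= N)%N -> (c <= b.+1)%N ->
  near_axis u0 m rho (pt (lattice_point t i c)).
Proof.
move=> tl iN cb k km; apply: le_trans fits; rewrite ler_pdivlMr// -[nu in leLHS](gtr0_norm nu0) -normrM.
have -> : (pt (lattice_point t i c) k - u0 k) * nu =
  ((s0 k)%:~R - nu * u0 k) + (t k)%:R + (if k == l then (i * a + c * g)%:R else 0).
  rewrite /pt /lattice_point !intrD -pmulrn; case: ifP => _; rewrite -?pmulrn; field; exact: nun0.
apply: le_trans (ler_normD _ _) _; apply: le_trans (lerD (ler_normD _ _) (lexx _)) _.
have h1 : `|(t k)%:R| <= ell%:R :> R by rewrite ger0_norm// ler_nat ltnW.
have h2 : `|if k == l then (i * a + c * g)%:R else 0| <= N%:R * a%:R + b.+1%:R * g%:R :> R.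
  case: ifP => _; last by rewrite normr0 addr_ge0// mulr_ge0.
  by rewrite ger0_norm// -!natrM -natrD ler_nat leq_add// leq_mul.
have := hs0 k; lra.
Qed.

Let C0 := 8 * r * (1 + Lip) / mu ^+ 2.
Let b0 := (ell%:R + b.+1%:R * g%:R) / nu.
Let lmin := g%:R * (a%:R / nu) / (2 * r).
Let lmax := g%:R * (8 * r / mu).

Let C00 : 0 <= C0.
Proof.
have Lip0 : 0 <= Lip by rewrite divr_ge0 ?normr_ge0// !mulr_ge0 ?(ltW r0).
by rewrite divr_ge0 ?exprn_ge0 ?normr_ge0// mulr_ge0 ?addr_ge0// mulr_ge0 ?(ltW r0).
Qed.

Let b00 : 0 <= b0.
Proof. by rewrite divr_ge0 ?(ltW nu0)// addr_ge0// mulr_ge0. Qed.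

Variable eta : R.
Hypothesis small : 2 * g%:R * (C0 * b0) + 2 <= eta * lmin.

Let pt_base t i c : (forall k, (t k < ell)%N) -> (c <= b.+1)%N ->
  forall k, `|pt (lattice_point t i c) k - pt (lattice_point (fun=> 0%N) i 0) k| <= b0.
Proof.
move=> tl cb k; rewrite /b0 ler_pdivlMr// -[nu in leLHS](gtr0_norm nu0) -normrM.
have -> : (pt (lattice_point t i c) k - pt (lattice_point (fun=> 0%N) i 0) k) * nu =
  (t k)%:R + (if k == l then (c * g)%:R else 0).
  rewrite /pt /lattice_point; case: ifP => _; rewrite ?mul0n ?addn0 ?PoszD !intrD -?pmulrn; field; exact: nun0.
apply: le_trans (ler_normD _ _) _; apply: lerD; first by rewrite ger0_norm// ler_nat ltnW.
case: ifP => _; last by rewrite normr0 mulr_ge0.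
by rewrite ger0_norm// -natrM ler_nat leq_mul.
Qed.

Let step_err t i c : (forall k, (t k < ell)%N) -> (i < N)%N -> (c < b)%N ->
  `|(lattice_graph (lattice_point t i c.+1) - lattice_graph (lattice_point t i c))%:~R -
    g%:R * slp (pt (lattice_point (fun=> 0%N) i 0))| <= g%:R * (C0 * b0) + 1.
Proof.
move=> tl iN cb; set p0 := pt _; set p := pt (lattice_point t i c); set p' := pt (lattice_point t i c.+1).
have gR : 0 < g%:R :> R by rewrite ltr0n.
have th0 : 0 < g%:R / nu by rewrite divr_gt0.
have := @sphere_graph_secant R D u0 m l r rho lm r0 u0r u0m rho0 rhor rhomu p0 p p' (g%:R / nu) b0.
have np0 : near_axis u0 m rho p0.
  by apply: lattice_near => //; [move=> k; exact: leq_ltn_trans (tl k)|exact: ltnW].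
have np : near_axis u0 m rho p by apply: lattice_near => //; [exact: ltnW|exact: leqW (ltnW cb)].
have np' : near_axis u0 m rho p' by apply: lattice_near => //; [exact: ltnW|exact: leqW].
move=> /(_ np0 np np' b00 th0) h.
have {}h : `|phi p' - phi p - g%:R / nu * slp p0| <= g%:R / nu * (C0 * b0).
  apply: h => k km.
  - rewrite /p' /p /pt /lattice_point; case: ifP => _; last by rewrite !addr0.
    by rewrite mulSn addnCA PoszD !intrD -?pmulrn; field; exact: nun0.
  - by apply: pt_base => //; exact: leqW (ltnW cb).
  - by apply: pt_base => //; exact: leqW.
rewrite /lattice_graph -/p -/p' intrB.
have /andP[f1 f2] := floor_itv (nu * phi p'); have /andP[f3 f4] := floor_itv (nu * phi p).
have : `|nu * (phi p' - phi p - g%:R / nu * slp p0)| <= nu * (g%:R / nu * (C0 * b0)).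
  by rewrite normrM (gtr0_norm nu0) ler_pM2l.
have -> : nu * (phi p' - phi p - g%:R / nu * slp p0) = nu * phi p' - nu * phi p - g%:R * slp p0 by field; exact: nun0.
have -> : nu * (g%:R / nu * (C0 * b0)) = g%:R * (C0 * b0) by field; exact: nun0.
rewrite intrD in f2; rewrite intrD in f4.
by rewrite !ler_norml => /andP[h1 h2]; apply/andP; split; lra.
Qed.

(** Outside [m] the two vectors differ by a constant in [c]; along [m] their difference advances by
    about [g] times the difference of slopes at the base points. The hypothesis [small] allows each
    family one secant error and a rounding error of 1. *)
Lemma lattice_spread (t : 'I_D -> nat) : (forall k, (t k < ell)%N) ->
  spread (torus_of (axis m)) b (fun (i : 'I_N) c => torus_of (lattice_vector t i c)) eta lmin lmax.
Proof.
move=> tl i j ij.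
have gR : 0 < g%:R :> R by rewrite ltr0n.
pose sl (i : nat) := slp (pt (lattice_point (fun=> 0%N) i 0)).
have sl_bounds : lmin <= g%:R * `|sl i - sl j| <= lmax.
  have np (i' : 'I_N) : near_axis u0 m rho (pt (lattice_point (fun=> 0%N) i' 0)).
    by apply: lattice_near => //; [move=> k; exact: leq_ltn_trans (tl k)|exact: ltnW].
  have := @slope_bounds R D u0 m l r rho lm r0 u0r u0m rho0 rhor rhomu _ _ (np i) (np j).
  have agree k : k != m -> k != l ->
      pt (lattice_point (fun=> 0%N) i 0) k = pt (lattice_point (fun=> 0%N) j 0) k.
    by move=> _ /negbTE kl; rewrite /pt /lattice_point kl.
  move=> /(_ agree)/andP[h1 h2].
  have -> : lmin = g%:R * ((a%:R / nu) / (2 * r)) by rewrite /lmin [RHS]mulrA.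
  rewrite /lmax !ler_pM2l//; apply/andP; split; last exact: h2.
  apply: le_trans h1; rewrite ler_pM2r ?invr_gt0 ?mulr_gt0//.
  rewrite -[_ / nu](gtr0_norm (divr_gt0 _ nu0)) ?ltr0n//.
  have -> : pt (lattice_point (fun=> 0%N) i 0) l - pt (lattice_point (fun=> 0%N) j 0) l =
      (i%:R - j%:R) * (a%:R / nu).
    rewrite /pt /lattice_point eqxx !mul0n !addn0 !intrD -!pmulrn !natrM; field; exact: nun0.
  rewrite [leRHS]normrM ler_peMl//; move: ij; rewrite neq_ltn => /orP[] ij.
    rewrite distrC; apply: le_trans (ler_norm _).
    have : i.+1%:R <= j%:R :> R by rewrite ler_nat.
    rewrite -natr1; lra.
  apply: le_trans (ler_norm _).
  have : j.+1%:R <= i%:R :> R by rewrite ler_nat.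
  rewrite -natr1; lra.
have oriented (i1 i2 : 'I_N) : sl i2 < sl i1 -> lmin <= g%:R * `|sl i1 - sl i2| <= lmax ->
  exists D0 : 'rV['I_n.+2]_D, exists psi : nat -> int, exists lam : R, [/\ lmin <= lam <= lmax,
    (forall c, (c < b)%N -> (1 - eta) * lam <= (psi c.+1 - psi c)%:~R <= (1 + eta) * lam) &
    (forall c, (c < b)%N -> torus_of (lattice_vector t i1 c) - torus_of (lattice_vector t i2 c) =
      D0 + torus_of (axis m) *~ psi c)].
  move=> lt12 hb12.
  exists (torus_of (fun k => if k == l then ((i1%:Z - i2%:Z) * a%:Z) else 0)).
  exists (fun c => lattice_graph (lattice_point t i1 c) - lattice_graph (lattice_point t i2 c)).
  exists (g%:R * (sl i1 - sl i2)); rewrite gtr0_norm ?subr_gt0// in hb12; split => //.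
    move=> c cb; have := step_err tl (ltn_ord i1) cb; have := step_err tl (ltn_ord i2) cb.
    rewrite -/(sl i1) -/(sl i2) !ler_norml !intrB => /andP[a1 a2] /andP[a3 a4].
    have /andP[hb1 _] := hb12.
    have : eta * lmin <= eta * (g%:R * (sl i1 - sl i2)).
      apply: ler_wpM2l => //.
      have lmin0 : 0 < lmin by rewrite /lmin !(mulr_gt0, invr_gt0, divr_gt0)// ltr0n.
      rewrite -(pmulr_lge0 _ lmin0); apply: le_trans small.
      by rewrite addr_ge0// mulr_ge0// mulr_ge0// ?C00// b00.
    have := small; move=> ? ?; apply/andP; split; lra.
  move=> c cb; rewrite -torus_ofMz -torus_ofB -torus_ofD; congr torus_of; apply/funext => k.
  rewrite /lattice_vector /axis; have [->|km] := eqVneq k m.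
    by rewrite eq_sym (negbTE lm) add0r mul1r.
  rewrite mul0r addr0 /lattice_point; case: ifP => _; last by rewrite !addr0 subrr.
  by rewrite !PoszD !PoszM; ring.
have [h|h|h] := ltgtP (sl i) (sl j).
- have sl_bounds' : lmin <= g%:R * `|sl j - sl i| <= lmax by rewrite distrC.
  have [D0 [psi [lam [l1 l2 l3]]]] := oriented j i h sl_bounds'.
  by exists D0, psi, lam; split => //; right.
- have [D0 [psi [lam [l1 l2 l3]]]] := oriented i j h sl_bounds.
  by exists D0, psi, lam; split => //; left.
- move: sl_bounds; rewrite h subrr normr0 mulr0 => /andP[h1 _].
  have : 0 < lmin by rewrite /lmin !(mulr_gt0, invr_gt0, divr_gt0)// ltr0n.
  lra.
Qed.

End LatticeDirections.

(** * Grid sets seen in a torus *)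

Section TorusIndex.
Variables (D n : nat).
Implicit Types y : 'rV['I_n.+2]_D.

Definition torus_index y : 'I_D -> int := fun k => (nat_of_ord (y 0 k))%:Z.

Lemma torus_indexK y : torus_of n (torus_index y) = y.
Proof.
apply/rowP => k; rewrite mxE /torus_index -pmulrn; apply/val_inj.
by rewrite /= Zp_nat /= modn_small.
Qed.

Lemma torus_ofK (z : 'I_D -> int) : (forall k, 0 <= z k < n.+2%:Z) ->
  torus_index (torus_of n z) = z.
Proof.
move=> hz; apply/funext => k; rewrite /torus_index mxE.
have := hz k; case: (z k) => [j|j] /andP[h0 h1]; last by [].
by rewrite -pmulrn Zp_nat /= modn_small.
Qed.

End TorusIndex.

(** * Line averages see all pairs of points in matching blocks *)

Section LineHits.
Variables (R : realType) (D n : nat) (m : 'I_D).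
Local Notation V := 'rV['I_n.+2]_D.
Local Notation e := (torus_of n (axis m)).

Definition in_block (H : nat) (c : 'I_D -> int) (y : V) :=
  [forall k, H%:Z * c k <= torus_index y k < H%:Z * (c k + 1)].

Variables (gr : ('I_D -> int) -> int) (s tau : 'I_D -> int) (H La : nat).
Hypothesis H0 : (0 < H)%N.
Hypothesis gr_ext : forall p p', (forall k, k != m -> p k = p' k) -> gr p = gr p'.
Hypothesis gr_lip : forall t : 'I_D -> nat, (forall k, (t k <= 3 * H)%N) ->
  `|gr (fun k => s k + (t k)%:Z) - gr s| <= (La * H)%N%:Z.
Hypothesis tau_other : forall k, k != m -> s k + H%:Z <= H%:Z * tau k < s k + (2 * H)%N%:Z.
Hypothesis tau_m : gr s - (La * H + 2 * H)%N%:Z < H%:Z * tau m <= gr s - (La * H + H)%N%:Z.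

Local Notation ell := ((2 * La + 3) * H)%N.

Definition graph_vector (t : 'I_D -> nat) : 'I_D -> int :=
  fun k => if k == m then gr (fun j => s j + (t j)%:Z) else s k + (t k)%:Z.

(** The ranges of [tau] allow to solve for [t] and [v] whenever [x] and [y] lie in matching blocks.
    Outside [m] the offsets lie strictly between 0 and [3 * H]; along [m], [v] is nonnegative and
    below twice the oscillation [La * H] plus [3 * H], which is [ell]. The vector does not depend on
    [t m], so each of the [ell] values of [t m] gives a hit: this is the factor [ell]. *)
Lemma block_hits (f : V -> R) c y : (forall x, 0 <= f x) -> in_block H c y ->
  ell%:R * \sum_(x | in_block H (fun k => c k - tau k) x) f x <=
  \sum_(t : {ffun 'I_D -> 'I_ell}) \sum_(v < ell) f (y - torus_of n (graph_vector (fun k => t k)) + e *+ v).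
Proof.
move=> f0 /forallP hy.
have ell0 : (0 < ell)%N by rewrite muln_gt0 H0 andbT addn_gt0 orbT.
have hit x (i : 'I_ell) : in_block H (fun k => c k - tau k) x ->
    exists t : {ffun 'I_D -> 'I_ell}, exists v : 'I_ell,
      t m = i /\ y - torus_of n (graph_vector (fun k => t k)) + e *+ v = x.
  move=> /forallP hx.
  pose dz k : int := torus_index y k - torus_index x k.
  have hd k : H%:Z * tau k - H%:Z < dz k < H%:Z * tau k + H%:Z.
    have /andP[a1 a2] := hy k; have /andP[b1 b2] := hx k.
    rewrite /dz; move: (torus_index y k) (torus_index x k) a1 a2 b1 b2 => Y X.
    rewrite !mulrDr mulr1 mulrN => a1 a2 b1 b2; apply/andP; split; lra.
  pose w k : nat := if k == m then nat_of_ord i else `|dz k - s k|%N.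
  have wE k : k != m -> (w k)%:Z = dz k - s k /\ (w k < 3 * H)%N.
    move=> km; rewrite /w (negbTE km).
    have := hd k; have := tau_other km; move: (H%:Z * tau k) => T; lia.
  have wl k : (w k < ell)%N.
    have [->|km] := eqVneq k m; first by rewrite /w eqxx.
    have [_ h] := wE k km; apply: leq_trans h _.
    by rewrite leq_mul2r leq_addl orbT.
  pose t : {ffun 'I_D -> 'I_ell} := [ffun k => Ordinal (wl k)].
  have grE : gr (fun j => s j + (t j)%:Z) = gr (fun j => s j + (if j == m then 0%N else w j)%:Z).
    by apply: gr_ext => k km; rewrite /t ffunE/= (negbTE km).
  have hg : `|gr (fun j => s j + (t j)%:Z) - gr s| <= (La * H)%N%:Z.
    rewrite grE; apply: (gr_lip (t := fun j => if j == m then 0%N else w j)) => k.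
    by case: eqVneq => // km; have [_ /ltnW] := wE k km.
  pose vz := gr (fun j => s j + (t j)%:Z) - dz m.
  have hv : (0 <= vz < ell%:Z).
    have := hd m; move: hg tau_m; rewrite /vz.
    move: (H%:Z * tau m) (dz m) (gr _) (gr s) => T d1 g1 g0.
    rewrite mulnDl -mulnA; move: (La * H)%N => LH; lia.
  have vl : (`|vz|%N < ell)%N by lia.
  exists t, (Ordinal vl); split; first by apply/val_inj; rewrite /t ffunE /= /w eqxx.
  rewrite /= pmulrn -torus_ofMz -{1}(torus_indexK y) -torus_ofB -torus_ofD -[RHS]torus_indexK.
  congr torus_of; apply/funext => k; rewrite /graph_vector /axis.
  have vE : (`|vz|%N : int) = vz by rewrite gez0_abs//; case/andP: hv.
  case: (eqVneq k m) => [->|km].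
    by rewrite mul1r vE /vz /dz opprB addrA subrK addrC subrK.
  have [h _] := wE k km.
  by rewrite /t ffunE /= h mul0r addr0 [s k + _]addrC subrK /dz opprB addrC subrK.
rewrite mulr_natl -[X in _ *+ X]card_ord -sumr_const.
pose G (t : {ffun 'I_D -> 'I_ell}) (v : 'I_ell) : V := y - torus_of n (graph_vector (fun k => t k)) + e *+ v.
pose Q x := in_block H (fun k => c k - tau k) x.
have step (i : 'I_ell) : \sum_(x | Q x) f x <=
    \sum_(t : {ffun 'I_D -> 'I_ell} | t m == i) \sum_(v < ell) \sum_(x | Q x) (G t v == x)%:R * f x.
  rewrite (eq_bigr (fun t => \sum_(x | Q x) \sum_v (G t v == x)%:R * f x)); last by move=> t _; rewrite exchange_big.
  rewrite exchange_big/=; apply: ler_sum => x Qx.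
  have [t [v [tm E]]] := hit x i Qx.
  rewrite (bigD1 t) ?tm//= (bigD1 v)//= {1}/G E eqxx mul1r -addrA lerDl.
  apply: addr_ge0; first by apply: sumr_ge0 => ? _; exact: mulr_ge0.
  by apply: sumr_ge0 => ? _; apply: sumr_ge0 => ? _; exact: mulr_ge0.
apply: le_trans (ler_sum _ (fun i _ => step i)) _.
rewrite [leRHS](partition_big (fun t : {ffun 'I_D -> 'I_ell} => t m) predT)//=.
apply: ler_sum => i _; apply: ler_sum => t _; apply: ler_sum => v _.
rewrite -/(G t v) big_mkcond (bigD1 (G t v))//= big1 ?addr0; last first.
  by move=> x /negbTE xG; rewrite eq_sym xG mul0r; case: ifP.
by rewrite eqxx mul1r; case: ifP.
Qed.

(** The factor [ell] of [block_hits] cancels the normalisation of [line_avg], and the blocks [c j]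
    are disjoint, so no [y] is used twice. *)
Lemma line_avg_hits (J : finType) (P : pred J) (c : J -> 'I_D -> int) (f h : V -> R) :
  injective c -> (forall x, 0 <= f x) -> (forall x, 0 <= h x) ->
  \sum_(j | P j) (\sum_(y | in_block H (c j) y) h y) *
      (\sum_(x | in_block H (fun k => c j k - tau k) x) f x) <=
  \sum_(t : {ffun 'I_D -> 'I_ell}) \sum_y h y *
    line_avg f e ell (y - torus_of n (graph_vector (fun k => t k))).
Proof.
move=> cinj f0 h0.
have ell0 : 0 < ell%:R :> R by rewrite ltr0n muln_gt0 H0 andbT addn_gt0 orbT.
pose G y := ell%:R^-1 * \sum_(t : {ffun 'I_D -> 'I_ell}) \sum_(v < ell)
  f (y - torus_of n (graph_vector (fun k => t k)) + e *+ v).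
have G0 y : 0 <= G y.
  by rewrite mulr_ge0 ?invr_ge0//; apply: sumr_ge0 => ? _; exact: sumr_ge0.
have -> : \sum_(t : {ffun 'I_D -> 'I_ell}) \sum_y h y *
    line_avg f e ell (y - torus_of n (graph_vector (fun k => t k))) = \sum_y h y * G y.
  rewrite exchange_big/=; apply: eq_bigr => y _.
  by rewrite /G mulr_sumr mulr_sumr; apply: eq_bigr => t _; rewrite /line_avg.
apply: le_trans (_ : \sum_(j | P j) \sum_(y | in_block H (c j) y) h y * G y <= _).
  apply: ler_sum => j _; rewrite mulr_suml; apply: ler_sum => y yj.
  by rewrite ler_wpM2l// /G mulrC ler_pdivlMr// mulrC; exact: block_hits.
rewrite (eq_bigr (fun j => \sum_y (in_block H (c j) y)%:R * (h y * G y))); last first.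
  by move=> j _; rewrite big_mkcond; apply: eq_bigr => y _; case: ifP; rewrite ?mul1r ?mul0r.
rewrite exchange_big/=; apply: ler_sum => y _; rewrite -mulr_suml.
apply: ler_piMl; first exact: mulr_ge0.
have [j0 /andP[_ yj0]|no] := pickP (fun j => P j && in_block H (c j) y); last first.
  by rewrite big1// => j Pj; have := no j; rewrite Pj/= => ->.
rewrite (le_trans (y := \sum_(j | P j) (j == j0)%:R))//.
  apply: ler_sum => j _; have [yj|] := boolP (in_block H (c j) y); last by [].
  suff -> : j = j0 by rewrite eqxx.
  apply: cinj; apply/funext => k.
  have /andP[a1 a2] := forallP yj k; have /andP[b1 b2] := forallP yj0 k.
  have := le_lt_trans a1 b2; have := le_lt_trans b1 a2.
  by rewrite !ltr_pM2l//; lia.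
rewrite big_mkcond (bigD1 j0)//= big1 ?addr0; first by rewrite eqxx; case: ifP.
by move=> j /negbTE ->; case: ifP.
Qed.

End LineHits.

Section BlockVariation.
Variables (R : realType) (D n K : nat) (m : 'I_D).
Hypotheses (K0 : (0 < K)%N) (Kn : (K %| n.+2)%N).
Local Notation V := 'rV['I_n.+2]_D.
Local Notation e := (torus_of n (axis m)).

Let shiftE (x : V) (c : nat) k :
  nat_of_ord ((x + e *+ c) 0 k) = (if k == m then (x 0%R k + c) %% n.+2 else x 0%R k)%N.
Proof.
rewrite pmulrn -torus_ofMz !mxE /axis; case: eqP => _.
  by rewrite mul1r -pmulrn Zp_nat /= modnDmr.
by rewrite mul0r addr0.
Qed.

(** A step along [m] can change [f] only where it crosses a block boundary, one position out of [K];
    divisibility makes this true across the wrap-around as well. *)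
Lemma block_variation (f : V -> R) : (forall x, 0 <= f x <= 1) ->
  (forall x x' : V, (forall k, (x 0%R k %/ K = x' 0%R k %/ K)%N) -> f x = f x') ->
  \sum_x `|f (x + e) - f x| <= K%:R^-1 * #|V|%:R.
Proof.
move=> f01 fK.
pose p (x : V) := (K %| (x 0%R m).+1)%N.
have fp x : `|f (x + e) - f x| <= (p x)%:R.
  have [px|npx] := boolP (p x).
    have /andP[a1 a2] := f01 x; have /andP[b1 b2] := f01 (x + e).
    have -> : true%:R = 1 :> R by [].
    by rewrite ler_norml; apply/andP; split; lra.
  rewrite (fK (x + e) x) ?subrr ?normr0// => k.
  have := shiftE x 1 k; rewrite mulr1n => ->; case: eqP => [->|//].
  have xn : ((x 0%R m).+1 < n.+2)%N.
    rewrite ltn_neqAle ltn_ord andbT; apply: contraNneq npx => h.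
    by rewrite /p [X in (_ %| X)%N]h.
  rewrite addn1 modn_small//; by rewrite divnS// -/(p x) (negbTE npx).
have KR : 0 < K%:R :> R by rewrite ltr0n.
rewrite mulrC ler_pdivlMr//.
apply: le_trans (_ : \sum_(x : V) (p x)%:R * K%:R <= _).
  by rewrite -mulr_suml ler_pM2r//; apply: ler_sum => x _; exact: fp.
have -> : \sum_(x : V) (p x)%:R * K%:R = \sum_(x : V) \sum_(c < K) (p (x + e *+ c))%:R :> R.
  rewrite exchange_big/= -mulr_suml mulr_natr -[X in _ *+ X]card_ord -sumr_const.
  apply: eq_bigr => c _; rewrite (reindex_inj (addIr (e *+ c)))/=; exact: eq_bigr.
rewrite -sum1_card natr_sum; apply: ler_sum => x _.
have pE c : p (x + e *+ c) = (K %| x 0%R m + c + 1)%N.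
  rewrite /p shiftE eqxx -addn1 /dvdn; congr (_ == _).
  by rewrite -modnDml modn_dvdm// modnDml.
have [c0 pc0|no] := pickP (fun c : 'I_K => p (x + e *+ c)); last first.
  by rewrite big1// => c _; rewrite no.
rewrite (bigD1 c0)//= pc0 big1 ?addr0// => c cc0.
suff /negbTE -> : ~~ p (x + e *+ c) by [].
apply: contraNN cc0 => pc; move: pc pc0; rewrite !pE /dvdn => /eqP h1 /eqP h2.
have : (x 0%R m + c + 1 == x 0%R m + c0 + 1 %[mod K])%N by rewrite h1 h2.
by rewrite eqn_modDr eqn_modDl !modn_small.
Qed.
End BlockVariation.

(** * From cells of the torus to measures, and the count of pairs *)

Section TorusCells.
Variables (R : realType) (d n : nat) (w : R) (G A : set 'rV[R]_d.+1).
Local Notation V := 'rV[R]_d.+1.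
Local Notation torus := 'rV['I_n.+2]_d.+1.
Hypotheses (w0 : 0 < w) (gridG : grid_set w G) (GT : G `<=` cell (n.+2%:R * w) (fun=> 0)).

Definition torus_ind (y : torus) : R := (`[< cell w (torus_index y) `<=` G >])%:R.

Let finG : finm G.
Proof. by apply: finmS GT _; apply: finm_cell; rewrite mulr_gt0// ltr0n. Qed.

Let torus_cell x : G x -> exists2 y : torus, torus_ind y = 1 & cell w (torus_index y) x.
Proof.
move=> Gx; have hx := cell_indexP x w0.
have bnd k : 0 <= cell_index w x k < n.+2%:Z.
  have /cellP/(_ k)/andP[h1 h2] := GT Gx; have /cellP/(_ k)/andP[h3 h4] := hx.
  rewrite mulr0 in h1; rewrite add0r mulr1 mulrC in h2.
  have : w * 0%:~R < w * (cell_index w x k + 1)%:~R by rewrite mulr0; exact: lt_le_trans h4.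
  have : w * (cell_index w x k)%:~R < w * n.+2%:Z%:~R by exact: lt_le_trans h3 h2.
  rewrite !ltr_pM2l// !ltr_int.
  move: (cell_index w x k) => c0; lia.
exists (torus_of n (cell_index w x)); last by rewrite torus_ofK.
rewrite /torus_ind torus_ofK// asboolT// => x' hx'.
exact: gridG hx hx' Gx.
Qed.

Lemma block_mass (H : nat) (c : 'I_d.+1 -> int) : finm A -> (0 < H)%N ->
  rleb (A `&` cell (H%:R * w) c) <=
  rleb (A `\` G) + w ^+ d.+1 * \sum_(y : torus | in_block H c y) torus_ind y.
Proof.
move=> fA H0; set C := cell _ _.
have fC : finm C by apply: finm_cell; rewrite mulr_gt0// ltr0n.
have fAG : finm (A `\` G) by exact: finmS fA.
have fGC : finm (G `&` C) by apply: finmS finG; exact: subIsetl.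
apply: le_trans (_ : rleb ((A `\` G) `|` (G `&` C)) <= _).
  apply: le_rleb; last exact: finmU.
  by move=> x [Ax Cx]; have [Gx|nGx] := pselect (G x); [right|left].
apply: le_trans (rlebU _ _) _ => //; rewrite lerD2l.
apply: le_trans (@rleb_bigcup_le R d _ (fun y : torus => in_block H c y && (torus_ind y == 1))
  (fun y => cell w (torus_index y)) _ _ _) _.
- move=> x [Gx /cellP Cx]; have [y y1 /cellP yx] := torus_cell Gx.
  exists y; last exact/cellP.
  rewrite y1 eqxx andbT; apply/forallP => k.
  have /andP[h1 h2] := Cx k; have /andP[h3 h4] := yx k.
  have := lt_le_trans h1 h4; have := lt_le_trans h3 h2.
  rewrite ![H%:R * w]mulrC -!mulrA !ltr_pM2l// -[H%:R]/(H%:Z%:~R) -!intrM !ltr_int.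
  by rewrite /torus_index; move: (c k) (y 0 k) => c0 y0; lia.
- by move=> y _; exact: finm_cell.
rewrite big_mkcondr mulr_sumr; apply: ler_sum => y _; rewrite rleb_cell//.
case: eqP => [->|_]; first by rewrite mulr1.
by rewrite mulr_ge0// exprn_ge0// ltW.
Qed.

(** Along [m] the vector [v] is off the lattice, so for [x] in the cell of [y] the point [x - v]
    lies in the cell of [y - z] or in the preceding one. If all three cells are in [G], the cell of
    [y] lies in [G] and in its translate by [v], hence, as [A] avoids [v], in the error set or its
    translate. The variation counts the other [y]. The lower bound 1 on indices keeps the preceding
    cell from wrapping around. *)
Lemma pair_mass (m : 'I_d.+1) (z : 'I_d.+1 -> int) (v : V) (Q : pred torus) :
  (forall k, k != m -> v 0 k = w * (z k)%:~R) -> w * (z m)%:~R <= v 0 m < w * (z m + 1)%:~R ->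
  (forall x, A x -> ~ A (x - v)) ->
  (forall y k, Q y -> 1 <= torus_index y k - z k < n.+2%:Z) ->
  \sum_(y | Q y) torus_ind y * torus_ind (y - torus_of n z) <=
  2 * rleb (G `\` A) / w ^+ d.+1 +
  \sum_y `|torus_ind (y + torus_of n (axis m)) - torus_ind y|.
Proof.
move=> vk /andP[vm1 vm2] Av Qz; set e := torus_of n (axis m).
have wD : 0 < w ^+ d.+1 by rewrite exprn_gt0.
have ind01 y : 0 <= torus_ind y <= 1 by rewrite /torus_ind; case: asbool; rewrite ?lexx ler01.
pose T y := [&& Q y, torus_ind y == 1, torus_ind (y - torus_of n z) == 1 &
  torus_ind (y - torus_of n z - e) == 1].
have indT y : torus_ind y == 1 -> cell w (torus_index y) `<=` G.
  by rewrite /torus_ind; case: asboolP => // _; rewrite eq_sym oner_eq0.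
apply: le_trans (_ : \sum_(y | T y) 1 +
  \sum_y `|torus_ind (y - torus_of n z) - torus_ind (y - torus_of n z - e)| <= _).
  rewrite big_mkcond [X in _ <= X + _]big_mkcond -big_split/=; apply: ler_sum => y _.
  rewrite /T; case: (Q y) => /=; last by rewrite add0r normr_ge0.
  have ind2 y' : torus_ind y' = 0 \/ torus_ind y' = 1 by rewrite /torus_ind; case: asbool; [right|left].
  have [->|->] := ind2 y; have [->|->] := ind2 (y - torus_of n z);
    have [->|->] := ind2 (y - torus_of n z - e);
    by rewrite ?eqxx ?(eq_sym 0) ?oner_eq0/= ?subrr ?subr0 ?sub0r ?normrN ?normr1 ?normr0
      ?mulr1 ?mulr0 ?mul0r ?addr0 ?add0r ?ler01 ?lexx.
apply: lerD; last first.
  rewrite [leRHS](reindex_inj (addIr (- torus_of n z - e)))/=.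
  apply: ler_sum => y _; rewrite !addrA subrK.
  exact: lexx.
have fGA : finm (G `\` A) by exact: finmS finG.
have f1 : finm (affine 1 v (G `\` A)) by exact: finm_affine.
rewrite ler_pdivlMr// mulr_suml.
have idxE y : Q y -> torus_index (y - torus_of n z) = (fun k => torus_index y k - z k) /\
    torus_index (y - torus_of n z - e) = (fun k => torus_index y k - z k - axis m k).
  move=> Qy; rewrite -{1 3}(torus_indexK y) -!torus_ofB !torus_ofK//.
    by move=> k; have := Qz y k Qy; rewrite /axis; case: eqP; lia.
  by move=> k; have := Qz y k Qy; lia.
have sub y : T y -> cell w (torus_index y) `<=` G `&` affine 1 v G.
  move=> /and4P[Qy /indT h1 /indT h2 /indT h3] x yx; split; first exact: h1.
  have [i1 i2] := idxE y Qy; rewrite i1 in h2; rewrite i2 in h3.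
  rewrite /affine/= invr1 scale1r.
  have /cellP hx := yx; have /andP[xm1 xm2] := hx m.
  have [lo|hi] := ltP (w * (torus_index y m - z m)%:~R) ((x - v) 0 m).
    apply: h2; apply/cellP => k; rewrite !mxE.
    have [->|km] := eqVneq k m; last first.
      by have /andP[a1 a2] := hx k; rewrite vk// !intrD !intrN !mulrDr !mulrN; apply/andP; split; lra.
    move: lo; rewrite !mxE => lo; rewrite lo/=.
    by move: xm2 vm1; rewrite !intrD !mulrDr; lra.
  apply: h3; apply/cellP => k; rewrite !mxE /axis.
  have [->|km] := eqVneq k m; last first.
    by have /andP[a1 a2] := hx k; rewrite vk// !intrD !intrN !mulrDr !mulrN; apply/andP; split; lra.
  move: hi; rewrite !mxE subrK => hi; rewrite hi andbT.
  by move: xm1 vm2; rewrite !intrD !mulrDr; lra.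
apply: le_trans (_ : rleb (G `&` affine 1 v G) <= _).
  apply: le_trans (@rleb_sum_disj_le R d _ T (fun y => cell w (torus_index y)) _ _ _ _).
  - apply: ler_sum => y Ty; rewrite mul1r setIC (setIidl (sub y Ty)) rleb_cell//.
  - by apply: finmS finG; exact: subIsetl.
  - by move=> y _; exact: measurable_cell.
  - move=> y y' x _ _ h h'; rewrite -(torus_indexK y) -(torus_indexK y'); congr torus_of.
    exact: cell_inj w0 h h'.
apply: le_trans (_ : rleb ((G `\` A) `|` affine 1 v (G `\` A)) <= _).
  apply: le_rleb; last exact: finmU.
  move=> x [Gx Gv]; have [Ax|nAx] := pselect (A x); last by left.
  right; split => //; rewrite invr1 scale1r; exact: Av.
apply: le_trans (rlebU _ _) _ => //.
by rewrite rleb_affine// expr1n mul1r; lra.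
Qed.

End TorusCells.

(** Order of choice: [N] controls the term [1 / N]; [al] approximates the spacing [a / nu] of the
    families; [be] bounds the window and the short steps, so that slopes are nearly constant; [g]
    makes rounding negligible against [g] times the gap of slopes. Only then come the relative
    window [la] and the lattice density [nu]; [la * nu] stands for [ell]. *)
Lemma direction_parameters (R : realType) (r mu C0 rho z : R) :
  0 < mu -> mu <= r -> 0 <= C0 -> 0 < rho -> rho <= r -> 0 < z ->
  exists N g : nat, exists th : R, [/\ (0 < N)%N, (0 < g)%N, 0 < th &
    forall la : R, 0 < la -> la <= th -> exists nu0 : R, forall nu : R, 0 < nu -> nu0 <= nu ->
    exists a b : nat, [/\ (0 < a)%N, (0 < b)%N,
      (1 + la * nu + N%:R * a%:R + b.+1%:R * g%:R) / nu <= rho,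
      2 * g%:R * (C0 * ((la * nu + b.+1%:R * g%:R) / nu)) + 2 <=
        z ^+ 2 / 4 * (g%:R * (a%:R / nu) / (2 * r)) &
      0 < g%:R * (a%:R / nu) / (2 * r) <= g%:R * (8 * r / mu) /\
      N%:R^-1 + la * nu / (g%:R * (a%:R / nu) / (2 * r) * b%:R) + z ^+ 2 / 4 <= 3 / 4 * z ^+ 2]].
Proof.
move=> mu0 mur C00 rho0 rhor z0.
have r0 : 0 < r by exact: lt_le_trans mur.
pose eta := z ^+ 2 / 4.
have etaE : z ^+ 2 / 4 = eta by [].
have eta0 : 0 < eta by rewrite divr_gt0// exprn_gt0.
pose N := (Num.truncn eta^-1).+1.
have NR : 0 < N%:R :> R by rewrite ltr0n.
have Neta : N%:R^-1 <= eta.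
  rewrite invf_ple ?posrE//; apply: ltW; exact: truncnS_gt.
pose al := rho / (4 * N%:R).
have al0 : 0 < al by rewrite divr_gt0// mulr_gt0.
have Nal : N%:R * al = rho / 4 by rewrite /al; field; exact: lt0r_neq0.
have alr : al <= r.
  apply: le_trans rhor; rewrite ler_pdivrMr ?mulr_gt0// ler_peMr ?(ltW rho0)//.
  have : (1 : R) <= N%:R by rewrite (ler_nat _ 1).
  by lra.
have C1 : 0 < C0 + 1 by lra.
pose be := Num.min (rho / 4) (eta * al / (32 * r * (C0 + 1))).
have be0 : 0 < be.
  by rewrite lt_min divr_gt0//=; apply: divr_gt0; first exact: mulr_gt0; do 2 apply: mulr_gt0 => //.
have be1 : be <= rho / 4 by rewrite ge_min lexx.
have be2 : be * (32 * r * (C0 + 1)) <= eta * al.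
  by rewrite -ler_pdivlMr ?ge_min ?lexx ?orbT//; do 2 apply: mulr_gt0 => //.
have ea0 : 0 < eta * al by exact: mulr_gt0.
pose g := (Num.truncn (16 * r / (eta * al))).+1.
have gR : 0 < g%:R :> R by rewrite ltr0n.
have g1 : 16 * r <= g%:R * (eta * al).
  by rewrite -ler_pdivrMr//; apply: ltW; exact: truncnS_gt.
have g0 : (0 < g)%N by [].
have N0 : (0 < N)%N by [].
clearbody g be al N eta.
(* The first bound keeps the window within half of [be], the second makes [ell / (lmin * b)] at most
   [eta]. *)
exists N, g, (Num.min (be / 2) (eta * al * be / (16 * r))); split => //.
  by rewrite lt_min; apply/andP; split; apply: divr_gt0 => //; apply: mulr_gt0 => //.
move=> la la0; rewrite le_min => /andP[la1 la2].
rewrite ler_pdivlMr ?(mulr_gt0 _ r0)// in la2.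
exists (4 / rho + 8 * g%:R / be + 2 / al) => nu nu0 hnu.
have p1 : 0 < 4 / rho by rewrite divr_gt0.
have p2 : 0 < 8 * g%:R / be by rewrite divr_gt0 ?mulr_gt0.
have p3 : 0 < 2 / al by rewrite divr_gt0.
have q1 : 4 <= rho * nu by rewrite mulrC -ler_pdivrMr//; lra.
have q2 : 8 * g%:R <= be * nu by rewrite [leRHS]mulrC -ler_pdivrMr//; lra.
have q3 : 2 <= al * nu by rewrite mulrC -ler_pdivrMr//; lra.
clear p1 p2 p3 hnu.
pose a := Num.truncn (al * nu).
have /andP[a1 a2] : a%:R <= al * nu < a.+1%:R by apply: truncn_itv; rewrite mulr_ge0// ltW.
have {}a2 : al * nu / 2 <= a%:R by rewrite -natr1 in a2; lra.
have a0 : (0 < a)%N by rewrite -(ltr0n R); apply: lt_le_trans a2; apply: divr_gt0 => //; exact: mulr_gt0.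
pose B := Num.truncn (be * nu / (2 * g%:R)).
have /andP[B1 B2] : B%:R <= be * nu / (2 * g%:R) < B.+1%:R.
  by apply: truncn_itv; rewrite divr_ge0 ?mulr_ge0 ?(ltW be0) ?(ltW nu0)// ltW.
have B1' : B%:R * g%:R <= be * nu / 2.
  by have := B1; rewrite ler_pdivlMr ?mulr_gt0//; lra.
have B2' : be * nu < 2 * g%:R * (B%:R + 1).
  by have := B2; rewrite ltr_pdivrMr ?mulr_gt0// -natr1; lra.
clearbody a B.
have B3 : 3 < B%:R :> R.
  have h : 2 * g%:R * 4 < 2 * g%:R * (B%:R + 1) :> R by clear -q2 B2'; nra.
  by rewrite ltr_pM2l ?mulr_gt0// in h; lra.
have [b Bb] : exists b, B = b.+1 by case: (B) B3 => [|b] hb; [lra|exists b].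
rewrite Bb in B1' B2' B3.
exists a, b.
have bR : 0 < b%:R :> R by move: B3; rewrite -natr1; clear; lra.
have b1 : be * nu / 4 <= g%:R * b%:R by rewrite -natr1 in B2'; clear -q2 B2'; nra.
have k1 : al / 2 <= a%:R / nu by rewrite ler_pdivlMr//; lra.
have k2 : a%:R / nu <= al by rewrite ler_pdivrMr//; lra.
have r20 : 0 < 2 * r by rewrite mulr_gt0.
set lmin := g%:R * (a%:R / nu) / (2 * r).
have k3 : g%:R * al <= lmin * (4 * r).
  have -> : lmin * (4 * r) = g%:R * (2 * (a%:R / nu)) by rewrite /lmin; field; rewrite !lt0r_neq0.
  by rewrite ler_pM2l//; lra.
have lmin0 : 0 < lmin.
  have r40 : 0 < 4 * r by rewrite mulr_gt0.
  by rewrite -(pmulr_lgt0 _ r40); apply: lt_le_trans k3; exact: mulr_gt0.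
have lab : la * nu + b.+1%:R * g%:R <= be * nu.
  have := ler_wpM2r (ltW nu0) la1; clear -B1'; nra.
split => //.
- by rewrite -(ltr0n R).
- rewrite ler_pdivrMr//.
  have h1 : N%:R * a%:R <= rho / 4 * nu.
    by rewrite -Nal -mulrA ler_pM2l//; lra.
  have := ler_wpM2r (ltW nu0) be1; clear -q1 lab h1; nra.
- have h0 : (la * nu + b.+1%:R * g%:R) / nu <= be by rewrite ler_pdivrMr.
  have h1 : C0 * ((la * nu + b.+1%:R * g%:R) / nu) <= (C0 + 1) * be.
    apply: le_trans (ler_wpM2l C00 h0) _; rewrite ler_pM2r//; lra.
  have h2 := ler_wpM2l (ltW gR) h1.
  have h3 := ler_wpM2l (ltW gR) be2.
  have h4 := ler_wpM2l (ltW eta0) k3.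
  rewrite etaE -(ler_pM2r (_ : 0 < 4 * r)); last exact: mulr_gt0.
  have h5 := ler_wpM2r (ltW r0) h2.
  move: h5; set X := C0 * (_ / nu) => h5.
  have -> : (2 * g%:R * X + 2) * (4 * r) = 8 * (g%:R * X * r) + 8 * r by ring.
  have -> : eta * lmin * (4 * r) = eta * (lmin * (4 * r)) by ring.
  apply: le_trans h4.
  have E3 : g%:R * (be * (32 * r * (C0 + 1))) = 32 * (g%:R * ((C0 + 1) * be) * r) by ring.
  have E4 : eta * (g%:R * al) = g%:R * (eta * al) by ring.
  rewrite E3 in h3; rewrite E4; clear -r0 g1 h3 h5; lra.
- split.
    rewrite lmin0/= /lmin ler_pdivrMr// -[leRHS]mulrA ler_pM2l//.
    apply: le_trans k2 (le_trans alr _).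
    have -> : 8 * r / mu * (2 * r) = r * (16 * (r / mu)) by ring.
    rewrite ler_peMr ?(ltW r0)//.
    have : 1 <= r / mu by rewrite ler_pdivlMr// mul1r.
    by lra.
  have h : la * nu / (lmin * b%:R) <= eta.
    rewrite ler_pdivrMr; last exact: mulr_gt0.
    rewrite -(ler_pM2r (_ : 0 < 16 * r * g%:R)); last by rewrite !mulr_gt0.
    have h1 : g%:R * al * (be * nu / 4) <= lmin * (4 * r) * (g%:R * b%:R).
      by apply: ler_pM => //; apply: mulr_ge0; rewrite ?(ltW gR) ?(ltW al0)// mulr_ge0 ?(ltW be0) ?(ltW nu0).
    have h2 := ler_wpM2l (ltW eta0) h1.
    have h3 := ler_wpM2r (mulr_ge0 (ltW nu0) (ltW gR)) la2.
    have -> : la * nu * (16 * r * g%:R) = la * (16 * r) * (nu * g%:R) by ring.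
    apply: le_trans h3 _.
    have -> : eta * al * be * (nu * g%:R) = 4 * (eta * (g%:R * al * (be * nu / 4))) by field.
    have -> : eta * (lmin * b%:R) * (16 * r * g%:R) = 4 * (eta * (lmin * (4 * r) * (g%:R * b%:R))) by ring.
    by rewrite ler_pM2l.
  rewrite etaE (_ : 3 / 4 * z ^+ 2 = 3 * eta); last by rewrite -etaE; ring.
  by lra.
Qed.

Section LatticeGraph.
Variables (R : realType) (D : nat) (u0 : 'I_D -> R) (m l : 'I_D) (r rho : R).
Hypotheses (lm : l != m) (r0 : 0 < r) (u0r : \sum_k u0 k ^+ 2 = r ^+ 2) (u0m : u0 m != 0).
Hypotheses (rho0 : 0 < rho) (rhor : rho <= r)
  (rhomu : D%:R * (rho * (3 * r)) <= 3 / 4 * `|u0 m| ^+ 2).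
Variables (nu : R) (s0 : 'I_D -> int) (a g ell N b : nat).
Hypotheses (nu0 : 0 < nu) (hs0 : forall k, `|(s0 k)%:~R - nu * u0 k| <= 1).
Hypothesis fits : (1 + ell%:R + N%:R * a%:R + b.+1%:R * g%:R) / nu <= rho.

Let Lip := 4 * D%:R * r / `|u0 m|.
Let Lip0 : 0 <= Lip.
Proof. by rewrite divr_ge0// !mulr_ge0// ltW. Qed.
Local Notation phi := (sphere_graph u0 m r).
Local Notation gr := (lattice_graph u0 m r nu).
Local Notation near := (@lattice_near R D u0 m l rho nu s0 a g ell N b nu0 hs0 fits _ _ _).

Lemma sphere_graph_ext (p p' : 'I_D -> R) : (forall k, k != m -> p k = p' k) -> phi p = phi p'.
Proof. by move=> h; rewrite /sphere_graph; do 3 congr (_ _); congr (- _); apply: eq_bigr => k /h ->. Qed.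

Lemma lattice_graph_ext (p p' : 'I_D -> int) : (forall k, k != m -> p k = p' k) -> gr p = gr p'.
Proof. by move=> h; rewrite /lattice_graph (sphere_graph_ext (p' := fun k => (p' k)%:~R / nu))// => k /h ->. Qed.

Lemma sphere_graph_center : phi u0 = u0 m.
Proof.
rewrite /sphere_graph -u0r (bigD1 m)//= addrK sqrtr_sqr.
by rewrite [RHS]numEsg.
Qed.

Lemma lattice_graph_near t i c : (forall k, (t k < ell)%N) -> (i <= N)%N -> (c <= b.+1)%N ->
  `|phi (fun k => (lattice_point l s0 a g t i c k)%:~R / nu) - u0 m| <= Lip * rho.
Proof.
move=> tl iN cb; rewrite -{1}sphere_graph_center.
have n1 := near tl iN cb.
apply: (sphere_graph_lip r0 u0r u0m rho0 rhor rhomu n1) => //.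
- by move=> k _; rewrite subrr normr0 ltW.
- exact: ltW.
Qed.

(** Supplies the oscillation bound of [line_avg_hits]; in the condition on [La], the term 1 pays for
    the floors, since [H] is at least 1. *)
Lemma lattice_graph_lip (H La : nat) i c (t : 'I_D -> nat) : (0 < H)%N -> (3 * H < ell)%N ->
  3 * Lip + 1 <= La%:R -> (i <= N)%N -> (c <= b.+1)%N -> (forall k, (t k <= 3 * H)%N) ->
  `|gr (fun k => lattice_point l s0 a g (fun=> 0%N) i c k + (t k)%:Z) -
    gr (lattice_point l s0 a g (fun=> 0%N) i c)| <= (La * H)%N%:Z.
Proof.
move=> H0 Hl hLa iN cb tH; set s := lattice_point _ _ _ _ _ _ _.
have tl k : (t k < ell)%N by exact: leq_ltn_trans (tH k) Hl.
have l0 : (0 < ell)%N by exact: leq_ltn_trans Hl.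
have sE : (fun k => s k + (t k)%:Z) = lattice_point l s0 a g t i c.
  by apply/funext => k; rewrite /s /lattice_point addr0 addrAC.
rewrite sE.
have n1 := near tl iN cb.
have n2 := near (fun=> l0) iN cb.
have HR : (1 : R) <= H%:R by rewrite (ler_nat _ 1).
have dl0 : 0 <= 3 * H%:R / nu by rewrite divr_ge0 ?mulr_ge0// ltW.
have := sphere_graph_lip r0 u0r u0m rho0 rhor rhomu n1 n2 dl0.
rewrite -/s -sE => lip.
have {}lip : `|phi (fun k => (s k + (t k)%:Z)%:~R / nu) - phi (fun k => (s k)%:~R / nu)| <= Lip * (3 * H%:R / nu).
  apply: lip => k _; rewrite -mulrBl normrM normfV (gtr0_norm nu0) ler_pM2r ?invr_gt0//.
  by rewrite intrD addrAC subrr add0r -pmulrn ger0_norm// -natrM ler_nat.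
rewrite /lattice_graph.
set P := phi _ in lip *; set P' := phi _ in lip *.
have {}lip : `|nu * P - nu * P'| <= 3 * Lip * H%:R.
  rewrite -mulrBr normrM (gtr0_norm nu0); apply: le_trans (ler_wpM2l (ltW nu0) lip) _.
  by have -> : nu * (Lip * (3 * H%:R / nu)) = 3 * Lip * H%:R by field; exact: lt0r_neq0.
have /andP[f1 f2] := floor_itv (nu * P); have /andP[f3 f4] := floor_itv (nu * P').
have hb : 3 * Lip * H%:R + 1 <= La%:R * H%:R.
  have := ler_wpM2r (ler0n _ H) hLa; lra.
rewrite -(ler_int R) intr_norm intrB -pmulrn natrM.
rewrite intrD in f2; rewrite intrD in f4.
by move: lip; rewrite !ler_norml => /andP[g1 g2]; apply/andP; split; lra.
Qed.

End LatticeGraph.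

Section GoodDirection.
Variables (R : realType) (d : nat) (u0 : 'I_d.+1 -> R) (m l : 'I_d.+1) (r rho : R).
Hypotheses (lm : l != m) (r0 : 0 < r) (u0r : \sum_k u0 k ^+ 2 = r ^+ 2) (u0m : u0 m != 0).
Hypotheses (rho0 : 0 < rho) (rhor : rho <= r)
  (rhomu : d.+1%:R * (rho * (3 * r)) <= 3 / 4 * `|u0 m| ^+ 2).
Variables (nu : R) (s0 : 'I_d.+1 -> int) (a g ell N b n : nat).
Hypotheses (nu0 : 0 < nu) (hs0 : forall k, `|(s0 k)%:~R - nu * u0 k| <= 1).
Hypotheses (a0 : (0 < a)%N) (g0 : (0 < g)%N) (N0 : (0 < N)%N) (b0 : (0 < b)%N) (ell0 : (0 < ell)%N).
Hypothesis fits : (1 + ell%:R + N%:R * a%:R + b.+1%:R * g%:R) / nu <= rho.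
Let Lip := 4 * d.+1%:R * r / `|u0 m|.
Let lmin := g%:R * (a%:R / nu) / (2 * r).
Let lmax := g%:R * (8 * r / `|u0 m|).
Variables (eta om z c0 be : R) (G A : set 'rV[R]_d.+1) (Q : pred 'rV['I_n.+2]_d.+1).
Hypothesis small : 2 * g%:R * (8 * r * (1 + Lip) / `|u0 m| ^+ 2 *
  ((ell%:R + b.+1%:R * g%:R) / nu)) + 2 <= eta * lmin.
Hypotheses (eta01 : 0 <= eta <= 1) (lmin_max : 0 < lmin <= lmax) (z0 : 0 < z).
Hypothesis budget : N%:R^-1 + ell%:R / (lmin * b%:R) + eta + 8 * lmax * om <= z ^+ 2.
Hypothesis (GT : G `<=` cell (n.+2%:R * nu^-1) (fun=> 0)).
Local Notation V := 'rV['I_n.+2]_d.+1.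
Local Notation f := (@torus_ind R d n nu^-1 G).
Hypothesis f_lip : \sum_x `|f (x + torus_of n (axis m)) - f x| <= om * #|V|%:R.
Hypothesis Ar : forall x y, A x -> A y -> edist x y <> r.
Hypotheses (rhobe : rho <= be) (Liprho : Lip * rho + nu^-1 <= be).
Hypothesis Qbe : forall (y : V) k (zk : int), Q y -> `|zk%:~R / nu - u0 k| <= be ->
  1 <= torus_index y k - zk < n.+2%:Z.
Hypothesis c0V : 2 * rleb (G `\` A) / nu^-1 ^+ d.+1 + om * #|V|%:R <= c0 * #|V|%:R.

Let f01 y : 0 <= f y <= 1.
Proof. by rewrite /torus_ind; case: asbool; rewrite ?lexx ler01. Qed.

(** The vector [v] agrees with the lattice vector outside [m] and has its last free coordinate on
    the sphere, so its length is exactly [r]. No two points of [A] differ by [v], and [pair_mass]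
    gives the bound [c0] for every direction. *)
Lemma good_direction : exists i : 'I_N, exists2 c : nat, (c < b)%N &
  \sum_(t : {ffun 'I_d.+1 -> 'I_ell}) \sum_y (Q y)%:R * f y * line_avg f (torus_of n (axis m)) ell
    (y - torus_of n (lattice_vector u0 m l r nu s0 a g (fun k => t k) i c)) <=
  (ell ^ d.+1)%:R * ((c0 + z) * #|V|%:R).
Proof.
have /andP[lmin0 lmm] := lmin_max.
have nun0 : nu != 0 by exact: lt0r_neq0.
have -> : (ell ^ d.+1)%N = #|{: {ffun 'I_d.+1 -> 'I_ell}}| by rewrite card_ffun !card_ord.
apply: (@exists_good_direction R _ f (fun y => (Q y)%:R * f y) (torus_of n (axis m)) ell N b
  {ffun 'I_d.+1 -> 'I_ell}
  (fun t i c => torus_of n (lattice_vector u0 m l r nu s0 a g (fun k => t k) i c))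
  om eta lmin lmax c0 z) => //.
- by move=> y; case: (Q y); rewrite ?mul1r ?mul0r ?lexx ?ler01.
- move=> t; have tl k : (t k < ell)%N by [].
  have h := lattice_spread lm r0 u0r u0m rho0 rhor rhomu nu0 hs0 a0 g0 fits n small tl.
  exact h.
move=> t i c cb.
have tl k : (t k < ell)%N by [].
have cb' : (c <= b.+1)%N by rewrite leqW// ltnW.
have iN : (i <= N)%N by exact: ltnW.
set p := lattice_point l s0 a g (fun k => t k) i c.
have near := lattice_near (m := m) l nu0 hs0 fits tl iN cb'.
have nearm := lattice_graph_near l r0 u0r u0m rho0 rhor rhomu nu0 hs0 fits tl iN cb'.
rewrite -/p/= in near nearm.
set ph := sphere_graph _ _ _ _ in nearm.
set zz := lattice_vector _ _ _ _ _ _ _ _ _ _ _.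
have zk k : k != m -> zz k = p k by rewrite /zz /lattice_vector => /negbTE ->.
have zm : zz m = Num.floor (nu * ph) by rewrite /zz /lattice_vector eqxx.
have /andP[fl1 fl2] := floor_itv (nu * ph).
have fl1' : (zz m)%:~R / nu <= ph by rewrite ler_pdivrMr// mulrC zm.
have fl2' : ph < (zz m + 1)%:~R / nu by rewrite ltr_pdivlMr// mulrC zm.
pose v : 'rV[R]_d.+1 := \row_k (if k == m then ph else (p k)%:~R / nu).
have vr : \sum_k (v 0 k) ^+ 2 = r ^+ 2.
  rewrite (bigD1 m)//= mxE eqxx (sphere_graph_sqr r0 u0r u0m rho0 rhor rhomu near).
  rewrite [X in _ + X](eq_bigr (fun k => ((p k)%:~R / nu) ^+ 2)) ?subrK// => k /negbTE km.
  by rewrite mxE km.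
apply: le_trans c0V; rewrite (eq_bigr (fun y => if Q y then f y * f (y - torus_of n zz) else 0)); last first.
  by move=> y _; case: (Q y); rewrite ?mul1r ?mul0r.
rewrite -big_mkcond/=.
have w0 : 0 < nu^-1 by rewrite invr_gt0.
apply: (@le_trans _ _ (2 * rleb (G `\` A) / nu^-1 ^+ d.+1 +
  \sum_x `|f (x + torus_of n (axis m)) - f x|)); last by rewrite lerD2l.
have hp := @pair_mass R d n nu^-1 G A w0 GT m zz v Q.
apply: hp.
- by move=> k km; rewrite mxE (negbTE km) mulrC zk.
- by rewrite mxE eqxx ![nu^-1 * _]mulrC fl1' fl2'.
- move=> x Ax Avx; apply: (Ar Ax Avx); rewrite /edist.
  under eq_bigr do rewrite !mxE opprB addrC subrK.
  have {1}<- : \sum_k v 0 k ^+ 2 = \sum_k (if k == m then ph else (p k)%:~R / nu) ^+ 2.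
    by apply: eq_bigr => k _; rewrite mxE.
  by rewrite vr sqrtr_sqr gtr0_norm.
- move=> y k Qy; apply: Qbe => //.
  have [->|km] := eqVneq k m; last by rewrite zk//; apply: le_trans (near k km) _.
  rewrite intrD mulrDl mul1r in fl2'.
  apply: le_trans Liprho; move: nearm; rewrite -/Lip !ler_norml => /andP[h1 h2].
  by apply/andP; split; lra.
Qed.

End GoodDirection.

Section BlockDensity.
Variables (R : realType) (d n : nat) (w : R) (G A : set 'rV[R]_d.+1).
Hypotheses (w0 : 0 < w) (GT : G `<=` cell (n.+2%:R * w) (fun=> 0)).
Local Notation torus := 'rV['I_n.+2]_d.+1.

Lemma block_dense (e1 : R) (H : nat) c : grid_set w G -> finm A -> (0 < H)%N ->
  e1 / 2 * (H%:R * w) ^+ d.+1 <= rleb (A `&` cell (H%:R * w) c) ->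
  rleb (A `\` G) <= e1 / 4 * (H%:R * w) ^+ d.+1 ->
  e1 / 4 * H%:R ^+ d.+1 <= \sum_(y : torus | in_block H c y) torus_ind w G y.
Proof.
move=> gridG fA H0 h1 h2; have h3 := block_mass w0 gridG GT c fA H0.
have wD : 0 < w ^+ d.+1 by rewrite exprn_gt0.
rewrite -(ler_pM2l wD); move: h1 h2 h3; set S := (\sum_(y | _) _).
rewrite exprMn; set X := rleb _; set Y := rleb _; move: (H%:R ^+ _) (w ^+ _) => h v h1 h2 h3.
have E1 : v * (e1 / 4 * h) = e1 / 4 * (h * v) by ring.
have E2 : e1 / 2 * (h * v) = e1 / 4 * (h * v) + e1 / 4 * (h * v) by field.
rewrite E1; rewrite E2 in h1; lra.
Qed.

Lemma torus_ind_block K : (0 < K)%N -> grid_set (w * K%:R) G -> forall x x' : torus,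
  (forall k, (x 0%R k %/ K = x' 0%R k %/ K)%N) -> torus_ind w G x = torus_ind w G x'.
Proof.
move=> K0 gridG.
have wlt (x x' : torus) : (forall k, (x 0%R k %/ K = x' 0%R k %/ K)%N) ->
    cell w (torus_index x) `<=` G -> cell w (torus_index x') `<=` G.
  move=> xx' xG p px'.
  (* The upper corner belongs to its cell: a point of [G] from which membership is carried over to
     the whole block. *)
  pose p0 : 'rV[R]_d.+1 := \row_k (w * (torus_index x k + 1)%:~R).
  have p0x : cell w (torus_index x) p0.
    by apply/cellP => k; rewrite mxE lexx andbT ltr_pM2l// ltr_int ltrDl.
  have KR : 0 < K%:R :> R by rewrite ltr0n.
  have ref (c : 'I_d.+1 -> int) : cell w c `<=` cell (w * K%:R) (fun k => (c k %/ K)%Z).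
    have := @cell_refine R d (w * K%:R) K c (mulr_gt0 w0 KR) K0.
    by rewrite mulfK// lt0r_neq0.
  apply: (gridG _ _ _ (ref _ _ p0x) _ (xG _ p0x)).
  have := ref _ _ px'; congr (cell _ _ _); apply/funext => k.
  by rewrite /torus_index !divz_nat xx'.
move=> x x' xx'; rewrite /torus_ind; congr ((nat_of_bool _)%:R).
by apply/asboolP/asboolP; apply: wlt => // k; rewrite xx'.
Qed.

End BlockDensity.

(** The factor [1 / 2] separates a sparse subcell from the density [e] of a dense cell; this gap is
    what increases the energy. *)
Definition sparse (R : realType) (d : nat) (e w : R) (A : set 'rV[R]_d.+1) (c : 'I_d.+1 -> int) : bool :=
  rleb (A `&` cell w c) < e / 2 * w ^+ d.+1.

Definition subcell (d K : nat) (c : 'I_d.+1 -> int) (f : {ffun 'I_d.+1 -> 'I_K}) : 'I_d.+1 -> int :=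
  fun k => K%:Z * c k + (f k)%:Z.

Lemma exists_other_ord d (m : 'I_d.+1) : (0 < d)%N -> exists l : 'I_d.+1, l != m.
Proof.
move=> d0; exists (if m == ord0 then ord_max else ord0).
case: (eqVneq m ord0) => [->|m0]; last by rewrite eq_sym.
by apply/eqP => /(congr1 val)/=; lia.
Qed.

Lemma divz_window (x : int) (H : nat) : (0 < H)%N -> x - H%:Z < H%:Z * (x %/ H)%Z <= x.
Proof.
move=> H0; have e := divz_eq x H; have l1 : (0 <= x %% H)%Z by rewrite modz_ge0//; lia.
have l2 : (x %% H < H)%Z by apply: ltz_pmod; lia.
by apply/andP; split; rewrite mulrC; lia.
Qed.

(* The final count: [X] of the [I] blocks of [Q] are dense, and each of them
   produces [(e1 / 4 * h) ^+ 2] pairs. *)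
Lemma dense_pair_count (R : realType) (e1 h B C z I X vol : R) :
  0 < e1 -> 0 < h -> 0 < B -> 0 < C -> 0 < I -> z = e1 ^+ 2 / (128 * B * C) ->
  vol = I * B * h -> I <= 2 * X -> X * ((e1 / 4 * h) * (e1 / 4 * h)) <= C * h * ((z + z) * vol) -> False.
Proof.
move=> e10 h0 B0 C0 I0 -> -> IX.
have B1 := lt0r_neq0 B0; have C1 := lt0r_neq0 C0.
have -> : C * h * ((e1 ^+ 2 / (128 * B * C) + e1 ^+ 2 / (128 * B * C)) * (I * B * h)) =
  I / 4 * ((e1 / 4 * h) * (e1 / 4 * h)) by field; rewrite B1 C1.
have p : 0 < e1 / 4 * h * (e1 / 4 * h) by rewrite !mulr_gt0// divr_gt0.
by rewrite ler_pM2r//; lra.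
Qed.

Lemma pow2_swap a b c : (2 ^ a * 2 ^ (b + c).+1 = 2 ^ b * 2 ^ (a + c).+1)%N.
Proof. by rewrite -!expnD; congr (2 ^ _)%N; lia. Qed.

Lemma pow2_SS q : (0 < q)%N -> exists n, n.+2 = (2 ^ q)%N.
Proof.
move=> q0; exists (2 ^ q - 2)%N; have : (2 ^ 1 <= 2 ^ q)%N by rewrite leq_exp2l.
by rewrite expn1; lia.
Qed.

Lemma half_count x y t : t = (x + y)%N -> (2 * x <= t -> t <= 2 * y)%N.
Proof. by move=> ->; lia. Qed.

Lemma exists_large_coord (R : realType) d (u : 'I_d.+1 -> R) (r : R) : 0 < r ->
  \sum_k u k ^+ 2 = r ^+ 2 -> exists m, r / d.+1%:R <= `|u m| <= r.
Proof.
move=> r0 ur.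
have le_r m : `|u m| <= r.
  rewrite -[r]gtr0_norm// -ler_sqr ?nnegrE ?normr_ge0// !real_normK ?num_real// -ur (bigD1 m)//=.
  by rewrite lerDl sumr_ge0// => k _; exact: sqr_ge0.
apply: contrapT => h.
have lt_u k : `|u k| < r / d.+1%:R.
  by rewrite ltNge; apply/negP => hk; apply: h; exists k; rewrite hk le_r.
have dR : 0 < d.+1%:R :> R by rewrite ltr0n.
have rd : 0 < r / d.+1%:R by exact: divr_gt0.
have : \sum_k u k ^+ 2 < \sum_(k < d.+1) (r / d.+1%:R) ^+ 2.
  apply: ltr_sum; first by apply/hasP; exists ord0; rewrite ?mem_index_enum.
  move=> k _; rewrite -[u k ^+ 2]real_normK ?num_real// ltr_sqr ?nnegrE ?normr_ge0 ?(ltW rd)//.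
rewrite sumr_const card_ord ur.
have -> : (r / d.+1%:R) ^+ 2 *+ d.+1 = r ^+ 2 / d.+1%:R by rewrite -mulr_natr; field; exact: lt0r_neq0.
apply/negP; rewrite -leNgt ler_pdivrMr// ler_peMr ?sqr_ge0//.
by rewrite (ler_nat _ 1).
Qed.

(* The points [x] and [y] of the two cells are [u0] apart; [bx] is the cell of
   [y], and [tau] the translation matching the subcells around [y] to those
   around [x]. The threshold [n0] must not depend on [u0], which is why the
   constants of the proof use [r / d.+1], a lower bound of the largest coordinate
   of [u0], instead of that coordinate. *)
Lemma local_gap (R : realType) (d : nat) (L r e1 : R) (nB : nat) :
  (0 < d)%N -> 0 < L -> 0 < r -> 0 < e1 -> e1 <= 1 ->
  exists n0 : nat, (nB <= n0)%N /\
  forall n1 (A : set 'rV[R]_d.+1), (n0 <= n1)%N -> lebesgue_measurable A ->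
  A `<=` cell L (fun=> 0) -> (forall x y, A x -> A y -> edist x y <> r) ->
  forall (u0 : 'I_d.+1 -> R) (bx : 'I_d.+1 -> int), \sum_k u0 k ^+ 2 = r ^+ 2 ->
  (forall k, 2 * (L / (2 ^ nB)%:R) <= L / (2 ^ nB)%:R * (bx k)%:~R - u0 k) ->
  (forall k, L / (2 ^ nB)%:R * (bx k + 1)%:~R - u0 k + 2 * (L / (2 ^ nB)%:R) <= L) ->
  exists tau : 'I_d.+1 -> int, (forall k, `|L / (2 ^ n1)%:R * (tau k)%:~R - u0 k| <= L / (2 ^ nB)%:R) /\
    ((2 ^ (n1 - nB)) ^ d.+1 < 2 * #|[pred f : {ffun 'I_d.+1 -> 'I_(2 ^ (n1 - nB))} |
       sparse e1 (L / (2 ^ n1)%:R) A (subcell bx f) ||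
       sparse e1 (L / (2 ^ n1)%:R) A (fun k => (subcell bx f k - tau k)%R)]|)%N.
Proof.
move=> d0 L0 r0 e10 e11; set be := L / (2 ^ nB)%:R.
have p2 q : 0 < (2 ^ q)%:R :> R by rewrite ltr0n expn_gt0.
have be0 : 0 < be by rewrite divr_gt0.
have dR : 0 < d.+1%:R :> R by rewrite ltr0n.
pose mu := r / d.+1%:R.
have muE : mu = r / d.+1%:R by [].
have mu0 : 0 < mu by exact: divr_gt0.
pose Lip := 4 * d.+1%:R * r / mu.
have Lip0 : 0 <= Lip by rewrite divr_ge0 ?(ltW mu0)// !mulr_ge0// ltW.
pose C0 := 8 * r * (1 + Lip) / mu ^+ 2.
have C00 : 0 <= C0 by rewrite divr_ge0 ?sqr_ge0// !mulr_ge0 ?(ltW r0)//; lra.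
have [rho [rho0 rhor rhobe rhomu Liprho]] : exists rho, [/\ 0 < rho, rho <= r, rho <= be / 4,
    d.+1%:R * (rho * (3 * r)) <= 3 / 4 * mu ^+ 2 & Lip * rho <= be / 4].
  have t1 : 0 < mu ^+ 2 / (4 * d.+1%:R * r) by rewrite divr_gt0 ?exprn_gt0// !mulr_gt0.
  have Lip1 : 0 < Lip + 1 by lra.
  have t2 : 0 < be / 4 / (Lip + 1) by rewrite !divr_gt0.
  exists (Num.min (Num.min r (be / 4)) (Num.min (mu ^+ 2 / (4 * d.+1%:R * r)) (be / 4 / (Lip + 1)))).
  set rho := Num.min _ _.
  have h1 : rho <= r by rewrite !ge_min lexx.
  have h2 : rho <= be / 4 by rewrite !ge_min lexx !orbT.
  have h3 : rho <= mu ^+ 2 / (4 * d.+1%:R * r) by rewrite !ge_min lexx !orbT.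
  have h4 : rho <= be / 4 / (Lip + 1) by rewrite !ge_min lexx !orbT.
  have h0 : 0 < rho by rewrite !lt_min r0 t1 t2 divr_gt0.
  split => //.
    rewrite ler_pdivlMr ?mulr_gt0// in h3.
    have -> : d.+1%:R * (rho * (3 * r)) = 3 / 4 * (rho * (4 * d.+1%:R * r)) by field.
    by rewrite ler_pM2l.
  rewrite ler_pdivlMr// in h4; apply: le_trans h4; rewrite mulrC ler_pM2l//; lra.
pose La := (Num.truncn (3 * Lip)).+2.
have hLa : 3 * Lip + 1 <= La%:R.
  by have := truncnS_gt (3 * Lip); rewrite /La -[_.+2%:R]natr1; lra.
pose CC := (2 * La + 3)%N.
have CC0 : (0 < CC)%N by rewrite addn_gt0 orbT.
have CCR : 0 < CC%:R :> R by rewrite ltr0n.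
pose B := ((2 ^ nB)%:R : R) ^+ d.+1.
pose C := (CC%:R : R) ^+ d.+1.
have B1 : 1 <= B by rewrite exprn_ege1// (ler_nat _ 1) expn_gt0.
have C1 : 1 <= C by rewrite exprn_ege1// (ler_nat _ 1).
have B0 : 0 < B by lra.
have C0' : 0 < C by lra.
(* Chosen to make [dense_pair_count] contradictory: [B] compares the large cell with one of level
   [nB], and [C] a window with a block. *)
pose z := e1 ^+ 2 / (128 * B * C).
have z0 : 0 < z by rewrite divr_gt0 ?exprn_gt0// !mulr_gt0.
have z1 : z <= 1.
  rewrite ler_pdivrMr ?mul1r; last by rewrite !mulr_gt0.
  apply: le_trans (_ : 1 <= _); first by rewrite expr_le1// ltW.
  have : 1 <= B * C by rewrite mulr_ege1.
  by rewrite -mulrA; lra.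
have zE : z = e1 ^+ 2 / (128 * B * C) by [].
clearbody z mu.
have [N [g [th [N0 g0 th0 params]]]] := direction_parameters r0 (lexx r) C00 rho0 rhor z0.
pose lmax := g%:R * (8 * r / mu).
have lmax0 : 0 < lmax by rewrite mulr_gt0 ?ltr0n// divr_gt0 ?mulr_gt0.
have La3 : 0 < La%:R + 3 :> R by have := ler0n R La; clear; lra.
(* The first bound makes the window [CC * w] admissible for [params], the second keeps the error on
   [tau] within [be]. *)
have [n00 hn00] : exists q : nat, L / (2 ^ q)%:R <= Num.min (th / CC%:R) (be / 4 / (La%:R + 3)).
  by apply: ex_pow2_small; rewrite lt_min !divr_gt0.
exists (maxn n00 nB); split; first exact: leq_maxr.
move=> n1 A; rewrite geq_max => /andP[n1n00 n1nB] mA AL Ar u0 bx u0r.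
move=> bx_lo bx_hi.
have [m /andP[mum mr]] := exists_large_coord r0 u0r.
rewrite -muE in mum.
have [l lm] := exists_other_ord m d0.
have m0 : 0 < `|u0 m| by exact: lt_le_trans mum.
have u0m : u0 m != 0 by rewrite -normr_gt0.
have sq_mum : mu ^+ 2 <= `|u0 m| ^+ 2 by rewrite ler_sqr ?nnegrE ?(ltW mu0) ?(ltW m0).
have rhomu' : d.+1%:R * (rho * (3 * r)) <= 3 / 4 * `|u0 m| ^+ 2.
  by apply: le_trans rhomu _; rewrite ler_pM2l.
pose Lip' := 4 * d.+1%:R * r / `|u0 m|.
have Lip_le : Lip' <= Lip by rewrite ler_pM2l ?lef_pV2 ?posrE ?mulr_gt0.
have Lip'0 : 0 <= Lip' by rewrite divr_ge0 ?(ltW m0)// !mulr_ge0// ltW.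
have hLa' : 3 * Lip' + 1 <= La%:R.
  by apply: le_trans hLa; rewrite lerD2r ler_pM2l.
have Liprho' : Lip' * rho <= be / 4.
  by apply: le_trans Liprho; rewrite ler_pM2r.
have C0_le : 8 * r * (1 + Lip') / `|u0 m| ^+ 2 <= C0.
  apply: ler_pM.
  - by rewrite !mulr_ge0 ?(ltW r0)// addr_ge0.
  - by rewrite invr_ge0 sqr_ge0.
  - by rewrite ler_pM2l ?mulr_gt0// lerD2l.
  - by rewrite lef_pV2 ?posrE ?exprn_gt0.
have lmax_le : g%:R * (8 * r / `|u0 m|) <= lmax.
  rewrite ler_pM2l ?ltr0n// ler_pM2l ?mulr_gt0// lef_pV2 ?posrE//.
set w := L / _; have w0 : 0 < w by rewrite divr_gt0.
have wE : w = L / (2 ^ n1)%:R by [].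
have hw : w <= Num.min (th / CC%:R) (be / 4 / (La%:R + 3)).
  apply: le_trans hn00; rewrite /w ler_pM2l// lef_pV2 ?posrE// ler_nat leq_exp2l//.
move: hw; rewrite le_min => /andP[hw1 hw2].
rewrite ler_pdivlMr// in hw1; rewrite ler_pdivlMr// in hw2.
clearbody w.
have [nu00 hnu] := params (CC%:R * w) (mulr_gt0 CCR w0) ltac:(by rewrite mulrC).
(* The first bound makes the pairs due to [G] outside [A] negligible; the second keeps subcells that
   are not sparse dense in [G]. *)
pose eps := Num.min (z * L ^+ d.+1 / 4) (e1 / 4 * w ^+ d.+1).
have LD : 0 < L ^+ d.+1 by rewrite exprn_gt0.
have eps0 : 0 < eps.
  rewrite lt_min; apply/andP; split; first by apply: divr_gt0 => //; exact: mulr_gt0.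
  by apply: mulr_gt0; [exact: divr_gt0|exact: exprn_gt0].
have [q' [G [gridG' GL AG GA]]] := dyadic_approx L0 mA AL eps0.
pose om0 := Num.min (z / 2) (z ^+ 2 / 4 / (8 * lmax)).
have om00 : 0 < om0.
  by rewrite lt_min divr_gt0//=; apply: divr_gt0; [rewrite divr_gt0 ?exprn_gt0|rewrite mulr_gt0].
have [j hj] := @ex_pow2_small R 1 om0 om00.
have nu1 : 0 < `|nu00| + 1 by have := normr_ge0 nu00; clear; lra.
have [j' hj'] := @ex_pow2_small R L (`|nu00| + 1)^-1 ltac:(by rewrite invr_gt0).
(* The lattice has [2 ^ q] steps per side: [G] is constant on blocks of [K] steps, and a subcell of
   level [n1] has [H]. The exponent [j] makes the variation [1 / K] small, [j'] makes [nu] large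
   enough for [params], and the successor gives [2 ^ q] the form [n.+2]. *)
pose K := (2 ^ (n1 + (j + j')).+1)%N; pose H := (2 ^ (q' + (j + j')).+1)%N.
pose q := (q' + (n1 + (j + j')).+1)%N.
have qK : (2 ^ q = 2 ^ q' * K)%N by rewrite expnD.
have qH : (2 ^ q = 2 ^ n1 * H)%N by rewrite qK pow2_swap.
have K0 : (0 < K)%N by rewrite expn_gt0.
have H0 : (0 < H)%N by rewrite expn_gt0.
have q0 : (0 < q)%N by rewrite addn_gt0 orbT.
have jK : ((2 ^ j)%:R : R) <= K%:R by rewrite ler_nat leq_exp2l// leqW// addnCA leq_addr.
have jq : ((2 ^ j')%:R : R) <= (2 ^ q)%:R by rewrite ler_nat leq_exp2l// /q !(addnS, addnA) leqW// leq_addl.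
clearbody q K H.
have KR : 0 < K%:R :> R by rewrite ltr0n.
have HR : 1 <= H%:R :> R by rewrite (ler_nat _ 1).
have [n nE] := pow2_SS q0.
pose nu := (2 ^ q)%:R / L.
have nu0 : 0 < nu by rewrite divr_gt0.
have nun0 : nu != 0 by exact: lt0r_neq0.
have Ln0 : L != 0 by exact: lt0r_neq0.
have pn0 k : (2 ^ k)%:R != 0 :> R by exact: lt0r_neq0.
have cancel1 (x h : R) : x != 0 -> L / x * (x * h / L) = h.
  by move=> x0; field; rewrite x0 Ln0.
have cancel2 (x h : R) : x != 0 -> h != 0 -> L / (x * h) * h = L / x.
  by move=> x0 h0; field; rewrite x0 h0.
have cancel3 (x h : R) : x != 0 -> h != 0 -> L / (x * h) = L / x / h.
  by move=> x0 h0; field; rewrite x0 h0.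
have Kn0 : K%:R != 0 :> R by exact: lt0r_neq0.
have wnu : w * nu = H%:R by rewrite wE /nu qH natrM; exact: cancel1.
have nu00nu : nu00 <= nu.
  apply: le_trans (ler_norm _) _; apply: le_trans (_ : `|nu00| + 1 <= _); first by rewrite lerDl.
  apply: le_trans (_ : (2 ^ j')%:R / L <= _); last by rewrite ler_pM2r ?invr_gt0.
  by rewrite -(invrK (`|nu00| + 1)) -invf_div lef_pV2 ?posrE ?invr_gt0 ?divr_gt0.
have [a [b [a0 b0 fits small [lminmax budget]]]] := hnu nu nu0 nu00nu.
have ellE : CC%:R * w * nu = (CC * H)%N%:R by rewrite -mulrA wnu natrM.
rewrite ellE in fits small budget.
have {small} : 2 * g%:R * (8 * r * (1 + Lip') / `|u0 m| ^+ 2 * (((CC * H)%:R + b.+1%:R * g%:R) / nu)) + 2 <=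
    z ^+ 2 / 4 * (g%:R * (a%:R / nu) / (2 * r)).
  apply: le_trans small; rewrite lerD2r ler_pM2l ?mulr_gt0 ?ltr0n//; apply: ler_wpM2r C0_le.
  by apply: divr_ge0 (ltW nu0); apply: addr_ge0; rewrite ?mulr_ge0.
have {lminmax} : 0 < g%:R * (a%:R / nu) / (2 * r) <= g%:R * (8 * r / `|u0 m|).
  move: lminmax => /andP[-> h] /=; apply: le_trans h _.
  rewrite ler_pM2l ?ltr0n// ler_pM2l ?mulr_gt0// lef_pV2 ?posrE//.
move=> lminmax small.
have nuV : nu^-1 = L / (2 ^ q)%:R by rewrite invf_div.
have gridK : grid_set (nu^-1 * K%:R) G.
  have -> // : nu^-1 * K%:R = L / (2 ^ q')%:R.
  by rewrite nuV qK natrM cancel2.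
have gridG : grid_set nu^-1 G.
  have -> : nu^-1 = L / (2 ^ q')%:R / K%:R by rewrite nuV qK natrM cancel3.
  by apply: grid_set_refine => //; rewrite divr_gt0.
have LE : n.+2%:R * nu^-1 = L by rewrite nE nuV mulrC divfK.
have GT : G `<=` cell (n.+2%:R * nu^-1) (fun=> 0) by rewrite LE.
have Kn : (K %| n.+2)%N by rewrite nE qK dvdn_mull.
have nuV0 : 0 < nu^-1 by rewrite invr_gt0.
pose f := @torus_ind R d n nu^-1 G.
have f01 y : 0 <= f y <= 1 by rewrite /f /torus_ind; case: asbool; rewrite ?lexx ler01.
have f_lip := @block_variation R d.+1 n K m K0 Kn f f01 (torus_ind_block nuV0 K0 gridK).
have om_le : K%:R^-1 <= om0.
  by apply: le_trans hj; rewrite div1r lef_pV2 ?posrE.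
have [om1 om2] : K%:R^-1 <= z / 2 /\ K%:R^-1 <= z ^+ 2 / 4 / (8 * lmax).
  by apply/andP; rewrite -le_min.
have budget' : N%:R^-1 + (CC * H)%N%:R / (g%:R * (a%:R / nu) / (2 * r) * b%:R) + z ^+ 2 / 4 +
    8 * (g%:R * (8 * r / `|u0 m|)) * K%:R^-1 <= z ^+ 2.
  have lm8 : 0 < 8 * lmax by exact: mulr_gt0.
  have {}om2 : 8 * lmax * K%:R^-1 <= z ^+ 2 / 4 by rewrite mulrC -ler_pdivlMr.
  have h8 : 8 * (g%:R * (8 * r / `|u0 m|)) * K%:R^-1 <= 8 * lmax * K%:R^-1.
    by rewrite ler_pM2r ?invr_gt0// ler_pM2l.
  apply: le_trans (lerD budget (le_trans h8 om2)) _; by have -> : 3 / 4 * z ^+ 2 + z ^+ 2 / 4 = z ^+ 2 by field.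
have cardV : #|{: 'rV['I_n.+2]_d.+1}|%:R = (2 ^ q)%:R ^+ d.+1 :> R.
  by rewrite card_mx card_ord mul1n nE natrX.
have c0V : 2 * rleb (G `\` A) / nu^-1 ^+ d.+1 + K%:R^-1 * #|{: 'rV['I_n.+2]_d.+1}|%:R <=
    z * #|{: 'rV['I_n.+2]_d.+1}|%:R.
  rewrite cardV; set X := (2 ^ q)%:R ^+ d.+1.
  have X0 : 0 < X by rewrite exprn_gt0.
  have h1 : 2 * rleb (G `\` A) / nu^-1 ^+ d.+1 <= z / 2 * X.
    rewrite ler_pdivrMr ?exprn_gt0// -[leRHS]mulrA /X -exprMn -nE LE.
    have : rleb (G `\` A) <= z * L ^+ d.+1 / 4 by apply: le_trans GA _; rewrite ge_min lexx.
    by move: (L ^+ d.+1) (rleb _) => x y h; (have -> : z / 2 * x = 2 * (z * x / 4) by field); rewrite ler_pM2l.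
  have h2 : K%:R^-1 * X <= z / 2 * X by rewrite ler_pM2r.
  by move: h1 h2; clear; lra.
pose s0 k := Num.floor (nu * u0 k).
have hs0 k : `|(s0 k)%:~R - nu * u0 k| <= 1.
  have /andP[h1 h2] := floor_itv (nu * u0 k); rewrite intrD in h2.
  by rewrite /s0 ler_norml; apply/andP; split; clear -h1 h2; lra.
have w_be : w <= be / 4.
  by apply: le_trans hw2; rewrite ler_peMr ?(ltW w0)//; clear -La3 La; have := ler0n R La; lra.
have nuw : nu^-1 <= w by rewrite -[leLHS]div1r ler_pdivrMr// wnu.
have Lr : Lip' * rho + nu^-1 <= be by move: Liprho' nuw w_be be0; clear; lra.
have rhobe' : rho <= be by move: rhobe be0; clear; lra.
pose HB := (2 ^ (n1 - nB) * H)%N.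
have HBE : HB%:R = be * nu.
  rewrite /be /nu qH -(subnKC n1nB) expnD -mulnA natrM -/HB; symmetry; exact: cancel1.
pose Q := @in_block d.+1 n HB bx.
have nube : 1 <= nu * be.
  have : nu^-1 <= be by move: nuw w_be be0; clear; lra.
  by move=> h; rewrite -(mulfV nun0) ler_pM2l.
have nuL : nu * L = n.+2%:R by rewrite /nu divfK// nE.
(* Here [bx_lo] and [bx_hi] rule out wrapping around the torus. *)
have Qbe y k (zk : int) : Q y -> `|zk%:~R / nu - u0 k| <= be -> 1 <= torus_index y k - zk < n.+2%:Z.
  move=> /forallP/(_ k)/andP[]; rewrite -(ler_int R) -(ltr_int R) !intrM -pmulrn HBE => y1 y2.
  rewrite ler_norml -!(ler_int R) -!(ltr_int R) intrB -pmulrn => /andP[h1 h2].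
  have {}h1 := ler_wpM2l (ltW nu0) h1; have {}h2 := ler_wpM2l (ltW nu0) h2.
  have E : nu * (zk%:~R / nu - u0 k) = zk%:~R - nu * u0 k by field.
  rewrite E mulrN in h1; rewrite E in h2.
  have h3 := ler_wpM2l (ltW nu0) (bx_lo k); have h4 := ler_wpM2l (ltW nu0) (bx_hi k).
  rewrite nuL in h4.
  have E3 x : nu * (be * x - u0 k) = be * nu * x - nu * u0 k by ring.
  have E4 x : nu * (be * x - u0 k + 2 * be) = be * nu * x - nu * u0 k + 2 * (nu * be) by ring.
  have E5 : nu * (2 * be) = 2 * (nu * be) by ring.
  rewrite E3 E5 in h3; rewrite E4 in h4.
  move: y1 y2 h1 h2 h3 h4 nube; clear.
  by move=> *; apply/andP; split; lra.
have ell0 : (0 < CC * H)%N by rewrite muln_gt0 CC0.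
have eta01 : 0 <= z ^+ 2 / 4 <= 1.
  have z2 : z ^+ 2 <= 1 by rewrite expr_le1// ltW.
  by rewrite divr_ge0 ?sqr_ge0//=; clear -z2; lra.
have [i [c cb sum_le]] := @good_direction R d u0 m l r rho lm r0 u0r u0m rho0 rhor rhomu' nu s0 a g
  (CC * H) N b n nu0 hs0 a0 g0 N0 b0 ell0 fits (z ^+ 2 / 4) K%:R^-1 z z be G A Q small eta01 lminmax z0
  budget' GT f_lip Ar rhobe' Lr Qbe c0V.
pose gr := lattice_graph u0 m r nu.
pose s := lattice_point l s0 a g (fun=> 0%N) i c.
(* Integer quotients by [H], realising the ranges required by [line_avg_hits]. *)
pose tau k : int := if k == m then ((gr s - (La * H + H)%N%:Z) %/ H%:Z)%Z
  else ((s k + (2 * H)%N%:Z - 1) %/ H%:Z)%Z.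
have tau_o k : k != m -> s k + H%:Z <= H%:Z * tau k < s k + (2 * H)%N%:Z.
  move=> /negbTE km; rewrite /tau km; have := divz_window (s k + (2 * H)%N%:Z - 1) H0.
  by set y := divz _ _; move: (s k) y; clear; move=> x y; lia.
have tau_m : gr s - (La * H + 2 * H)%N%:Z < H%:Z * tau m <= gr s - (La * H + H)%N%:Z.
  rewrite /tau eqxx/=; have := divz_window (gr s - (La * H + H)%N%:Z) H0.
  by set y := divz _ _; move: (gr s) (La * H)%N y; clear; move=> x LH y; lia.
have iN : (i <= N)%N by exact: ltnW.
have cb' : (c <= b.+1)%N by rewrite leqW// ltnW.
have near := lattice_near (m := m) l nu0 hs0 fits (t := fun=> 0%N) (fun=> ell0) iN cb'.
have nearm := lattice_graph_near l r0 u0r u0m rho0 rhor rhomu' nu0 hs0 fits (t := fun=> 0%N) (fun=> ell0) iN cb'.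
rewrite -/s/= in near nearm.
have Hw : H%:R / nu = w by rewrite -wnu mulfK.
have wtau k : w * (tau k)%:~R = (H%:Z * tau k)%:~R / nu by rewrite intrM -pmulrn mulrAC Hw.
have close k : `|w * (tau k)%:~R - u0 k| <= be.
  rewrite wtau; have [->|km] := eqVneq k m; last first.
    have /andP[h1 h2] := tau_o k km; have h3 := near k km.
    have {}h1 : (s k)%:~R / nu + w <= (H%:Z * tau k)%:~R / nu.
      by rewrite -Hw -mulrDl ler_pM2r// -[H%:R]/(H%:Z%:~R) -intrD ler_int.
    have {}h2 : (H%:Z * tau k)%:~R / nu <= (s k)%:~R / nu + 2 * w.
      rewrite -Hw mulrA -mulrDl ler_pM2r// -natrM -[(2 * H)%:R]/((2 * H)%N%:Z%:~R) -intrD ler_int.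
      exact: ltW.
    move: h1 h2 h3 w_be rhobe be0; rewrite !ler_norml; clear.
    by move=> h1 h2 /andP[h3 h4] *; apply/andP; split; lra.
  have /andP[h1 h2] := tau_m.
  have grE : gr s = Num.floor (nu * sphere_graph u0 m r (fun k => (s k)%:~R / nu)) by [].
  move: grE nearm; set ph := sphere_graph _ _ _ _ => grE nearm.
  have /andP[f1 f2] := floor_itv (nu * ph); rewrite -grE in f1 f2.
  have {}f1 : (gr s)%:~R / nu <= ph by rewrite ler_pdivrMr// mulrC.
  have {}f2 : ph <= (gr s)%:~R / nu + nu^-1.
    have : ph <= (gr s + 1)%:~R / nu by rewrite ler_pdivlMr// mulrC ltW.
    by rewrite intrD mulrDl mul1r.
  have {}h2 : (H%:Z * tau m)%:~R / nu <= (gr s)%:~R / nu.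
    by rewrite ler_pM2r// ler_int; apply: le_trans h2 _; rewrite lerBlDr lerDl.
  have {}h1 : (gr s)%:~R / nu - (La%:R + 2) * w <= (H%:Z * tau m)%:~R / nu.
    rewrite -Hw mulrA -mulrBl ler_pM2r// mulrDl -!natrM -natrD -[_%:R]/((La * H + 2 * H)%N%:Z%:~R) -intrB ler_int.
    exact: ltW.
  have h4 : (La%:R + 2) * w + nu^-1 <= be / 4.
    apply: le_trans hw2; rewrite [leRHS]mulrC.
    have -> : (La%:R + 3) * w = (La%:R + 2) * w + w by ring.
    by rewrite lerD2l.
  move: h1 h2 f1 f2 nearm Liprho' h4 nuV0 be0; rewrite -/Lip' !ler_norml; clear.
  by move=> h1 h2 f1 f2 /andP[h3 h4] *; apply/andP; split; lra.
(* If at most half of the subcells are bad, the others alone yield more pairs than [sum_le]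
   allows. *)
exists tau; split => //; rewrite ltnNge; apply/negP.
set bad := [pred f | _] => few.
pose J : finType := {ffun 'I_d.+1 -> 'I_(2 ^ (n1 - nB))}.
have gr_lip (t : 'I_d.+1 -> nat) : (forall k, (t k <= 3 * H)%N) ->
    `|gr (fun k => s k + (t k)%:Z) - gr s| <= (La * H)%N%:Z.
  have h3 : (3 * H < CC * H)%N by rewrite ltn_pmul2r// /CC -[X in (X < _)%N]add0n ltn_add2r muln_gt0.
  exact: (lattice_graph_lip l r0 u0r u0m rho0 rhor rhomu' nu0 hs0 fits H0 h3 hLa' iN cb').
have gr_ext : forall p p', (forall k, k != m -> p k = p' k) -> gr p = gr p'.
  by move=> p p'; exact: lattice_graph_ext.
have subcell_inj : injective (@subcell d (2 ^ (n1 - nB)) bx).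
  move=> f1 f2 h; apply/ffunP => k; apply/val_inj; have := congr1 (@^~ k) h.
  by rewrite /subcell => /addrI [].
have f0 y : 0 <= f y by have /andP[] := f01 y.
have h0 y : 0 <= (Q y)%:R * f y by rewrite mulr_ge0.
have hits := line_avg_hits H0 gr_ext gr_lip tau_o tau_m (predC bad) subcell_inj f0 h0.
have hE : \sum_(t : {ffun 'I_d.+1 -> 'I_((2 * La + 3) * H)}) \sum_y (Q y)%:R * f y *
      line_avg f (torus_of n (axis m)) ((2 * La + 3) * H) (y - torus_of n (graph_vector m gr s (fun k => t k))) =
    \sum_(t : {ffun 'I_d.+1 -> 'I_(CC * H)}) \sum_y (Q y)%:R * f y * line_avg f (torus_of n (axis m)) (CC * H)
      (y - torus_of n (lattice_vector u0 m l r nu s0 a g (fun k => t k) i c)).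
  apply: eq_bigr => t _; apply: eq_bigr => y _; congr (_ * line_avg _ _ _ (_ - torus_of _ _)).
  have sE : (fun k => s k + (t k)%:Z) = lattice_point l s0 a g (fun k => t k) i c.
    by apply/funext => k; rewrite /s /lattice_point addr0 addrAC.
  by apply/funext => k; rewrite /graph_vector /lattice_vector sE -[s k + _]/((fun k => s k + (t k)%:Z) k) sE.
rewrite hE in hits; have {hits sum_le} := le_trans hits sum_le.
have fA : finm A by apply: finmS AL _; exact: finm_cell.
have AGe : rleb (A `\` G) <= e1 / 4 * (H%:R * nu^-1) ^+ d.+1.
  by rewrite Hw; apply: le_trans AG _; rewrite ge_min lexx orbT.
have dense c' : ~~ sparse e1 w A c' ->
    e1 / 4 * H%:R ^+ d.+1 <= \sum_(y : 'rV['I_n.+2]_d.+1 | in_block H c' y) f y.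
  rewrite /sparse -leNgt => h; apply: (block_dense nuV0 GT gridG fA H0) => //.
  by rewrite Hw.
have inQ (fJ : J) y : in_block H (subcell bx fJ) y -> Q y.
  move=> /forallP h; apply/forallP => k; have /andP[h1 h2] := h k.
  rewrite /subcell in h1 h2; rewrite /HB PoszM.
  have a1 : H%:Z * ((2 ^ (n1 - nB))%N%:Z * bx k) <= H%:Z * ((2 ^ (n1 - nB))%N%:Z * bx k + (fJ k)%:Z).
    by rewrite ler_wpM2l// lerDl.
  have a2 : H%:Z * ((2 ^ (n1 - nB))%N%:Z * bx k + (fJ k)%:Z + 1) <= H%:Z * ((2 ^ (n1 - nB))%N%:Z * (bx k + 1)).
    by rewrite ler_wpM2l// mulrDr mulr1 -addrA lerD2l; have := ltn_ord (fJ k); clear; lia.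
  rewrite [_%:Z * H%:Z]mulrC -!mulrA (le_trans a1 h1)/=; exact: lt_le_trans h2 a2.
have e4h : 0 <= e1 / 4 * H%:R ^+ d.+1 by apply: mulr_ge0; [apply: divr_ge0; [exact: ltW|exact: ler0n]|exact: exprn_ge0].
move=> sum_le.
have {}sum_le : #|predC bad|%:R * ((e1 / 4 * H%:R ^+ d.+1) * (e1 / 4 * H%:R ^+ d.+1)) <=
    C * H%:R ^+ d.+1 * ((z + z) * (2 ^ q)%:R ^+ d.+1).
  have -> : C * H%:R ^+ d.+1 = ((CC * H) ^ d.+1)%N%:R by rewrite natrX natrM exprMn.
  rewrite -cardV; apply: le_trans sum_le; rewrite mulr_natl -sumr_const.
  apply: ler_sum => fJ; rewrite !inE negb_or => /andP[g1 g2].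
  apply: (ler_pM e4h e4h); last exact: dense.
  rewrite (eq_bigr f); first exact: dense.
  by move=> y /inQ ->; rewrite mul1r.
have I0 : 0 < ((2 ^ (n1 - nB))%:R : R) ^+ d.+1 by rewrite exprn_gt0.
have Hd0 : 0 < (H%:R : R) ^+ d.+1 by apply: exprn_gt0; rewrite ltr0n.
apply: (dense_pair_count e10 Hd0 B0 C0' I0 zE _ _ sum_le).
  have qE : (2 ^ q = 2 ^ (n1 - nB) * 2 ^ nB * H)%N by rewrite -expnD subnK.
  by rewrite qE !natrM !exprMn.
rewrite -natrX -[2]/(2%:R) -natrM ler_nat.
have := cardC bad; rewrite card_ffun !card_ord => cC.
by apply: half_count few; rewrite -cC.
Qed.

Lemma offset_lt (M : nat) (a b : int) : M%:Z * b <= a < M%:Z * (b + 1) ->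
  (absz (a - M%:Z * b)%R < M)%N.
Proof. by rewrite mulrDr mulr1; move: (M%:Z * b) => x; lia. Qed.

Lemma offsetE (M : nat) (a b : int) : M%:Z * b <= a < M%:Z * (b + 1) ->
  (absz (a - M%:Z * b)%R)%:Z = a - M%:Z * b.
Proof. by move=> /andP[ab _]; rewrite gez0_abs// subr_ge0. Qed.

(** * Energy increment *)

Section Subcells.
Variables (R : realType) (d : nat).
Local Notation index n := {ffun 'I_d.+1 -> 'I_n}.

Definition corner n (c : index n) : 'I_d.+1 -> int := fun k => (c k)%:Z.

Lemma sum_subcell (N M T : nat) (F : ('I_d.+1 -> int) -> R) : (0 < M)%N -> T = (N * M)%N ->
  \sum_(c : index T) F (corner c) = \sum_(c : index N) \sum_(h : index M) F (subcell (corner c) h).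
Proof.
move=> M0 ->; rewrite pair_big/=.
have bl (p : index N * index M) k : (M * p.1 k + p.2 k < N * M)%N.
  rewrite mulnC; apply: leq_trans (_ : p.1 k * M + M <= _)%N; first by rewrite ltn_add2l.
  by rewrite addnC -mulSn leq_mul2r ltn_ord orbT.
have dl (c : index (N * M)%N) k : (c k %/ M < N)%N by rewrite ltn_divLR.
have ml (c : index (N * M)%N) k : (c k %% M < M)%N by rewrite ltn_mod.
rewrite (reindex (fun p : index N * index M => [ffun k => Ordinal (bl p k)] : index (N * M)%N))/=.
  apply: eq_bigr => -[c h] _; congr F; apply/funext => k.
  by rewrite /corner /subcell ffunE /= PoszD PoszM.
exists (fun c => ([ffun k => Ordinal (dl c k)], [ffun k => Ordinal (ml c k)])) => [[c h] _|c _].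
  congr pair; apply/ffunP => k; apply/val_inj; rewrite !ffunE/= ffunE/= mulnC.
    by rewrite divnMDl// divn_small ?addn0.
  by rewrite modnMDl modn_small.
apply/ffunP => k; apply/val_inj; rewrite !ffunE/= !ffunE/= mulnC; exact/esym/divn_eq.
Qed.

Lemma subcell_inj K (c : 'I_d.+1 -> int) : injective (@subcell d K c).
Proof.
move=> f1 f2 h; apply/ffunP => k; apply/val_inj; have := congr1 (@^~ k) h.
by rewrite /subcell => /addrI [].
Qed.

Lemma card_subcell_le (K M : nat) (c : 'I_d.+1 -> int) (P : ('I_d.+1 -> int) -> bool)
    (phi : index K -> 'I_d.+1 -> int) : injective phi ->
  (forall f k, M%:Z * c k <= phi f k < M%:Z * (c k + 1)) ->
  (#|[pred f | P (phi f)]| <= #|[pred h : index M | P (subcell c h)]|)%N.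
Proof.
move=> phi_inj hphi.
have lt f k := offset_lt (hphi f k).
pose h f : index M := [ffun k => Ordinal (lt f k)].
have hE f : subcell c (h f) = phi f.
  by apply/funext => k; rewrite /subcell ffunE [X in _ + X](offsetE (hphi f k)) addrC subrK.
have h_inj : injective h by move=> f f' ff'; apply: phi_inj; rewrite -!hE ff'.
rewrite -(fintype.card_image h_inj); apply: subset_leq_card; apply/fintype.subsetP => _ /fintype.imageP[f Pf ->].
by move: Pf; rewrite !inE hE.
Qed.

Lemma rleb_subcell (w : R) (M : nat) (A : set 'rV[R]_d.+1) c : 0 < w -> (0 < M)%N -> finm A ->
  rleb (A `&` cell (M%:R * w) c) = \sum_(h : index M) rleb (A `&` cell w (subcell c h)).
Proof.
move=> w0 M0 fA; have MR : 0 < M%:R :> R by rewrite ltr0n.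
have sub (h : index M) : cell w (subcell c h) `<=` cell (M%:R * w) c.
  move=> x /cellP hx; apply/cellP => k; have /andP[h1 h2] := hx k.
  have E z : M%:R * w * z%:~R = w * (M%:Z * z)%:~R by rewrite intrM -pmulrn; ring.
  rewrite !E; apply/andP; split.
    by apply: le_lt_trans h1; rewrite ler_pM2l// ler_int /subcell lerDl.
  apply: le_trans h2 _; rewrite ler_pM2l// ler_int /subcell mulrDr mulr1 -addrA lerD2l.
  by have := ltn_ord (h k); clear; lia.
have AC (h : index M) : A `&` cell w (subcell c h) =
    (A `&` cell (M%:R * w) c) `&` cell w (subcell c h).
  by rewrite -setIA [cell (M%:R * w) c `&` _]setIC (setIidl (@sub h)).
under eq_bigr => h _ do rewrite AC.
symmetry; apply: rleb_sum_disj.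
- by apply: finmS fA; exact: subIsetl.
- by move=> h _; exact: measurable_cell.
- move=> h h' x _ _ hx hx'; apply: (@subcell_inj M c); exact: cell_inj w0 hx hx'.
move=> x [Ax /cellP hx]; have /cellP ix := cell_indexP x w0.
have bnd k : M%:Z * c k <= cell_index w x k < M%:Z * (c k + 1).
  have /andP[h1 h2] := hx k; have /andP[h3 h4] := ix k.
  have E z : M%:R * w * z%:~R = w * (M%:Z * z)%:~R by rewrite intrM -pmulrn; ring.
  rewrite !E in h1 h2; have := lt_le_trans h1 h4; have := lt_le_trans h3 h2.
  by rewrite !ltr_pM2l// !ltr_int ltzD1 => -> ->.
have lt k := offset_lt (bnd k).
exists [ffun k => Ordinal (lt k)] => //.
have -> : subcell c [ffun k => Ordinal (lt k)] = cell_index w x; last exact/cellP.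
by apply/funext => k; rewrite /subcell ffunE [X in _ + X](offsetE (bnd k)) addrC subrK.
Qed.

End Subcells.

Section Energy.
Variables (R : realType) (d : nat) (L : R) (A : set 'rV[R]_d.+1).
Hypotheses (L0 : 0 < L) (fA : finm A).
Local Notation index n := {ffun 'I_d.+1 -> 'I_n}.
Local Notation side n := (L / (2 ^ n)%:R).

Lemma pow2_gt0 n : 0 < (2 ^ n)%:R :> R.
Proof. by rewrite ltr0n expn_gt0. Qed.

Lemma side_gt0 n : 0 < side n.
Proof. by rewrite divr_gt0// pow2_gt0. Qed.

Lemma side_refine n n1 : (n <= n1)%N -> (2 ^ (n1 - n))%:R * side n1 = side n.
Proof.
move=> nn1; rewrite -{2}(subnKC nn1) expnD natrM.
have := pow2_gt0 n; have := pow2_gt0 (n1 - n); move: (_%:R) (_%:R) => x y x0 y0.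
by field; rewrite !lt0r_neq0.
Qed.

Definition dens n (c : 'I_d.+1 -> int) : R := rleb (A `&` cell (side n) c) / side n ^+ d.+1.

Lemma dens_ge0 n c : 0 <= dens n c.
Proof. by rewrite divr_ge0 ?rleb_ge0// exprn_ge0// ltW// side_gt0. Qed.

Lemma dens_le1 n c : dens n c <= 1.
Proof.
have s0 := side_gt0 n; rewrite ler_pdivrMr ?exprn_gt0// mul1r -(rleb_cell c s0).
by apply: le_rleb (@finm_cell R d _ c s0); exact: subIsetr.
Qed.

Lemma sum_dens n n1 c : (n <= n1)%N ->
  \sum_(h : index (2 ^ (n1 - n))) dens n1 (subcell c h) = (2 ^ (n1 - n))%:R ^+ d.+1 * dens n c.
Proof.
move=> nn1; have s0 := side_gt0 n1.
rewrite -mulr_suml -(rleb_subcell _ s0) ?expn_gt0// /dens -(side_refine nn1).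
move: (side n1) s0 (pow2_gt0 (n1 - n)) => y y0; move: (_%:R) => z z0.
rewrite exprMn; move: (rleb _) => x.
by field; rewrite !expf_neq0 ?lt0r_neq0.
Qed.

Definition energy n : R := ((2 ^ n)%:R ^+ d.+1)^-1 * \sum_(c : index (2 ^ n)) dens n (corner c) ^+ 2.

Lemma energy_ge0 n : 0 <= energy n.
Proof.
rewrite mulr_ge0 ?invr_ge0 ?exprn_ge0//; apply: sumr_ge0 => c _; exact: sqr_ge0.
Qed.

Lemma energy_le1 n : energy n <= 1.
Proof.
have p0 : 0 < (2 ^ n)%:R ^+ d.+1 :> R by rewrite exprn_gt0// pow2_gt0.
rewrite /energy mulrC ler_pdivrMr// mul1r.
apply: le_trans (_ : \sum_(c : index (2 ^ n)) 1 <= _).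
  by apply: ler_sum => c _; rewrite expr_le1// ?dens_le1 ?dens_ge0.
by rewrite sumr_const card_ffun !card_ord -natrX lexx.
Qed.

(** Sparse subcells are counted in a whole cell of level [n], but against a quarter of the subcells
    of one cell of level [n + g]: they remain a minority in such a smaller cell wherever it lies. *)
Definition regular e1 g n n1 (c : 'I_d.+1 -> int) : bool :=
  (4 * #|[pred h : index (2 ^ (n1 - n)) | sparse e1 (side n1) A (subcell c h)]| <=
   (2 ^ (n1 - (n + g))) ^ d.+1)%N.

Variables (e1 : R) (g : nat).
Hypothesis e10 : 0 < e1.
Let gain := e1 ^+ 2 / (16 * (2 ^ g)%:R ^+ d.+1).

Let gain0 : 0 < gain.
Proof. by rewrite divr_gt0 ?exprn_gt0// mulr_gt0// exprn_gt0// pow2_gt0. Qed.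

(** Variance decomposition. In a dense irregular cell, each sparse subcell deviates from the mean by
    at least [e1 / 2], and their proportion exceeds [1 / (4 * (2 ^ g) ^ d.+1)]; the product is
    [gain]. *)
Lemma sum_sqr_dens n n1 c : (n + g <= n1)%N ->
  (2 ^ (n1 - n))%:R ^+ d.+1 * (dens n c ^+ 2 + ((e1 <= dens n c) && ~~ regular e1 g n n1 c)%:R * gain) <=
  \sum_(h : index (2 ^ (n1 - n))) dens n1 (subcell c h) ^+ 2.
Proof.
move=> ngn1; have nn1 : (n <= n1)%N by apply: leq_trans ngn1; exact: leq_addr.
set M := _ ^+ d.+1; set a := dens n c.
have E : \sum_(h : index (2 ^ (n1 - n))) dens n1 (subcell c h) ^+ 2 =
    M * a ^+ 2 + \sum_(h : index (2 ^ (n1 - n))) (dens n1 (subcell c h) - a) ^+ 2.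
  have -> : \sum_(h : index (2 ^ (n1 - n))) (dens n1 (subcell c h) - a) ^+ 2 =
    \sum_(h : index (2 ^ (n1 - n))) dens n1 (subcell c h) ^+ 2 -
    2 * a * \sum_(h : index (2 ^ (n1 - n))) dens n1 (subcell c h) + M * a ^+ 2.
    have -> : M * a ^+ 2 = \sum_(h : index (2 ^ (n1 - n))) a ^+ 2.
      by rewrite sumr_const card_ffun !card_ord -mulr_natl natrX.
    by rewrite mulr_sumr -sumrB -big_split; apply: eq_bigr => h _ /=; ring.
  by rewrite (sum_dens c nn1) -/a -/M; ring.
rewrite E mulrDr lerD2l; case: andP => [[ae reg]|_]; last first.
  by rewrite mul0r mulr0; apply: sumr_ge0 => h _; exact: sqr_ge0.
pose sp := [pred h : index (2 ^ (n1 - n)) | sparse e1 (side n1) A (subcell c h)].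
apply: le_trans (_ : \sum_(h | sp h) e1 ^+ 2 / 4 <= _); last first.
  rewrite [leRHS](bigID sp)/= -[leLHS]addr0; apply: lerD; last by apply: sumr_ge0 => h _; exact: sqr_ge0.
  apply: ler_sum => h hsp; rewrite -[leRHS]sqrrN opprB.
  have : dens n1 (subcell c h) <= e1 / 2.
    by rewrite ler_pdivrMr ?exprn_gt0 ?side_gt0// ltW.
  move=> hd; have -> : e1 ^+ 2 / 4 = (e1 / 2) ^+ 2 by field.
  have e2 : e1 / 2 <= a - dens n1 (subcell c h) by rewrite lerBrDr (le_trans _ ae)// [leRHS]splitr lerD2l.
  have e3 : 0 <= e1 / 2 by rewrite divr_ge0// ltW.
  by rewrite ler_sqr// nnegrE; exact: le_trans e2.
rewrite sumr_const mul1r.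
have -> : e1 ^+ 2 / 4 *+ #|sp| = #|sp|%:R * (e1 ^+ 2 / 4) by rewrite mulr_natl.
move: reg; rewrite /regular -/sp -ltnNge -(ltr_nat R) natrM natrX => reg.
have ME : M = (2 ^ (n1 - (n + g)))%:R ^+ d.+1 * (2 ^ g)%:R ^+ d.+1.
  by rewrite -exprMn -natrM -expnD subnDA subnK// leq_subRL.
have p0 : 0 < (2 ^ g)%:R ^+ d.+1 :> R by rewrite exprn_gt0// pow2_gt0.
rewrite ME /gain; move: reg p0.
move: ((2 ^ (n1 - (n + g)))%:R ^+ d.+1) ((2 ^ g)%:R ^+ d.+1) (#|sp|%:R) => x y s xs y0.
have -> : x * y * (e1 ^+ 2 / (16 * y)) = x * (e1 ^+ 2 / 16) by field; rewrite lt0r_neq0.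
have -> : s * (e1 ^+ 2 / 4) = 4 * s * (e1 ^+ 2 / 16) by field.
by rewrite ler_pM2r ?divr_gt0 ?exprn_gt0// ltW.
Qed.

Definition irregular n n1 := [pred c : index (2 ^ n) |
  (e1 <= dens n (corner c)) && ~~ regular e1 g n n1 (corner c)].

Lemma energy_gain n n1 : (n + g <= n1)%N ->
  energy n + gain * (#|irregular n n1|%:R / (2 ^ n)%:R ^+ d.+1) <= energy n1.
Proof.
move=> ngn1; have nn1 : (n <= n1)%N by apply: leq_trans ngn1; exact: leq_addr.
have T : (2 ^ n1 = 2 ^ n * 2 ^ (n1 - n))%N by rewrite -expnD subnKC.
rewrite /energy (sum_subcell (fun c => dens n1 c ^+ 2) _ T) ?expn_gt0//.
have p1 : 0 < (2 ^ n)%:R ^+ d.+1 :> R by rewrite exprn_gt0// pow2_gt0.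
have p2 : 0 < (2 ^ (n1 - n))%:R ^+ d.+1 :> R by rewrite exprn_gt0// pow2_gt0.
have := ler_sum (index_enum _) (fun (c : index (2 ^ n)) (_ : true) => sum_sqr_dens (corner c) ngn1).
rewrite -mulr_sumr big_split/= -mulr_suml -natr_sum.
have -> : (\sum_(c : index (2 ^ n)) ((e1 <= dens n (corner c))%R && ~~ regular e1 g n n1 (corner c)))%N =
  #|irregular n n1| by rewrite -sum1_card [RHS]big_mkcond; apply: eq_bigr => c _; rewrite inE; case: ifP.
have -> : (2 ^ n1)%:R ^+ d.+1 = (2 ^ n)%:R ^+ d.+1 * (2 ^ (n1 - n))%:R ^+ d.+1 :> R.
  by rewrite -exprMn -natrM -T.
move: p1 p2; move: ((2 ^ n)%:R ^+ d.+1) ((2 ^ (n1 - n))%:R ^+ d.+1) => x y x0 y0.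
move: (#|_|%:R) => s; set S1 := (\sum_i _); set S2 := (\sum_i _) => h.
rewrite [leRHS]mulrC ler_pdivlMr ?mulr_gt0//; apply: le_trans h.
by have -> : (x^-1 * S1 + gain * (s / x)) * (x * y) = y * (S1 + s * gain) by field; rewrite lt0r_neq0.
Qed.

(** The energy stays between 0 and 1 and gains at least [gain * x] at each level that fails, so [J]
    levels cannot all fail. *)
Lemma exists_regular_level (ns : nat -> nat) (J : nat) (x : R) : 0 < x ->
  (forall i, ns i + g <= ns i.+1)%N -> 1 < J%:R * (gain * x) ->
  exists2 i, (i < J)%N & #|irregular (ns i) (ns i.+1)|%:R <= x * (2 ^ ns i)%:R ^+ d.+1.
Proof.
move=> x0 hns hJ; apply: contrapT => h.
have step i : (i <= J)%N -> i%:R * (gain * x) <= energy (ns i).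
  elim: i => [_|i IH iJ]; first by rewrite mul0r energy_ge0.
  apply: le_trans (energy_gain (hns i)); rewrite -natr1 mulrDl mul1r.
  apply: lerD; first by apply: IH; exact: ltnW.
  rewrite ler_pM2l// ler_pdivlMr ?exprn_gt0 ?pow2_gt0//; apply: ltW; rewrite ltNge.
  by apply/negP => hi; apply: h; exists i.
by have := lt_le_trans hJ (le_trans (step J (leqnn _)) (energy_le1 _)); rewrite ltxx.
Qed.

End Energy.

Lemma quarter_count a b u t : (4 * a <= t -> 4 * b <= t -> u <= a + b -> 2 * u <= t)%N.
Proof. by lia. Qed.

Section Middles.
Variables (R : realType) (d : nat) (L : R) (A : set 'rV[R]_d.+1) (e1 : R) (g n n1 : nat).
Hypotheses (L0 : 0 < L) (ngn1 : (n + g <= n1)%N).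
Local Notation index n := {ffun 'I_d.+1 -> 'I_n}.
Local Notation side n := (L / (2 ^ n)%:R).
Local Notation be := (side (n + g)).
Local Notation w1 := (side n1).

(* The margin of three cells of the level [n + g] leaves room for a translation
   of a cell containing a point of the middle, up to an error of one more cell. *)
Definition middle (c : 'I_d.+1 -> int) : set 'rV[R]_d.+1 :=
  half_open_box (\row_k (side n * (c k)%:~R + 3 * be)) (\row_k (side n * (c k + 1)%:~R - 3 * be)).

Let index_bounds (c z : int) : side n * c%:~R <= w1 * z%:~R < side n * (c + 1)%:~R ->
  (2 ^ (n1 - n))%N%:Z * c <= z < (2 ^ (n1 - n))%N%:Z * (c + 1).
Proof.
have nn1 : (n <= n1)%N by apply: leq_trans ngn1; exact: leq_addr.
have E (x : int) : side n * x%:~R = w1 * ((2 ^ (n1 - n))%N%:Z * x)%:~R.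
  by rewrite -(side_refine L nn1) intrM -pmulrn; ring.
by rewrite !E ler_pM2l ?ltr_pM2l ?side_gt0// ler_int ltr_int.
Qed.

(** The hypothesis matches the subcells of the small cell of [y] with subcells around [x], more than
    half of the pairs having a sparse member. The margins keep all of them inside the two large
    cells, where regularity allows at most a quarter on each side. *)
Lemma middles_avoid (r : R) : 0 < r ->
  (forall (u0 : 'I_d.+1 -> R) (bx : 'I_d.+1 -> int), \sum_k u0 k ^+ 2 = r ^+ 2 ->
  (forall k, 2 * be <= be * (bx k)%:~R - u0 k) ->
  (forall k, be * (bx k + 1)%:~R - u0 k + 2 * be <= L) ->
  exists tau : 'I_d.+1 -> int, (forall k, `|w1 * (tau k)%:~R - u0 k| <= be) /\
    ((2 ^ (n1 - (n + g))) ^ d.+1 < 2 * #|[pred f : index (2 ^ (n1 - (n + g))) |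
       sparse e1 w1 A (subcell bx f) || sparse e1 w1 A (fun k => (subcell bx f k - tau k)%R)]|)%N) ->
  forall (c c' : index (2 ^ n)) x y, regular L A e1 g n n1 (corner c) -> regular L A e1 g n n1 (corner c') ->
  middle (corner c) x -> middle (corner c') y -> edist y x <> r.
Proof.
move=> r0 LP c c' x y reg reg' mx my xyr.
have be0 : 0 < be by exact: side_gt0.
have w10 : 0 < w1 by exact: side_gt0.
have {}mx k : side n * (corner c k)%:~R + 3 * be < x 0 k /\ x 0 k <= side n * (corner c k + 1)%:~R - 3 * be.
  by have := mx k; rewrite !mxE => /andP[].
have {}my k : side n * (corner c' k)%:~R + 3 * be < y 0 k /\ y 0 k <= side n * (corner c' k + 1)%:~R - 3 * be.
  by have := my k; rewrite !mxE => /andP[].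
pose u0 k := y 0 k - x 0 k.
pose bx := cell_index be y.
have hbx k : be * (bx k)%:~R < y 0 k /\ y 0 k <= be * (bx k + 1)%:~R.
  by have /cellP/(_ k)/andP[] := cell_indexP y be0.
have n0 : 0 < side n by exact: side_gt0.
have u0r : \sum_k u0 k ^+ 2 = r ^+ 2.
  by rewrite -xyr /edist sqr_sqrtr// sumr_ge0// => k _; exact: sqr_ge0.
have bE k : be * (bx k + 1)%:~R = be * (bx k)%:~R + be by rewrite intrD mulrDr mulr1.
have cL (c0 : index (2 ^ n)) k : 0 <= side n * (corner c0 k)%:~R /\ side n * (corner c0 k + 1)%:~R <= L.
  split; first by rewrite mulr_ge0 ?(ltW n0)// ler0z.
  have LE : L = side n * ((2 ^ n)%N%:Z)%:~R by rewrite -pmulrn divfK// lt0r_neq0// pow2_gt0.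
  by rewrite [leRHS]LE ler_pM2l// ler_int /corner; have := ltn_ord (c0 k); clear; lia.
have [k|k|tau [tau_u few]] := LP u0 bx u0r.
- have [h1 h2] := hbx k; have [h3 h4] := mx k; have [h5 h6] := cL c k; rewrite bE in h2.
  by rewrite /u0; move: h1 h2 h3 h5; clear; lra.
- have [h1 h2] := hbx k; have [h3 h4] := mx k; have [h5 h6] := cL c k.
  by rewrite bE /u0; move: h1 h4 h6; clear; lra.
have KE : (2 ^ (n1 - (n + g)))%:R * w1 = be by exact: side_refine.
have fE (f : index (2 ^ (n1 - (n + g)))) k : w1 * (subcell bx f k)%:~R = be * (bx k)%:~R + w1 * (f k)%:R.
  by rewrite /subcell intrD intrM -!pmulrn -KE; ring.
have f_ge (f : index (2 ^ (n1 - (n + g)))) k : 0 <= w1 * (f k)%:R by rewrite mulr_ge0// ltW.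
have f_lt (f : index (2 ^ (n1 - (n + g)))) k : w1 * (f k)%:R < be.
  by rewrite -KE mulrC ltr_pM2r// ltr_nat.
have inj1 : injective (fun f : index (2 ^ (n1 - (n + g))) => subcell bx f) by exact: subcell_inj.
have inj2 : injective (fun (f : index (2 ^ (n1 - (n + g)))) k => subcell bx f k - tau k).
  move=> f f' h; apply: (@subcell_inj d _ bx); apply/funext => k.
  by have := congr1 (@^~ k) h => /addIr.
have le1 := @card_subcell_le d _ (2 ^ (n1 - n)) (corner c') (sparse e1 w1 A) _ inj1.
have le2 := @card_subcell_le d _ (2 ^ (n1 - n)) (corner c) (sparse e1 w1 A) _ inj2.
have {}le1 := leq_trans (leq_mul (leqnn 4) (le1 _)) reg'.
have {}le2 := leq_trans (leq_mul (leqnn 4) (le2 _)) reg.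
move: few; apply/negP; rewrite -leqNgt.
apply: (@quarter_count _ _ _ _ (le1 _) (le2 _)).
- move=> f k; apply: index_bounds; rewrite fE; have [h1 h2] := hbx k; rewrite bE in h2.
  have [h3 h4] := my k; have h5 := f_ge f k; have h6 := f_lt f k.
  by move: be0 h1 h2 h3 h4 h5 h6; clear; move=> *; apply/andP; split; lra.
- move=> f k; apply: index_bounds; rewrite intrB mulrBr fE; have [h1 h2] := hbx k; rewrite bE in h2.
  have [h3 h4] := mx k; have h5 := f_ge f k; have h6 := f_lt f k.
  have := tau_u k; rewrite /u0 ler_norml => /andP[h7 h8].
  by move: be0 h1 h2 h3 h4 h5 h6 h7 h8; clear; move=> *; apply/andP; split; lra.
by rewrite -cardUI; apply: leq_trans (leq_addr _ _); apply: eq_leq; apply: eq_card.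
Qed.

End Middles.

(** * The upper bound *)

Section CellBounds.
Variables (R : realType) (d : nat) (L : R).
Hypothesis L0 : 0 < L.
Local Notation V := 'rV[R]_d.+1.
Local Notation index n := {ffun 'I_d.+1 -> 'I_n}.
Local Notation side n := (L / (2 ^ n)%:R).

Lemma cell_rleb_le (w s : R) D (A : set V) c : 0 < w -> 0 <= s -> (forall x, D x -> x <= s) ->
  lebesgue_measurable A -> avoiding D A ->
  rleb (A `&` cell w c) <= mden d D * (w + s) ^+ d.+1.
Proof.
move=> w0 s0 Ds mA aA; have fC : finm (A `&` cell w c).
  by apply: finmS (@finm_cell R d w c w0); exact: subIsetr.
pose v : V := \row_i (w * (- c i)%:~R).
have -> : rleb (A `&` cell w c) = rleb (affine 1 v (A `&` cell w c)).
  by rewrite rleb_affine// expr1n mul1r.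
apply: rleb_le_mden => //.
- apply: measurable_affine => //; apply: caratheodory_measurable_setI => //; exact: measurable_cell.
- exact: translate_cell0.
- by apply: avoiding_translate; apply: avoidingS aA; exact: subIsetl.
Qed.

Lemma middle_sub g n (c : 'I_d.+1 -> int) : middle L g n c `<=` cell (side n) c.
Proof.
move=> x hx; apply/cellP => k; have := hx k; rewrite !mxE => /andP[h1 h2].
have b0 := @side_gt0 R L L0 (n + g).
by apply/andP; split; move: b0 h1 h2; clear; lra.
Qed.

Lemma corner_cell_sub n (c : index (2 ^ n)) : cell (side n) (corner c) `<=` cell L (fun=> 0).
Proof.
move=> x /cellP hx; apply/cellP => k; have /andP[h1 h2] := hx k.
have s0 := @side_gt0 R L L0 n.
rewrite mulr0 add0r mulr1; apply/andP; split.
  by apply: le_lt_trans h1; rewrite mulr_ge0 ?(ltW s0)// ler0z.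
apply: le_trans h2 _; have LE : L = side n * ((2 ^ n)%N%:Z)%:~R by rewrite -pmulrn divfK// lt0r_neq0// pow2_gt0.
by rewrite [leRHS]LE ler_pM2l// ler_int /corner; have := ltn_ord (c k); clear; lia.
Qed.

(** The union of the selected middles is itself a [D]-avoiding subset of the large cell. *)
Lemma card_middles_le (S : R) D g n (P : pred (index (2 ^ n))) : 0 <= S -> (forall x, D x -> x <= S) ->
  6 * side (n + g) <= side n ->
  (forall c c' x y, P c -> P c' -> middle L g n (corner c) x -> middle L g n (corner c') y -> ~ D (edist x y)) ->
  #|P|%:R * (side n - 6 * side (n + g)) ^+ d.+1 <= mden d D * (L + S) ^+ d.+1.
Proof.
move=> S0 DS hs hP.
have s0 := @side_gt0 R L L0 n.
pose U : set V := \bigcup_(c in [set` P]) middle L g n (corner c).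
have mM c : lebesgue_measurable (middle L g n c : set V) by exact: measurable_box.
have UL : U `<=` cell L (fun=> 0) by move=> x [c _ /middle_sub]; exact: corner_cell_sub.
have fU : finm U by apply: finmS UL _; exact: finm_cell.
have mU : lebesgue_measurable U.
  rewrite /U bigcup_pred; apply: (big_ind (fun X : set V => lebesgue_measurable X)) => //.
    exact: caratheodory_measurable_set0.
  by move=> X Y mX mY; exact: caratheodory_measurable_setU.
have aU : avoiding D U by move=> x y [c Pc cx] [c' Pc' cy]; exact: hP Pc Pc' cx cy.
apply: le_trans (rleb_le_mden L0 S0 DS mU UL aU).
have disj c c' x : P c -> P c' -> middle L g n (corner c) x -> middle L g n (corner c') x -> c = c'.
  move=> _ _ /middle_sub h1 /middle_sub h2; have h := cell_inj s0 h1 h2.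
  by apply/ffunP => k; apply/val_inj; have := congr1 (@^~ k) h => -[].
apply: le_trans (rleb_sum_disj_le fU (fun c _ => mM (corner c)) disj).
rewrite mulr_natl -sumr_const; apply: ler_sum => c Pc.
rewrite [U `&` _]setIC setIidl; last by move=> x cx; exists c.
rewrite rleb_box; last first.
  by move=> k; rewrite !mxE intrD mulrDr mulr1; move: hs; clear; lra.
rewrite /box_volume -[X in _ ^+ X]card_ord -prodr_const; apply: ler_prod => k _.
rewrite subr_ge0 hs/= !mxE intrD mulrDr mulr1; clear; lra.
Qed.

End CellBounds.

(** For [y] the proportion of good cells; [2 * x] stands for the cells of density below [x] and for
    the irregular ones. The bound on [x] ensures [(1 + x) ^+ 2 <= (1 + 4 * x) * (1 - x)]. *)
Lemma density_budget (R : realType) (m m' x y : R) : 0 <= m -> 0 <= m' -> m * m' <= 1 -> 0 <= x -> x <= 1 / 8 ->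
  y * (1 - x) <= m * (1 + x) -> 2 * x + y * (m' * (1 + x)) <= m * m' + 8 * x.
Proof.
move=> m0 m'0 mm x0 x8 h.
have h1 : y * (1 + x) <= m * (1 + 4 * x).
  have p : 0 < 1 - x by lra.
  rewrite -(ler_pM2r p).
  have -> : y * (1 + x) * (1 - x) = y * (1 - x) * (1 + x) by ring.
  have p' : 0 <= 1 + x by lra.
  apply: le_trans (ler_wpM2r p' h) _; rewrite -!mulrA; apply: ler_wpM2l => //.
  rewrite -subr_ge0; have -> : (1 + 4 * x) * (1 - x) - (1 + x) * (1 + x) = x * (1 - 5 * x) by ring.
  by rewrite mulr_ge0//; lra.
have -> : y * (m' * (1 + x)) = y * (1 + x) * m' by ring.
have h2 := ler_wpM2r m'0 h1.
have h3 : m * (1 + 4 * x) * m' <= m * m' + 4 * x.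
  have -> : m * (1 + 4 * x) * m' = m * m' + 4 * x * (m * m') by ring.
  by rewrite lerD2l ler_piMr// mulr_ge0.
lra.
Qed.

(* The property provided by [local_gap], for all the distances of [D] at once. *)
Definition separating (R : realType) (d : nat) (L e1 : R) (nB : nat) (D : set R) (n1 : nat) : Prop :=
  (nB <= n1)%N /\
  forall A : set 'rV[R]_d.+1, lebesgue_measurable A ->
  A `<=` cell L (fun=> 0) -> forall r, D r -> (forall x y, A x -> A y -> edist x y <> r) ->
  forall (u0 : 'I_d.+1 -> R) (bx : 'I_d.+1 -> int), \sum_k u0 k ^+ 2 = r ^+ 2 ->
  (forall k, 2 * (L / (2 ^ nB)%:R) <= L / (2 ^ nB)%:R * (bx k)%:~R - u0 k) ->
  (forall k, L / (2 ^ nB)%:R * (bx k + 1)%:~R - u0 k + 2 * (L / (2 ^ nB)%:R) <= L) ->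
  exists tau : 'I_d.+1 -> int, (forall k, `|L / (2 ^ n1)%:R * (tau k)%:~R - u0 k| <= L / (2 ^ nB)%:R) /\
    ((2 ^ (n1 - nB)) ^ d.+1 < 2 * #|[pred f : {ffun 'I_d.+1 -> 'I_(2 ^ (n1 - nB))} |
       sparse e1 (L / (2 ^ n1)%:R) A (subcell bx f) ||
       sparse e1 (L / (2 ^ n1)%:R) A (fun k => (subcell bx f k - tau k)%R)]|)%N.

Lemma exists_separating (R : realType) (d : nat) (L e1 : R) (nB : nat) (D : set R) :
  (0 < d)%N -> 0 < L -> 0 < e1 -> e1 <= 1 -> finite_set D -> (forall r, D r -> 0 < r) ->
  exists n1, separating d L e1 nB D n1.
Proof.
move=> d0 L0 e10 e11 /finite_seqP[ds ->] Dpos.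
suff [n0 h] : exists n0, forall n1, (n0 <= n1)%N -> separating d L e1 nB [set` ds] n1.
  by exists n0; exact: h.
elim: ds Dpos => [|r ds IH] Dpos; first by exists nB => n1 h; split.
have r0 : 0 < r by apply: Dpos; rewrite /= inE eqxx.
have [|n0 h0] := IH; first by move=> r' r'ds; apply: Dpos; rewrite /= inE r'ds orbT.
have [n0' [nB0 h0']] := @local_gap R d L r e1 nB d0 L0 r0 e10 e11.
exists (maxn n0 n0') => n1; rewrite geq_max => /andP[n01 n01'].
split; first exact: leq_trans n01'.
move=> A mA AL r' /=; rewrite inE => /orP[/eqP ->|r'ds] Ar; first exact: h0' n01' mA AL Ar.
by have [_] := h0 _ n01; apply.
Qed.

Lemma density_step (R : realType) (d : nat) (L x S eta : R) (n g n1 : nat) (D D' : set R)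
    (A : set 'rV[R]_d.+1) :
  0 < L -> 0 < x -> x <= 1 / 8 -> 0 <= S -> 0 <= eta -> (n + g <= n1)%N ->
  (forall r, D r -> 0 < r) -> (forall r, D r -> r <= S) -> (forall r, D' r -> r <= eta) ->
  (L + S) ^+ d.+1 <= (1 + x) * L ^+ d.+1 ->
  (L / (2 ^ n)%:R + eta) ^+ d.+1 <= (1 + x) * (L / (2 ^ n)%:R) ^+ d.+1 ->
  6 * (L / (2 ^ (n + g))%:R) <= L / (2 ^ n)%:R ->
  (1 - x) * (L / (2 ^ n)%:R) ^+ d.+1 <= (L / (2 ^ n)%:R - 6 * (L / (2 ^ (n + g))%:R)) ^+ d.+1 ->
  separating d L x (n + g) D n1 ->
  lebesgue_measurable A -> A `<=` cell L (fun=> 0) -> avoiding (D `|` D') A ->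
  #|irregular L A x g n n1|%:R <= x * (2 ^ n)%:R ^+ d.+1 ->
  rleb A <= (mden d D * mden d D' + 8 * x) * L ^+ d.+1.
Proof.
move=> L0 x0 x8 S0 eta0 ngn1 Dpos DS D'e LS we h6 h6D [_ sep] mA AL aA irr.
set m := mden d D; set m' := mden d D'.
have m0 : 0 <= m by exact: mden_ge0.
have m'0 : 0 <= m' by exact: mden_ge0.
have s0 := @side_gt0 R L L0 n; move: we h6 h6D s0.
have sE : (2 ^ n)%:R * (L / (2 ^ n)%:R) = L.
  by rewrite mulrC divfK// lt0r_neq0// pow2_gt0.
move: sE; set s := L / (2 ^ n)%:R => sE we h6 h6D s0.
have fA : finm A by apply: finmS AL _; exact: finm_cell.
have sD : 0 < s ^+ d.+1 by rewrite exprn_gt0.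
have LD : 0 < L ^+ d.+1 by rewrite exprn_gt0.
pose good := [pred c : {ffun 'I_d.+1 -> 'I_(2 ^ n)} |
  (x <= dens L A n (corner c)) && regular L A x g n n1 (corner c)].
have splitA : rleb A = \sum_(c : {ffun 'I_d.+1 -> 'I_(2 ^ n)}) rleb (A `&` cell s (corner c)).
  have -> : rleb A = rleb (A `&` cell ((2 ^ n)%:R * s) (fun=> 0)) by rewrite sE (setIidl AL).
  rewrite (rleb_subcell _ s0) ?expn_gt0//; apply: eq_bigr => c _; congr (rleb (_ `&` cell _ _)).
  by apply/funext => k; rewrite /subcell mulr0 add0r.
have aD : avoiding D A by move=> y z Ay Az Dyz; apply: (aA y z Ay Az); left.
have aD' : avoiding D' A by move=> y z Ay Az Dyz; apply: (aA y z Ay Az); right.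
(* A cell has density below [x], or is irregular, or is good. In a good one [A] still avoids [D'],
   whose distances are short compared with the side. *)
have cell_le (c : {ffun 'I_d.+1 -> 'I_(2 ^ n)}) : rleb (A `&` cell s (corner c)) <=
    s ^+ d.+1 * (x + (irregular L A x g n n1 c)%:R + (good c)%:R * (m' * (1 + x))).
  have g0 : 0 <= (good c)%:R * (m' * (1 + x)).
    by rewrite !mulr_ge0// addr_ge0// ltW.
  have dE : rleb (A `&` cell s (corner c)) = s ^+ d.+1 * dens L A n (corner c).
    by rewrite /dens -/s mulrC divfK// lt0r_neq0.
  have [dx|dx] := leP x (dens L A n (corner c)); last first.
    rewrite dE ler_pM2l//; apply: le_trans (ltW dx) _.
    by rewrite -addrA lerDl addr_ge0.
  have [reg|nreg] := boolP (regular L A x g n n1 (corner c)); last first.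
    rewrite dE ler_pM2l//; apply: le_trans (@dens_le1 R d L A L0 n (corner c)) _.
    have -> : irregular L A x g n n1 c = true by rewrite /irregular/= dx nreg.
    by rewrite addrAC lerDr addr_ge0// ltW.
  apply: le_trans (cell_rleb_le (corner c) s0 eta0 D'e mA aD') _.
  have -> : good c = true by rewrite /good/= dx reg.
  rewrite mul1r -/m'; apply: le_trans (ler_wpM2l m'0 we) _.
  have -> : m' * ((1 + x) * s ^+ d.+1) = s ^+ d.+1 * (m' * (1 + x)) by ring.
  by rewrite ler_pM2l// lerDr addr_ge0// ltW.
have := ler_sum (index_enum _) (fun c (_ : true) => cell_le c).
rewrite -splitA -mulr_sumr !big_split/= -mulr_suml -!natr_sum sumr_const card_ffun !card_ord.
have cE (P : pred {ffun 'I_d.+1 -> 'I_(2 ^ n)}) : (\sum_c (P c : nat))%N = #|P|.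
  by rewrite -sum1_card [RHS]big_mkcond; apply: eq_bigr => c _; rewrite -topredE/=; case: (P c).
rewrite !cE => leA; apply: le_trans leA _.
have avoidM c c' y z : good c -> good c' -> middle L g n (corner c) y -> middle L g n (corner c') z ->
    ~ D (edist y z).
  move=> /andP[_ rc] /andP[_ rc'] my mz Dyz.
  have noA y1 y2 : A y1 -> A y2 -> edist y1 y2 <> edist y z.
    by move=> A1 A2 e; apply: (aD _ _ A1 A2); rewrite e.
  exact: (middles_avoid L0 ngn1 (Dpos _ Dyz) (sep A mA AL _ Dyz noA) rc' rc mz my).
have hg := card_middles_le L0 S0 DS h6 avoidM.
set G := #|good|%:R in hg *; set I := #|irregular _ _ _ _ _ _|%:R in irr *.
pose y := G * s ^+ d.+1 / L ^+ d.+1.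
have hy : y * (1 - x) <= m * (1 + x).
  rewrite /y mulrAC ler_pdivrMr//.
  have h1 : G * ((1 - x) * s ^+ d.+1) <= m * (L + S) ^+ d.+1.
    by apply: le_trans hg; apply: ler_wpM2l.
  have -> : G * s ^+ d.+1 * (1 - x) = G * ((1 - x) * s ^+ d.+1) by ring.
  by apply: le_trans h1 _; rewrite -mulrA; exact: ler_wpM2l.
have mm : m * m' <= 1 by rewrite mulr_ile1// ?mden_le1.
have := density_budget m0 m'0 mm (ltW x0) x8 hy.
rewrite -(ler_pM2r LD) => /(le_trans _); apply.
have LE : L ^+ d.+1 = s ^+ d.+1 * (2 ^ n)%:R ^+ d.+1 by rewrite -exprMn mulrC sE.
have -> : (2 * x + y * (m' * (1 + x))) * L ^+ d.+1 = 2 * x * L ^+ d.+1 + G * s ^+ d.+1 * (m' * (1 + x)).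
  by rewrite /y; field; exact: lt0r_neq0.
have -> : x *+ (2 ^ n) ^ d.+1 = x * (2 ^ n)%:R ^+ d.+1 by rewrite -natrX mulr_natr.
rewrite LE; have := ler_wpM2l (ltW sD) irr; clear.
by lra.
Qed.

Lemma finite_set_bound (R : realType) (D : set R) : finite_set D ->
  exists2 S, 0 <= S & forall r, D r -> r <= S.
Proof.
move=> /finite_seqP[ds ->]; exists (\sum_(r <- ds) `|r|); first exact: sumr_ge0.
move=> r /= rds; rewrite (big_rem r)//=; apply: le_trans (ler_norm r) _.
by rewrite lerDl sumr_ge0.
Qed.

Lemma mden_union_le (R : realType) (d : nat) (D : set R) (e : R) :
  (0 < d)%N -> finite_set D -> (forall r, D r -> 0 < r) -> 0 < e ->
  exists2 eta, 0 < eta & forall D' : set R, (forall r, D' r -> r <= eta) ->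
    mden d (D `|` D') <= mden d D * mden d D' + e.
Proof.
move=> d0 Dfin Dpos e0.
pose x : R := Num.min e 1 / 8.
have x0 : 0 < x by rewrite divr_gt0// lt_min e0 ltr01.
have x8 : x <= 1 / 8 by rewrite ler_pM2r ?invr_gt0// ge_min lexx orbT.
have xe : 8 * x <= e by rewrite /x mulrC divfK// ge_min lexx.
clearbody x.
have x1 : x <= 1 by move: x8; clear; lra.
have [S S0 DS] := finite_set_bound Dfin.
have [dl dl0 hdl] := expr1D_perturb d.+1 x0.
have perturb (w s : R) : 0 < w -> 0 <= s -> s <= dl * w -> (w + s) ^+ d.+1 <= (1 + x) * w ^+ d.+1.
  move=> w0 s0 sw; have wn0 : w != 0 by exact: lt0r_neq0.
  have -> : w + s = (1 + s / w) * w by field.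
  rewrite exprMn ler_pM2r ?exprn_gt0//; apply: hdl.
  by rewrite divr_ge0 ?(ltW w0)//= ler_pdivrMr.
pose L := S / dl + 1.
have L0 : 0 < L by rewrite ltr_wpDl// divr_ge0// ltW.
have SL : S <= dl * L by rewrite /L mulrDr mulrC divfK ?lt0r_neq0// lerDl mulr1 ltW.
clearbody L.
have LS := perturb L S L0 S0 SL.
have dR : 0 < d.+1%:R :> R by rewrite ltr0n.
(* The margins take six cells of level [n + g] off each side; by Bernoulli's inequality this [g]
   limits the loss of volume to a proportion [x]. *)
have [g hg] := @ex_pow2_small R 1 (x / (6 * d.+1%:R)) ltac:(by rewrite divr_gt0// mulr_gt0).
have p2 q : 0 < (2 ^ q)%:R :> R := pow2_gt0 R q.
pose th : R := 6 / (2 ^ g)%:R.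
have th0 : 0 <= th by rewrite divr_ge0// ltW.
have hth : d.+1%:R * th <= x.
  move: hg; rewrite ler_pdivlMr ?mulr_gt0// div1r => hg.
  by apply: le_trans hg; rewrite /th mulrCA [leRHS]mulrC -[leRHS]mulrA.
have th1 : th <= 1.
  apply: le_trans x1; apply: le_trans hth; rewrite ler_peMl//.
  by rewrite (ler_nat _ 1).
have sideE n : 6 * (L / (2 ^ (n + g))%:R) = th * (L / (2 ^ n)%:R).
  rewrite /th expnD natrM invfM; clear; ring.
pose gain := x ^+ 2 / (16 * (2 ^ g)%:R ^+ d.+1).
have gx0 : 0 < gain * x by rewrite mulr_gt0// divr_gt0 ?exprn_gt0// mulr_gt0// exprn_gt0.
pose J := (Num.truncn (gain * x)^-1).+1.
have hJ : 1 < J%:R * (gain * x).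
  by rewrite -ltr_pdivrMr// div1r; exact: truncnS_gt.
have [N0 hN0] := choice (fun n => @exists_separating R d L x (n + g) D d0 L0 x0 x1 Dfin Dpos).
pose ns i := iter i N0 0%N.
have ns_sep i : separating d L x (ns i + g) D (ns i.+1) by exact: hN0.
have ns_le i : (ns i + g <= ns i.+1)%N by have [] := ns_sep i.
have ns_mono i : (i <= J)%N -> (ns i <= ns J)%N.
  move=> iJ; rewrite -(subnKC iJ); elim: (J - i)%N => [|k IH]; first by rewrite addn0.
  by rewrite addnS; apply: leq_trans IH (leq_trans (leq_addr g _) (ns_le _)).
(* Short compared with the finest level that may be selected, hence with all of them. *)
exists (dl * (L / (2 ^ ns J)%:R)); first by rewrite mulr_gt0// divr_gt0.
set eta := dl * _ => D' D'e.
have eta0 : 0 <= eta by rewrite mulr_ge0 ?(ltW dl0)// ltW// divr_gt0.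
have m0 := mden_ge0 d D; have m'0 := mden_ge0 d D'.
apply: (mden_le L0) => [|A mA AL aA]; first by rewrite addr_ge0 ?mulr_ge0 ?(ltW e0).
have fA : finm A by apply: finmS AL _; exact: finm_cell.
have [i iJ irr] := exists_regular_level L0 fA x0 x0 ns_le hJ.
have s0 : 0 < L / (2 ^ ns i)%:R by rewrite divr_gt0.
apply: le_trans (_ : _ <= (mden d D * mden d D' + 8 * x) * L ^+ d.+1) _; last first.
  by rewrite ler_pM2r ?exprn_gt0// lerD2l.
apply: (density_step L0 x0 x8 S0 eta0 (ns_le i) Dpos DS D'e LS _ _ _ (ns_sep i) mA AL aA irr).
- apply: perturb => //; rewrite ler_pM2l// ler_pM2l// lef_pV2 ?posrE// ler_nat leq_exp2l//.
  by apply: ns_mono; exact: ltnW.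
- by rewrite sideE ler_piMl// ltW.
rewrite sideE; move: s0; set s := L / _ => s0; clearbody s.
have -> : s - th * s = (1 - th) * s by ring.
rewrite exprMn ler_pM2r ?exprn_gt0//.
apply: le_trans (bernoulli_le _ _); last by rewrite th0 th1.
by rewrite lerD2l lerN2.
Qed.

Lemma mden_set0 (R : realType) d : mden d (@set0 R) = 1.
Proof.
apply/eqP; rewrite eq_le mden_le1/=.
have mC := @measurable_cell R d 1 (fun=> 0).
have := @rleb_le_mden R d 1 0 set0 _ ltr01 (lexx 0) _ mC (fun x h => h).
by rewrite rleb_cell// addr0 !expr1n mulr1; apply => [x []|x y _ _ []].
Qed.

(** * Products over several scales *)

Section Products.
Variables (R : realType) (d : nat).

Lemma bigcup_dilate_ord_recl k (D : 'I_k.+1 -> set R) (t : 'I_k.+1 -> R) :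
  \bigcup_i dilate (t i) (D i) = dilate (t ord0) (D ord0) `|`
    \bigcup_i dilate (t (lift ord0 i)) (D (lift ord0 i)).
Proof.
apply/seteqP; split=> x.
  move=> [i _ Dx]; have [j ij|i0] := unliftP ord0 i.
    by right; exists j => //; rewrite -ij.
  by left; rewrite -i0.
by move=> [Dx|[i _ Dx]]; [exists ord0|exists (lift ord0 i)].
Qed.

Lemma dilate_bound (D : set R) (t S : R) : 0 < t -> (forall r, D r -> r <= S) ->
  forall r, dilate t D r -> r <= t * S.
Proof. by move=> t0 DS _ [r Dr <-]; rewrite ler_pM2l// DS. Qed.

Lemma bigcup_dilate_bound k (D : 'I_k -> set R) (t : 'I_k -> R) (S : 'I_k -> R) :
  (forall i, 0 < t i) -> (forall i, 0 <= S i) -> (forall i r, D i r -> r <= S i) ->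
  forall r, (\bigcup_i dilate (t i) (D i)) r -> r <= \sum_i t i * S i.
Proof.
move=> t0 S0 DS r [i _ /(dilate_bound (t0 i) (DS i)) rS].
apply: le_trans rS _; rewrite (bigD1 i)//= lerDl sumr_ge0// => j _.
by rewrite mulr_ge0// ltW.
Qed.

Lemma finite_bounds k (D : 'I_k -> set R) : (forall i, finite_set (D i)) ->
  exists S : 'I_k -> R, (forall i, 0 <= S i) /\ forall i r, D i r -> r <= S i.
Proof.
move=> fD; have h i : exists s, 0 <= s /\ forall r, D i r -> r <= s.
  by have [s s0 Ds] := finite_set_bound (fD i); exists s.
have [S hS] := choice h.
by exists S; split=> i; have [] := hS i.
Qed.

Lemma prod_mden_le k (D : 'I_k -> set R) (t : 'I_k -> R) : (forall i, finite_set (D i)) ->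
  (forall i, 0 < t i) -> \prod_i mden d (D i) <= mden d (\bigcup_i dilate (t i) (D i)).
Proof.
elim: k D t => [|k IH] D t fD t0.
  rewrite big_ord0; suff -> : \bigcup_i dilate (t i) (D i) = set0 by rewrite mden_set0.
  by apply/seteqP; split=> x // -[[]].
have [S [S0 DS]] := finite_bounds fD.
rewrite big_ord_recl bigcup_dilate_ord_recl.
set X := \bigcup_i _; pose b := \sum_(i < k) t (lift ord0 i) * S (lift ord0 i).
have b0 : 0 <= b by apply: sumr_ge0 => i _; rewrite mulr_ge0// ltW.
have Xb : forall r, X r -> r <= b.
  exact: (bigcup_dilate_bound (fun i => t0 (lift ord0 i)) (fun i => S0 (lift ord0 i)) (fun i => DS (lift ord0 i))).
have tS : 0 <= t ord0 * S ord0 by rewrite mulr_ge0// ltW.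
have Db := dilate_bound (t0 ord0) (DS ord0).
apply: le_trans (_ : mden d (dilate (t ord0) (D ord0)) * mden d X <= _).
  rewrite (mden_dilate d (t0 ord0) (S0 ord0) (DS ord0)) ler_wpM2l ?mden_ge0//.
  exact: (IH (fun i => D (lift ord0 i)) (fun i => t (lift ord0 i))).
apply: (@mden_mul_le R d (t ord0 * S ord0 + b)) => [|r /Db h|r /Xb h].
- by rewrite addr_ge0.
- by apply: le_trans h _; rewrite lerDl.
- by apply: le_trans h _; rewrite lerDr.
Qed.

Lemma ratio_chain k (t : 'I_k.+1 -> R) (La : R) : 1 <= La -> (forall i, 0 < t i) ->
  (forall i j : 'I_k.+1, j = i.+1 :> nat -> La <= t i / t j) ->
  forall i : 'I_k, t (lift ord0 i) <= t ord0 / La.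
Proof.
move=> La1 t0 ht; have La0 : 0 < La by apply: lt_le_trans La1.
have step (i j : 'I_k.+1) : j = i.+1 :> nat -> t j <= t i / La.
  by move=> /ht; rewrite !ler_pdivlMr// mulrC.
suff h n (hn : (n.+1 < k.+1)%N) : t (Ordinal hn) <= t ord0 / La.
  move=> i; have hi : (i.+1 < k.+1)%N by rewrite ltnS.
  by have -> : lift ord0 i = Ordinal hi; [apply/val_inj; rewrite /= /bump|exact: h].
elim: n hn => [|n IH] hn; first exact: step.
have hn' : (n.+1 < k.+1)%N by exact: ltnW.
apply: le_trans (IH hn'); apply: le_trans (step (Ordinal hn') _ _) _ => //.
by rewrite ler_pdivrMr// ler_peMr// ltW.
Qed.

Hypothesis d0 : (0 < d)%N.

(** The first scale is the largest. After division by [t ord0] all other distances are at most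
    [eta], and [mden_union_le] applies with [D'] the union of all the other scales at once. *)
Lemma mden_le_prod k (D : 'I_k -> set R) (e : R) : (forall i, finite_set (D i)) ->
  (forall i r, D i r -> 0 < r) -> 0 < e ->
  exists La : R, forall t : 'I_k -> R, (forall i, 0 < t i) ->
    (forall i j : 'I_k, j = i.+1 :> nat -> La <= t i / t j) ->
    mden d (\bigcup_i dilate (t i) (D i)) <= \prod_i mden d (D i) + e.
Proof.
elim: k D e => [|k IH] D e fD Dpos e0.
  exists 0 => t _ _; rewrite big_ord0; apply: le_trans (mden_le1 _ _) _.
  by rewrite lerDl ltW.
have e20 : 0 < e / 2 by rewrite divr_gt0.
have [La1 hLa1] := IH (fun i => D (lift ord0 i)) (e / 2) (fun i => fD _) (fun i => Dpos _) e20.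
have [eta eta0 heta] := mden_union_le d0 (fD ord0) (Dpos ord0) e20.
have [S [S0 DS]] := finite_bounds fD.
pose b := \sum_i S i.
have b0 : 0 <= b by apply: sumr_ge0.
have Sb i : S i <= b by rewrite /b (bigD1 i)//= lerDl sumr_ge0.
(* [La1] serves the induction, 1 allows [ratio_chain], and [b / eta] brings the other scales below
   [eta]. *)
exists (Num.max La1 (Num.max 1 (b / eta))) => t t0; set La := Num.max _ _ => ht.
have La_ge1 : 1 <= La by rewrite !le_max lexx !orbT.
have La_geb : b / eta <= La by rewrite !le_max lexx !orbT.
have La0 : 0 < La by exact: lt_le_trans La_ge1.
have chain := ratio_chain La_ge1 t0 ht.
have t00 := t0 ord0; have tn0 : t ord0 != 0 by exact: lt0r_neq0.
have rest : mden d (\bigcup_i dilate (t (lift ord0 i)) (D (lift ord0 i))) <=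
    \prod_i mden d (D (lift ord0 i)) + e / 2.
  apply: (hLa1 (fun i => t (lift ord0 i))) => // i j ij.
  apply: le_trans (ht (lift ord0 i) (lift ord0 j) _); first by rewrite !le_max lexx.
  by rewrite /= /bump/= ij.
rewrite bigcup_dilate_ord_recl big_ord_recl.
move: rest; set X := \bigcup_i _; set P := \prod_(i < k) _ => rest.
have Xb : forall r, X r -> r <= t ord0 * eta.
  move=> _ [i _ [r Dr <-]]; have rb : r <= b by exact: le_trans (DS _ _ Dr) (Sb _).
  apply: le_trans (ler_wpM2l (ltW (t0 _)) rb) _.
  apply: le_trans (ler_wpM2r b0 (chain i)) _.
  rewrite -mulrA ler_pM2l// mulrC ler_pdivrMr//.
  by move: La_geb; rewrite ler_pdivrMr// mulrC.
have te0 : 0 <= t ord0 * eta by rewrite mulr_ge0 ?(ltW t00)// ltW.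
pose Y := dilate (t ord0)^-1 X.
have XY : X = dilate (t ord0) Y.
  apply/seteqP; split=> [x Xx|_ [_ [x Xx <-] <-]].
    by exists ((t ord0)^-1 * x); [exists x|rewrite mulrA mulfV ?mul1r].
  by rewrite mulrA mulfV ?mul1r.
have Yb : forall r, Y r -> r <= eta.
  by move=> _ [x /Xb xb <-]; rewrite mulrC ler_pdivrMr// mulrC.
have -> : mden d (dilate (t ord0) (D ord0) `|` X) = mden d (D ord0 `|` Y).
  have -> : dilate (t ord0) (D ord0) `|` X = dilate (t ord0) (D ord0 `|` Y).
    by rewrite {1}XY /dilate image_setU.
  apply: (@mden_dilate R d (t ord0) (S ord0 + eta)) => //.
    by rewrite addr_ge0// ltW.
  move=> r [/DS|/Yb] h; apply: le_trans h _; first by rewrite lerDl ltW.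
  by rewrite lerDr.
apply: le_trans (heta Y Yb) _.
have -> : mden d Y = mden d X by rewrite XY (mden_dilate d t00 (ltW eta0) Yb).
have m0 := mden_ge0 d (D ord0); have m1 := mden_le1 d (D ord0).
have h1 := ler_wpM2l m0 rest.
have h2 : mden d (D ord0) * (e / 2) <= e / 2 by rewrite ler_piMl// ltW.
rewrite mulrDr in h1; have := splitr e; move: h1 h2; clear; lra.
Qed.

End Products.

Theorem theorem1 (R : realType) (d : nat) (hd : (2 <= d)%N)
  (k : nat) (hk : (0 < k)%N)
  (D : 'I_k -> set R)
  (D_finite : forall i, finite_set (D i))
  (D_pos : forall i x, D i x -> 0 < x)
  (T : Type) (F : set_system T) (F_filter : Filter F)
  (t : 'I_k -> T -> R)
  (t_pos : forall i s, 0 < t i s)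
  (t_ratio : forall i j : 'I_k, j = i.+1 :> nat ->
     t i s / t j s @[s --> F] --> +oo) :
  max_density d (\bigcup_i dilate (t i s) (D i)) @[s --> F] -->
    (\prod_(i < k) max_density d (D i))%E.
Proof.
case: d hd => [|d] // d1; have d0 : (0 < d)%N by [].
rewrite (eq_bigr _ (fun i _ => mdenE d (D i))) prodEFin.
under eq_fun do rewrite mdenE.
apply: cvg_EFin; first exact: nearW.
apply/cvgrPdist_le => e e0 /=.
have [La hLa] := mden_le_prod d0 D_finite D_pos e0.
(* The ratio conditions are finite in number, so they hold simultaneously along the filter. *)
have : \near F, forall i j : 'I_k, j = i.+1 :> nat -> La <= t i F / t j F.
  apply: filter_forall => i; apply: filter_forall => j.
  have [ij|nij] := eqVneq (j : nat) i.+1; last by apply: nearW => s /eqP; rewrite (negbTE nij).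
  by have /cvgryPge/(_ La) := t_ratio i j ij; apply: filterS.
apply: filterS => s hs.
have h1 := hLa (fun i => t i s) (fun i => t_pos i s) hs.
have h2 := prod_mden_le d D_finite (fun i => t_pos i s).
by rewrite ler_norml; apply/andP; split; move: h1 h2 (ltW e0); clear; lra.
Qed.
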